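(* Let $\mathcal A=\{A_1,\dots,A_m\}$ be an irreducible finite family of real $d\times d$ matrices that has a unique dominant product $\Pi$, and suppose that $\Pi$ has a unique and simple leading eigenvalue $\lambda$. If $\lambda$ is either real or complex with an irrational $\mathrm{mod}\ \pi$ argument, then $\mathcal A$ possesses a unique invariant body (up to multiplication by a positive constant). If $\lambda$ is real, then this invariant body is a polytope; if $\lambda$ is complex with an irrational $\mathrm{mod}\ \pi$ argument, then it is a convex hull of several (finitely many) ellipses.
   Context: Family: $\mathcal A=\{A_1,\dots,A_m\}$, $m\ge 1$, is irreducible if the matrices $A_i$ share no common invariant linear subspace other than $\{0\}$ and $\mathbb R^d$. $\mathcal A^k$ is the set of all products of $k$ matrices from $\mathcal A$ (repetitions permitted), $\mathcal A^{\mathbb N}=\bigcup_{k\ge1}\mathcal A^k$; products are regarded as words, $|\Pi|$ is the length of the product $\Pi$. $\rho(S)$ is the spectral radius of a matrix $S$; the joint spectral radius is $\rho(\mathcal A)=\lim_{n\to\infty}\max_{\Pi\in\mathcal A^n}\|\Pi\|^{1/n}$. Put $\nu(\Pi)=\rho(\Pi)^{1/|\Pi|}$. A convex body is a convex compact set with nonempty interior; convex bodies and polytopes are assumed symmetric about the origin, and ellipses are centered at the origin (an ellipse is a set $\{a\cos t+b\sin t: t\in\mathbb R\}$ with $a,b\in\mathbb R^d$). A convex body $G\subset\mathbb R^d$ is invariant for $\mathcal A$ if $\mathrm{co}\bigl(\bigcup_{i=1}^m A_iG\bigr)=\rho(\mathcal A)\,G$. A product is primitive if it is not a power of a shorter product.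 A set $\mathcal P\subset\mathcal A^{\mathbb N}$ is a set of dominant products if: (1) all its elements are primitive and none is a cyclic permutation of another; (2) there is $q$ with $\nu(\Pi)=q$ for all $\Pi\in\mathcal P$; (3) there is $\varepsilon>0$ such that every $S\in\mathcal A^{\mathbb N}$ satisfies $\nu(S)\le(1-\varepsilon)^{1/|S|}q$ unless $S$ is a power of some product from $\mathcal P$ or of one of its cyclic permutations. $\mathcal A$ has a unique dominant product $\Pi$ if $\mathcal P=\{\Pi\}$ is a set of dominant products. A leading eigenvalue of a matrix is an eigenvalue of largest modulus. It is unique and simple if $\lambda$ is not multiple and all other eigenvalues, except for $\bar\lambda$ when $\lambda\notin\mathbb R$, are strictly smaller in modulus. For $\lambda=|\lambda|e^{i\varphi}$ the argument is rational $\mathrm{mod}\ \pi$ if $\varphi/\pi\in\mathbb Q$, and irrational $\mathrm{mod}\ \pi$ otherwise. *)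

(* Defs.v *)
From HB Require Import structures.
From mathcomp Require Import all_boot all_order all_algebra.
From mathcomp Require Import complex.
From mathcomp Require Import all_classical all_reals all_analysis.

Set Implicit Arguments.
Unset Strict Implicit.
Unset Printing Implicit Defensive.

Import Order.TTheory GRing.Theory Num.Theory.
Import numFieldNormedType.Exports.

Local Open Scope classical_set_scope.
Local Open Scope ring_scope.
Local Open Scope complex_scope.

(* Modulus of a complex number, as an element of R. *)
Notation cmod := ComplexField.Normc.normc.

Definition complexify (R : realType) (d : nat) (M : 'M[R]_d) : 'M[R[i]]_d :=
  map_mx (real_complex R) M.

(* [eigenvalue] uses row eigenvectors; the eigenvalues are the same as for
   column vectors. *)
Definition spectral_radius (R : realType) (d : nat) (M : 'M[R]_d) : R :=
  sup [set cmod z | z in [set z : R[i] | eigenvalue (complexify M) z]].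

Definition leading_eigenvalue (R : realType) (d : nat) (M : 'M[R]_d)
    (l : R[i]) : Prop :=
  eigenvalue (complexify M) l /\
  forall z : R[i], eigenvalue (complexify M) z -> cmod z <= cmod l.

(* For real [l], the hypothesis [z <> conjc l] is the same as [z <> l]. *)
Definition unique_simple_leading (R : realType) (d : nat) (M : 'M[R]_d)
    (l : R[i]) : Prop :=
  [/\ leading_eigenvalue M l,
      mup l (char_poly (complexify M)) = 1%N &
      forall z : R[i], eigenvalue (complexify M) z ->
        z <> l -> z <> conjc l -> cmod z < cmod l].

Definition is_real (R : realType) (l : R[i]) : Prop := complex.Im l = 0.

Definition is_argument (R : realType) (l : R[i]) (phi : R) : Prop :=
  l = (cmod l * cos phi) +i* (cmod l * sin phi).

Definition complex_irrational_arg (R : realType) (l : R[i]) : Prop :=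
  ~ is_real l /\ exists2 phi : R, is_argument l phi & irrational (phi / pi).

(* A family is indexed by ['I_m]; products are words, i.e. nonempty sequences of
   indices. *)
Definition prod_word (R : realType) (d m : nat) (A : 'I_m -> 'M[R]_d)
    (w : seq 'I_m) : 'M[R]_d :=
  \prod_(i <- w) A i.

Definition wpow (T : Type) (n : nat) (w : seq T) : seq T := flatten (nseq n w).

Definition primitive (T : Type) (w : seq T) : Prop :=
  ~ exists (v : seq T) (n : nat), (size v < size w)%N /\ w = wpow n v.

Definition cyclic_perm (T : Type) (v w : seq T) : Prop :=
  exists k : nat, v = rot k w.

Definition nu (R : realType) (d m : nat) (A : 'I_m -> 'M[R]_d)
    (w : seq 'I_m) : R :=
  spectral_radius (prod_word A w) `^ (size w)%:R^-1.

(* The norm is the maximum of the moduli of the entries; the limit does not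
   depend on the choice of the norm. *)
Definition jsr (R : realType) (d m : nat) (A : 'I_m -> 'M[R]_d) : R :=
  limn (fun n : nat =>
    (\big[Num.max/0]_(w : n.-tuple 'I_m) `|prod_word A w|) `^ n%:R^-1).

(* The bound [e <= 1] keeps the base of the power [(1 - e) `^ _] nonnegative:
   [powR] takes the value 1 on negative bases. *)
Definition dominant_products (R : realType) (d m : nat) (A : 'I_m -> 'M[R]_d)
    (P : set (seq 'I_m)) : Prop :=
  [/\ forall w, P w -> w <> [::] /\ primitive w,
      forall v w, P v -> P w -> v <> w -> ~ cyclic_perm v w &
      exists q : R,
        (forall w, P w -> nu A w = q) /\
        exists e : R, [/\ 0 < e, e <= 1 &
          forall s : seq 'I_m, s <> [::] ->
            ~ (exists (w v : seq 'I_m) (n : nat),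
                 [/\ P w, cyclic_perm v w & s = wpow n v]) ->
            nu A s <= (1 - e) `^ (size s)%:R^-1 * q]].

Definition unique_dominant_product (R : realType) (d m : nat)
    (A : 'I_m -> 'M[R]_d) (w : seq 'I_m) : Prop :=
  dominant_products A [set w].

Definition irreducible_family (R : realType) (d m : nat)
    (A : 'I_m -> 'M[R]_d) : Prop :=
  forall U : {vspace 'cV[R]_d},
    (forall i v, v \in U -> A i *m v \in U) -> U = 0%VS \/ U = fullv.

Definition convex (R : realType) (d : nat) (G : set 'cV[R]_d) : Prop :=
  @convex_set R 'cV[R]_d G.

Definition hull (R : realType) (d : nat) (S : set 'cV[R]_d) : set 'cV[R]_d :=
  smallest (@convex R d) S.

Definition dilate (R : realType) (d : nat) (c : R) (G : set 'cV[R]_d) :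
    set 'cV[R]_d :=
  [set c *: x | x in G].

Definition convex_body (R : realType) (d : nat) (G : set 'cV[R]_d) : Prop :=
  [/\ convex G, compact G, interior G !=set0 & forall x, G x -> G (- x)].

Definition invariant_body (R : realType) (d m : nat) (A : 'I_m -> 'M[R]_d)
    (G : set 'cV[R]_d) : Prop :=
  convex_body G /\
  hull (\bigcup_(i in [set: 'I_m]) [set A i *m x | x in G])
    = dilate (jsr A) G.

Definition polytope (R : realType) (d : nat) (G : set 'cV[R]_d) : Prop :=
  convex_body G /\ exists2 V : set 'cV[R]_d, finite_set V & G = hull V.

Definition ellipse (R : realType) (d : nat) (a b : 'cV[R]_d) : set 'cV[R]_d :=
  [set cos t *: a + sin t *: b | t in [set: R]].

Definition hull_of_ellipses (R : realType) (d : nat) (G : set 'cV[R]_d) : Prop :=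
  exists (n : nat) (a b : 'I_n -> 'cV[R]_d),
    G = hull (\bigcup_(i in [set: 'I_n]) ellipse (a i) (b i)).

(* Main.v *)
(* Normalise the family so that its joint spectral radius is 1; irreducibility
   makes the semigroup of products bounded.  If a product [T] of a bounded
   sequence of products S_k, S_(k+1) = S_k A, carries S_k close to itself, then
   1 is almost an eigenvalue of [T], and the spectral gap forces [T] to be a
   power of a cyclic permutation of the dominant product [Pi].  By compactness,
   an infinite word all of whose prefixes have products bounded away from 0 is
   therefore eventually periodic with period [Pi].  This gives, in turn:
   - q equals the joint spectral radius (the Berger-Wang formula here);
   - only finitely many images of the leading set E of [Pi] (the pair {a, -a}, or
     the ellipse spanned by the real and imaginary parts of a leading eigenvector)
     are needed to span the convex hull G of its whole orbit: an infinite
     sequence of images leaving the hull of the earlier ones would end with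
     powers of [Pi], which map every point towards a multiple s E, where s < 1
     unless the word is itself a power of [Pi];
   - uniqueness: if c is the largest number with c E in an invariant body G', then
     all products of some fixed length map G' into (c + eta) G, because
     limits of [Pi]^n x with x in G' lie in the cone over E and in G', that is,
     in multiples s E with s <= c. *)

Require Import Defs.
From mathcomp Require Import all_boot all_order fingroup perm all_algebra.
From mathcomp Require Import complex.
From mathcomp Require Import all_classical all_reals all_analysis.
From mathcomp Require Import ring lra zify.
Set Implicit Arguments.
Unset Strict Implicit.
Unset Printing Implicit Defensive.
Import Order.TTheory GRing.Theory Num.Theory.
Import numFieldNormedType.Exports.
Local Open Scope classical_set_scope.
Local Open Scope ring_scope.

(** * Matrix norms and compactness *)

(** Closeness to the spectrum is measured by a determinant. If S (1 - T) is small while S is not,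
    multiplying by an adjugate shows that det (1 - T) is small; but eigenvalues of modulus at most 1
    - e keep |det (1 - T)| at least e^d, since this determinant is the product of the d differences.
    The bound does not depend on the length of T: once the roots are removed, the gap reads rho(S)
    <= (1 - e) q^|S| with one e for all S. The periodicity argument leaves one end of the word
    uncontrolled: u Pi^n if words grow to the right, Pi^n u if they grow to the left. Uniqueness
    uses u Pi^n, where Pi acts first, on arbitrary points of G'. Finiteness of the hull uses Pi^n u,
    where Pi acts last and the limit s E may have s >= 1; hence the gap is needed for det (sigma -
    T) with every real |sigma| >= 1, and not for sigma = 1 alone. The real and the complex case
    share one argument about an abstract set E on which the orbits of the normalised Pi are dense up
    to sign. The sign is forced by the real case, where a positive eigenvalue never carries a to
    -a. *)

Lemma mx_entry_le (R : realType) (m n : nat) (M : 'M[R]_(m, n)) i j :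
  `|M i j| <= `|M|.
Proof.
rewrite [leRHS]/Num.Def.normr /= mx_normrE.
by apply/bigmax_geP; right => /=; exists (i, j).
Qed.

Lemma mx_norm_leP (R : realType) (m n : nat) (M : 'M[R]_(m, n)) (c : R) : 0 <= c ->
  (forall i j, `|M i j| <= c) -> `|M| <= c.
Proof.
move=> c0 h; rewrite [leLHS]/Num.Def.normr /= mx_normrE.
by apply/bigmax_leP; split => // -[i j] _ /=.
Qed.

Lemma mx_norm_mulmx (R : realType) (m n p : nat) (M : 'M[R]_(m, n))
  (N : 'M[R]_(n, p)) : `|M *m N| <= n%:R * `|M| * `|N|.
Proof.
apply: mx_norm_leP => [|i j]; first by rewrite !mulr_ge0.
rewrite mxE (le_trans (ler_norm_sum _ _ _)) //.
apply: (@le_trans _ _ (\sum_(k < n) `|M| * `|N|)).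
  by apply: ler_sum => k _; rewrite normrM ler_pM // mx_entry_le.
by rewrite sumr_const card_ord -mulrA mulr_natl.
Qed.

Lemma mx_norm_trmx (R : realType) (m n : nat) (M : 'M[R]_(m, n)) :
  `|M^T| = `|M|.
Proof.
by apply/eqP; rewrite eq_le; apply/andP; split; apply: mx_norm_leP => // i j;
  [rewrite mxE | have := mx_entry_le M^T j i; rewrite mxE]; rewrite // mx_entry_le.
Qed.

Lemma mx_norm_mxvec (R : realType) (m n : nat) (M : 'M[R]_(m, n)) :
  `|mxvec M| = `|M|.
Proof.
apply/eqP; rewrite eq_le; apply/andP; split; apply: mx_norm_leP => // i j.
  by rewrite ord1; case/mxvec_indexP: j => a b; rewrite mxvecE mx_entry_le.
by rewrite -mxvecE mx_entry_le.
Qed.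

Lemma closed_mxP (R : realType) (m n : nat) (X : set 'M[R]_(m, n)) :
  closed X <-> forall x, (forall e : R, 0 < e -> exists2 y, X y & `|x - y| < e) -> X x.
Proof.
split=> [cX x h|h x cx].
  apply: cX => B /nbhs_ballP[e /= e0 sB].
  by have [y Xy yx] := h _ e0; exists y; split => //; apply: sB; rewrite -ball_normE.
apply: h => e e0; have [|y [Xy]] := cx (ball x e); first exact: nbhsx_ballx.
by rewrite -ball_normE; exists y.
Qed.

(** Heine-Borel for row vectors, transported along the isometry [vec_mx]. *)
Lemma compact_mx (R : realType) (m n : nat) (X : set 'M[R]_(m, n)) (C : R) :
  (forall x, X x -> `|x| <= C) ->
  (forall x, (forall e : R, 0 < e -> exists2 y, X y & `|x - y| < e) -> X x) ->
  compact X.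
Proof.
move=> bX cX.
have -> : X = vec_mx @` [set v | X (vec_mx v)].
  apply/seteqP; split => [x Xx|_ [v Xv <-] //].
  by exists (mxvec x); rewrite /= mxvecK.
apply: continuous_compact; last first.
  apply: bounded_closed_compact.
    exists C; split; first exact: num_real.
    move=> x Cx v Xv; have vC : `|v : 'rV[R]_(m * n)| <= C.
      by rewrite -(vec_mxK v) mx_norm_mxvec; exact: bX.
    exact: le_trans vC (ltW Cx).
  apply/closed_mxP => x h; apply: cX => e e0.
  have [y Xy xy] := h _ e0; exists (vec_mx y) => //.
  by rewrite -linearB /= -mx_norm_mxvec vec_mxK.
apply: continuous_subspaceT => v B /nbhs_ballP[e /= e0 sB].
apply/nbhs_ballP; exists e => //= z; rewrite -ball_normE /= => vz.
apply: sB; rewrite -ball_normE /=.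
have -> : vec_mx v - vec_mx z = vec_mx (v - z) :> 'M[R]_(m, n) by rewrite linearB.
by rewrite -mx_norm_mxvec vec_mxK.
Qed.

Lemma compact_mxP (R : realType) (m n : nat) (X : set 'M[R]_(m, n)) :
  compact X <-> (exists C : R, forall x, X x -> `|x| <= C) /\
  (forall x, (forall e : R, 0 < e -> exists2 y, X y & `|x - y| < e) -> X x).
Proof.
split=> [cX|[[C bX] cX]]; last exact: compact_mx bX cX.
split; last by apply/closed_mxP; apply: compact_closed => //; apply: norm_hausdorff.
by have /compact_bounded[C [_ h]] := cX; exists (C + 1) => x Xx; apply: h => //; rewrite ltrDl.
Qed.

Lemma interior_mxP (R : realType) (m n : nat) (X : set 'M[R]_(m, n)) x :
  interior X x <-> exists2 e : R, 0 < e & forall y, `|x - y| < e -> X y.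
Proof.
split=> [/nbhs_ballP[e /= e0 h]|[e e0 h]].
  by exists e => // y xy; apply: h; rewrite -ball_normE.
by apply/nbhs_ballP; exists e => //= y; rewrite -ball_normE; apply: h.
Qed.

Lemma compact_cluster_point (R : realType) (m n : nat) (X : set 'M[R]_(m, n))
    (u : nat -> 'M[R]_(m, n)) :
  compact X -> (forall k, X (u k)) ->
  exists2 x, X x & forall (e : R) N, 0 < e -> exists2 k, (N <= k)%N & `|u k - x| < e.
Proof.
move=> cX Xu; have FX : (u @ \oo) X by exists 0%N => // k _; exact: Xu.
have [x [Xx clx]] := cX (u @ \oo) _ FX.
exists x => // e N e0.
have FN : (u @ \oo) (u @` [set k | (N <= k)%N]).
  by exists N => //= k Nk; exists k.
have [y [[k Nk <-]]] := clx _ _ FN (nbhsx_ballx x e e0).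
by rewrite -ball_normE /= distrC; exists k.
Qed.

Lemma bounded_cluster_point (R : realType) (m n : nat) (u : nat -> 'M[R]_(m, n)) (C : R) :
  (forall k, `|u k| <= C) ->
  exists x : 'M[R]_(m, n), forall (e : R) N, 0 < e -> exists2 k, (N <= k)%N & `|u k - x| < e.
Proof.
move=> uC; have [||x _ hx] := @compact_cluster_point R m n [set x | `|x| <= C] u.
- apply: (@compact_mx _ _ _ _ C) => // x h /=; apply/ler_addgt0Pr => e e0.
  have [y yC xy] := h _ e0; rewrite -(subrK y x) (le_trans (ler_normD _ _)) //.
  by rewrite addrC lerD // ltW.
- exact: uC.
by exists x.
Qed.

(** * Convex hulls *)

Lemma convexP (R : realType) (d : nat) (X : set 'cV[R]_d) :
  Defs.convex X <-> forall x y (t : R), X x -> X y -> 0 <= t -> t <= 1 ->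
    X (t *: x + (1 - t) *: y).
Proof.
split=> [cX x y t Xx Xy t0 t1|h x y t].
  have t01 : Itv.spec (@Itv.num_sem R) (Itv.Real `[0%Z, 1%Z]) t.
    by rewrite /Itv.spec /= /Itv.num_sem /= num_real in_itv /= t0 t1.
  by have /set_mem := cX x y (Itv.mk t01) (mem_set Xx) (mem_set Xy).
by move=> /set_mem Xx /set_mem Xy; apply/mem_set; apply: h.
Qed.

Lemma hull_convex (R : realType) (d : nat) (S : set 'cV[R]_d) :
  Defs.convex (hull S).
Proof.
apply/convexP => x y t hx hy t0 t1 X [cX sX].
by move/convexP : (cX); apply => //; [apply: hx | apply: hy].
Qed.

Lemma sub_hull (R : realType) (d : nat) (S : set 'cV[R]_d) : S `<=` hull S.
Proof. exact: sub_gen_smallest. Qed.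

Lemma hull_sub (R : realType) (d : nat) (S X : set 'cV[R]_d) :
  Defs.convex X -> S `<=` X -> hull S `<=` X.
Proof. by move=> cX sX; apply: smallest_sub. Qed.

Lemma hullS (R : realType) (d : nat) (S T : set 'cV[R]_d) :
  S `<=` T -> hull S `<=` hull T.
Proof.
by move=> ST; apply: hull_sub; [exact: hull_convex | move=> x /ST; exact: sub_hull].
Qed.

Lemma hull_id (R : realType) (d : nat) (X : set 'cV[R]_d) :
  Defs.convex X -> hull X = X.
Proof. exact: smallest_id. Qed.

Lemma convex_preimage (R : realType) (d : nat) (M : 'M[R]_d) (X : set 'cV[R]_d) :
  Defs.convex X -> Defs.convex [set x | X (M *m x)].
Proof.
move=> /convexP cX; apply/convexP => x y t /= Xx Xy t0 t1.
by rewrite mulmxDr -!scalemxAr; apply: cX.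
Qed.

Lemma hull_mulmx (R : realType) (d : nat) (M : 'M[R]_d) (S T : set 'cV[R]_d) :
  (forall x, S x -> T (M *m x)) -> forall x, hull S x -> hull T (M *m x).
Proof.
move=> h; apply: hull_sub => [|x /h]; last exact: sub_hull.
exact/convex_preimage/hull_convex.
Qed.

Lemma hull_opp (R : realType) (d : nat) (S : set 'cV[R]_d) :
  (forall x, S x -> S (- x)) -> forall x, hull S x -> hull S (- x).
Proof.
move=> h x hx; have -> : - x = (- 1%:M) *m x by rewrite mulNmx mul1mx.
by apply: hull_mulmx hx => y /h; rewrite mulNmx mul1mx.
Qed.

Lemma convex_comb (R : realType) (d : nat) (X : set 'cV[R]_d) x y (s t : R) :
  Defs.convex X -> X x -> X y -> 0 <= s -> 0 <= t -> s + t = 1 ->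
  X (s *: x + t *: y).
Proof.
move=> /convexP cX Xx Xy s0 t0 st; have -> : t = 1 - s by lra.
by apply: cX => //; lra.
Qed.

Lemma convex_scale (R : realType) (d : nat) (X : set 'cV[R]_d) x (t : R) :
  Defs.convex X -> X 0 -> X x -> 0 <= t -> t <= 1 -> X (t *: x).
Proof.
move=> /convexP cX X0 Xx t0 t1.
by have := cX x 0 t Xx X0 t0 t1; rewrite scaler0 addr0.
Qed.

Lemma symmetric_convex0 (R : realType) (d : nat) (X : set 'cV[R]_d) x :
  Defs.convex X -> (forall y, X y -> X (- y)) -> X x -> X 0.
Proof.
move=> cX sX Xx; have -> : 0 = 2^-1 *: x + 2^-1 *: - x.
  by rewrite scalerN subrr.
by apply: convex_comb => //; [exact: sX | lra..].
Qed.

(** The union of the segments joining [X] to [Y] is already convex: in a mixture of two such points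
    the [X] parts and the [Y] parts can be averaged separately. This displays the hull as a
    continuous image of a product, which yields its compactness. *)
Lemma hull_setU (R : realType) (d : nat) (X Y : set 'cV[R]_d) x0 y0 :
  Defs.convex X -> Defs.convex Y -> X x0 -> Y y0 ->
  hull (X `|` Y) =
  (fun z : R * ('cV[R]_d * 'cV[R]_d) => z.1 *: z.2.1 + (1 - z.1) *: z.2.2) @`
    (`[0, 1] `*` (X `*` Y)).
Proof.
move=> cX cY Xx0 Yy0; apply/seteqP; split.
  apply: hull_sub; last first.
    move=> x [Xx|Yx].
      exists (1, (x, y0)) => /=; last by rewrite scale1r subrr scale0r addr0.
      by split => //=; rewrite in_itv /= ler01 lexx.
    exists (0, (x0, x)) => /=; last by rewrite scale0r add0r subr0 scale1r.
    by split => //=; rewrite in_itv /= ler01 lexx.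
  apply/convexP => _ _ t [[a [x y]] [/= /[!in_itv]/= /andP[a0 a1] [Xx Yy]] <-]
    [[b [x' y']] [/= /[!in_itv]/= /andP[b0 b1] [Xx' Yy']] <-] t0 t1 /=.
  pose s := t * a + (1 - t) * b.
  have s0 : 0 <= s by rewrite addr_ge0 ?mulr_ge0 // subr_ge0.
  have s1 : s <= 1 by rewrite /s; nra.
  (* The average is stated through [(p + q) *: u] because both weights may vanish. *)
  have mix (Z : set 'cV[R]_d) p q z z' : Defs.convex Z -> Z z -> Z z' ->
      0 <= p -> 0 <= q -> exists2 u, Z u & p *: z + q *: z' = (p + q) *: u.
    move=> cZ Zz Zz' p0 q0; have [pq0|pq0] := eqVneq (p + q) 0.
      have [-> ->] : p = 0 /\ q = 0 by split; lra.
      by exists z; rewrite // addr0 !scale0r addr0.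
    have pq1 : p / (p + q) + q / (p + q) = 1 by rewrite -mulrDl divff.
    exists (p / (p + q) *: z + q / (p + q) *: z').
      by apply: convex_comb; rewrite // divr_ge0 // addr_ge0.
    rewrite scalerDr !scalerA ![_ * (_ / _)]mulrC !divfK //.
  have [u Xu eu] := mix X (t * a) ((1 - t) * b) x x' cX Xx Xx'
    (mulr_ge0 t0 a0) ltac:(by rewrite mulr_ge0 // subr_ge0).
  have [v Yv ev] := mix Y (t * (1 - a)) ((1 - t) * (1 - b)) y y' cY Yy Yy'
    ltac:(by rewrite mulr_ge0 // subr_ge0) ltac:(by rewrite mulr_ge0 // subr_ge0).
  exists (s, (u, v)); first by split => //=; rewrite in_itv /= s0 s1.
  rewrite /= -eu (_ : 1 - s = t * (1 - a) + (1 - t) * (1 - b)); last by rewrite /s; ring.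
  by rewrite -ev !scalerDr !scalerA addrACA.
move=> _ [[a [x y]] [/= /[!in_itv]/= /andP[a0 a1] [Xx Yy]] <-] /=.
apply: convex_comb; rewrite ?subr_ge0 //; first exact: hull_convex.
- by apply: sub_hull; left.
- by apply: sub_hull; right.
- by rewrite addrC subrK.
Qed.

Lemma compact_hull_setU (R : realType) (d : nat) (X Y : set 'cV[R]_d) :
  Defs.convex X -> Defs.convex Y -> compact X -> compact Y ->
  compact (hull (X `|` Y)).
Proof.
move=> cX cY kX kY.
have [->|/set0P[x0 Xx0]] := eqVneq X set0; first by rewrite set0U hull_id.
have [->|/set0P[y0 Yy0]] := eqVneq Y set0; first by rewrite setU0 hull_id.
rewrite (hull_setU cX cY Xx0 Yy0); apply: continuous_compact; last first.
  by do 2?apply: compact_setX => //; exact: segment_compact.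
apply: continuous_subspaceT => z.
have c1 : (fun z : R * ('cV[R]_d * 'cV[R]_d) => z.1) @ z --> z.1 by exact: cvg_fst.
have c2 : (fun z : R * ('cV[R]_d * 'cV[R]_d) => z.2.1) @ z --> z.2.1.
  by apply: (cvg_comp _ _ cvg_snd cvg_fst).
have c3 : (fun z : R * ('cV[R]_d * 'cV[R]_d) => z.2.2) @ z --> z.2.2.
  by apply: (cvg_comp _ _ cvg_snd cvg_snd).
apply: cvgD; apply: cvgZ => //.
by apply: cvgB => //; exact: cvg_cst.
Qed.

Lemma compact_hull_seq (R : realType) (d : nat) (I : eqType) (r : seq I)
    (S : I -> set 'cV[R]_d) :
  (forall i, compact (hull (S i))) ->
  compact (hull [set x | exists2 i, i \in r & S i x]).
Proof.
move=> kS; elim: r => [|i r IH].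
  rewrite (_ : [set x | _] = set0) ?hull_id; first exact: compact0.
  - by apply/convexP.
  - by apply/seteqP; split => // x [].
rewrite (_ : hull _ = hull (hull (S i) `|`
    hull [set x | exists2 j, j \in r & S j x])).
  by apply: compact_hull_setU => //; exact: hull_convex.
apply/seteqP; split; apply: hull_sub; try exact: hull_convex.
  move=> x [j]; rewrite inE => /orP[/eqP-> Sx|jr Sx]; apply: sub_hull.
    by left; apply: sub_hull.
  by right; apply: sub_hull; exists j.
move=> x [] hx; [apply: hullS hx|apply: hullS hx] => y.
  by move=> Sy; exists i; rewrite // mem_head.
by case=> j jr Sy; exists j; rewrite // inE jr orbT.
Qed.

(** [y] is the mixture, with weights [s] and [1 - s], of [x] and a point of the ball of radius [r].
    This is how a limit [s *: x] with [s < 1] forces the approximating points themselves into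
    [X]. *)
Lemma convex_interior_scale (R : realType) (d : nat) (X : set 'cV[R]_d) (r s : R) x y :
  Defs.convex X -> (forall z, `|z| < r -> X z) -> 0 <= s -> s < 1 -> X x ->
  `|y - s *: x| < (1 - s) * r -> X y.
Proof.
move=> cX rX s0 s1 Xx yx; have s10 : 0 < 1 - s by rewrite subr_gt0.
have -> : y = s *: x + (1 - s) *: ((1 - s)^-1 *: (y - s *: x)).
  by rewrite scalerA divff ?gt_eqF // scale1r addrC subrK.
apply: convex_comb => //; [|exact: ltW|by rewrite addrC subrK].
apply: rX; rewrite normrZ gtr0_norm ?invr_gt0 //.
by rewrite mulrC ltr_pdivrMr // mulrC.
Qed.

Lemma convex_body_ball (R : realType) (d : nat) (G : set 'cV[R]_d) :
  convex_body G -> exists2 r : R, 0 < r & forall x, `|x| < r -> G x.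
Proof.
move=> [cG _ [x0 /interior_mxP[e e0 h]] sG]; exists e => // x xe.
have -> : x = 2^-1 *: (x0 + x) + 2^-1 *: - (x0 - x).
  rewrite -scalerDr opprD opprK addrACA subrr add0r.
  by rewrite -mulr2n -[x *+ 2]scaler_nat scalerA mulVf ?scale1r.
apply: convex_comb; rewrite ?invr_ge0 //; last by lra.
  by apply: h; rewrite opprD addrA subrr sub0r normrN.
by apply/sG/h; rewrite opprB addrC subrK.
Qed.

(** * Almost periodic words *)

Lemma prod_word_nil (R : realType) (d m : nat) (A : 'I_m -> 'M[R]_d) :
  prod_word A [::] = 1%:M.
Proof. by rewrite /prod_word big_nil. Qed.

Lemma prod_word_cons (R : realType) (d m : nat) (A : 'I_m -> 'M[R]_d) i s :
  prod_word A (i :: s) = A i *m prod_word A s.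
Proof. by rewrite /prod_word big_cons. Qed.

Lemma prod_word_cat (R : realType) (d m : nat) (A : 'I_m -> 'M[R]_d) s t :
  prod_word A (s ++ t) = prod_word A s *m prod_word A t.
Proof. by rewrite /prod_word big_cat. Qed.

Lemma prod_word_tr (R : realType) (d m : nat) (A : 'I_m -> 'M[R]_d) s :
  prod_word (fun i => (A i)^T) s = (prod_word A (rev s))^T.
Proof.
elim: s => [|i s IH]; first by rewrite !prod_word_nil trmx1.
rewrite prod_word_cons IH rev_cons -cats1 prod_word_cat trmx_mul prod_word_cons.
by rewrite prod_word_nil mulmx1.
Qed.

Lemma wpow0 (T : Type) (w : seq T) : wpow 0 w = [::]. Proof. by []. Qed.

Lemma wpowS (T : Type) n (w : seq T) : wpow n.+1 w = w ++ wpow n w.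
Proof. by []. Qed.

Lemma wpowD (T : Type) n k (w : seq T) : wpow (n + k) w = wpow n w ++ wpow k w.
Proof. by rewrite /wpow nseqD flatten_cat. Qed.

Lemma size_wpow (T : Type) n (w : seq T) : size (wpow n w) = (n * size w)%N.
Proof. by elim: n => // n IH; rewrite wpowS size_cat IH mulSn. Qed.

Lemma wpow_rot (T : Type) n (u v : seq T) :
  wpow n.+1 (v ++ u) = v ++ wpow n (u ++ v) ++ u.
Proof.
elim: n => [|n IH]; first by rewrite wpowS !wpow0 cats0.
by rewrite wpowS IH wpowS -!catA.
Qed.

Lemma rev_wpow (T : Type) n (w : seq T) : rev (wpow n w) = wpow n (rev w).
Proof.
elim: n => // n IH; rewrite wpowS rev_cat IH -[n.+1]addn1 wpowD.
by rewrite wpowS wpow0 cats0.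
Qed.

(** Koenig's lemma: keep a prefix that has admissible extensions of every length. If no next letter
    preserved this, each letter [i] would fail at some length [N i], and an extension longer than
    all [N i] would be a contradiction. *)
Lemma konig (m : nat) (P : seq 'I_m -> Prop) :
  (forall s t, P (s ++ t) -> P s) -> (forall n, exists2 s, size s = n & P s) ->
  exists g : nat -> seq 'I_m,
    [/\ forall n, size (g n) = n, forall n, P (g n) &
        forall n k, exists v, g (n + k)%N = g n ++ v].
Proof.
move=> Pc Pn.
pose Ext s := forall n, exists2 t, size t = n & P (s ++ t).
have Ext0 : Ext [::] by move=> n; have [s sn Ps] := Pn n; exists s.
have ExtS s : exists i, Ext s -> Ext (rcons s i).
  have [i0 _] : exists i : 'I_m, True.
    by have [[|i ?] //] := Pn 1%N; exists i.
  apply: contrapT => /forallNP h.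
  have Es : Ext s by apply: contrapT => nE; apply: (h i0).
  have /choice[N hN] i : exists n, forall t, size t = n -> ~ P (rcons s i ++ t).
    have /existsNP[n hn] : ~ Ext (rcons s i) by move=> E; apply: (h i).
    by exists n => t tn Pt; apply: hn; exists t.
  have [[|i t] // tN Pt] := Es (\max_i N i).+1.
  apply: (hN i (take (N i) t)).
    by rewrite size_takel //; case: tN => ->; exact: leq_bigmax.
  apply: (Pc _ (drop (N i) t)).
  by rewrite -catA cat_take_drop cat_rcons.
have [F hF] := choice ExtS.
pose g n := iter n (fun s => rcons s (F s)) [::].
have Eg n : Ext (g n) by elim: n => // n IH /=; apply: hF.
exists g; split.
- by elim=> // n IH /=; rewrite size_rcons IH.
- by move=> n; have [[|? ?] // _] := Eg n 0%N; rewrite cats0.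
- move=> n; elim=> [|k [v hv]]; first by exists [::]; rewrite addn0 cats0.
  by exists (rcons v (F (g (n + k)%N))); rewrite addnS /= hv rcons_cat.
Qed.

(** * Determinants as a measure of near-singularity *)

Lemma det_bound (R : realType) (d : nat) (C : R) : exists2 K : R, 0 < K &
  forall M : 'M[R]_d, `|M| <= C -> `|\det M| <= K.
Proof.
exists (\sum_(s : {perm 'I_d}) \prod_(i < d) (1 + `|C|)).
  apply: (@lt_le_trans _ _ (\prod_(i < d) (1 + `|C|))).
    by apply: prodr_gt0 => i _; rewrite ltr_pwDl.
  rewrite (bigD1 (1%g : {perm 'I_d})) //= lerDl sumr_ge0 // => s _.
  by apply: prodr_ge0 => i _; rewrite addr_ge0.
move=> M MC; rewrite /determinant (le_trans (ler_norm_sum _ _ _)) //.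
apply: ler_sum => s _; rewrite normrM normrX normrN1 expr1n mul1r normr_prod.
apply: ler_prod => i _; rewrite normr_ge0 /= (le_trans (mx_entry_le _ _ _)) //.
by rewrite (le_trans MC) // (le_trans (ler_norm _)) // lerDr.
Qed.

Lemma adj_bound (R : realType) (d : nat) (C : R) : exists2 K : R, 0 < K &
  forall M : 'M[R]_d, `|M| <= C -> `|\adj M| <= K.
Proof.
have [K K0 hK] := det_bound d.-1 C; exists K => // M MC.
apply: mx_norm_leP => [|i j]; first exact: ltW.
rewrite mxE /cofactor normrM normrX normrN1 expr1n mul1r; apply: hK.
apply: mx_norm_leP => [|a b]; first exact: le_trans MC.
by rewrite !mxE (le_trans (mx_entry_le _ _ _)).
Qed.

(** From [\adj M *m (M *m X) = \det M *: X]: if [M] almost kills an [X] that is not small, then its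
    determinant is small. The factor [d.+1] keeps [K] positive for [d = 0]. *)
Lemma det_norm_le (R : realType) (d p : nat) (C : R) : exists2 K : R, 0 < K &
  forall (M : 'M[R]_d) (X : 'M[R]_(d, p)), `|M| <= C ->
    `|\det M| * `|X| <= K * `|M *m X|.
Proof.
have [K K0 hK] := adj_bound d C; exists (d.+1%:R * K).
  by rewrite mulr_gt0.
move=> M X MC; rewrite -normrZ -mul_scalar_mx -mul_adj_mx -mulmxA.
rewrite (le_trans (mx_norm_mulmx _ _)) // ler_wpM2r // ler_pM //; last exact: hK.
by rewrite ler_nat.
Qed.

Lemma mx_norm1_le (R : realType) (d : nat) : `|1%:M : 'M[R]_d| <= 1.
Proof.
by apply: mx_norm_leP => // i j; rewrite mxE; case: eqP => _; rewrite ?normr1 ?normr0.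
Qed.

(* Two nearby points [S_k0], [S_k = S_k0 *m T] of a bounded sequence that stays
   away from 0 make [S_k0 *m (1 - T)] small, so that [1 - T] is almost singular. *)
Lemma almost_recurrence (R : realType) (d m : nat) (B : 'I_m -> 'M[R]_d) (C delta e : R)
    (P : seq 'I_m -> Prop) :
  (forall s, `|prod_word B s| <= C) -> 0 < delta -> 0 < e ->
  (forall s t, P (s ++ t) -> P s) -> (forall n, exists2 s, size s = n & P s) ->
  (forall s, P s -> delta <= `|prod_word B s|) ->
  exists u : seq 'I_m, exists v : nat -> seq 'I_m, forall N,
    [/\ (N < size (v N))%N, P (u ++ v N),
        (exists t, v N = v 0%N ++ t) &
        `|\det (1%:M - prod_word B (v N))| < e].
Proof.
move=> BC delta0 e0 Pc Pn Pdelta.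
have [g [gn Pg gc]] := konig Pc Pn.
have [S hS] := bounded_cluster_point (fun n => BC (g n)).
have C0 : 0 <= C by apply: le_trans (BC [::]).
have S0 : delta / 2 <= `|S|.
  have [k _ hk] := hS (delta / 2) 0%N (divr_gt0 delta0 (ltr0n _ 2)).
  have := Pdelta _ (Pg k); have := ler_normD (prod_word B (g k) - S) S.
  rewrite subrK; lra.
have [K K0 hK] := @det_norm_le R d d (1 + C).
pose L := d%:R * (1 + C) + 2.
have L0 : 0 < L by rewrite ltr_wpDl // mulr_ge0 // addr_ge0.
pose eta := e * (delta / 2) / (2 * K * L).
have eta0 : 0 < eta by rewrite !(divr_gt0, mulr_gt0).
have [k0 _ hk0] := hS eta 0%N eta0.
have key k : (k0 <= k)%N -> `|prod_word B (g k) - S| < eta ->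
    `|\det (1%:M - prod_word B (drop k0 (g k)))| < e.
  move=> k0k hk; set T := prod_word B _.
  have ST : prod_word B (g k0) *m T = prod_word B (g k).
    rewrite -prod_word_cat; have [v] := gc k0 (k - k0)%N.
    by rewrite subnKC // => ->; rewrite drop_size_cat // gn.
  have nT : `|1%:M - T| <= 1 + C.
    by rewrite (le_trans (ler_normB _ _)) // lerD // ?mx_norm1_le ?BC.
  (* The almost singular factor stands to the right of [S], so the adjugate bound is applied to
     transposes. *)
  have := hK (1%:M - T)^T S^T; rewrite !mx_norm_trmx det_tr -trmx_mul mx_norm_trmx.
  move=> /(_ nT).
  have -> : S *m (1%:M - T) = (S - prod_word B (g k0)) *m (1%:M - T) +
      ((prod_word B (g k0) - S) - (prod_word B (g k) - S)).
    rewrite mulmxBl [prod_word _ (g k0) *m _]mulmxBr mulmx1 ST.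
    suff -> : prod_word B (g k0) - S - (prod_word B (g k) - S) =
        prod_word B (g k0) - prod_word B (g k) by rewrite subrK.
    by rewrite opprB addrA subrK.
  set Z := (X in K * `|X|) => h1.
  have hZ : `|Z| <= eta * L.
    rewrite (le_trans (ler_normD _ _)) // [leRHS]mulrDr lerD //.
      rewrite (le_trans (mx_norm_mulmx _ _)) // [leRHS]mulrCA -mulrA ler_wpM2l //.
      by rewrite ler_pM // distrC ltW.
    by rewrite (le_trans (ler_normB _ _)) // mulr_natr mulr2n lerD // ltW.
  have h2 : `|\det (1%:M - T)| * (delta / 2) <= K * (eta * L).
    apply: le_trans (le_trans h1 _); first by rewrite ler_wpM2l.
    by rewrite ler_wpM2l // ltW.
  have h3 : K * (eta * L) = e * (delta / 2) / 2.
    by rewrite /eta; field; rewrite !gt_eqF.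
  rewrite h3 in h2.
  have : `|\det (1%:M - T)| * (delta / 2) < e * (delta / 2).
    apply: le_lt_trans h2 _.
    by rewrite ltr_pdivrMr // ltr_pMr ?ltr1n // mulr_gt0 // divr_gt0.
  by rewrite ltr_pM2r // divr_gt0.
have /choice[k hk] N : exists k, (N + k0 < k)%N /\ `|prod_word B (g k) - S| < eta.
  by have [k kN kh] := hS eta (N + k0).+1 eta0; exists k.
(* Every return index is at least the index [K1 0], so all return words begin with [v 0]; this
   common beginning later pins down a single rotation of the period. *)
pose K1 := fix K1 N := if N is N'.+1 then k (K1 N' + N)%N else k 0%N.
have K1P N : (N + k0 < K1 N)%N /\ `|prod_word B (g (K1 N)) - S| < eta.
  case: N => [|N] /=; first exact: hk.
  by have [h ?] := hk (K1 N + N.+1)%N; split => //; apply: leq_trans h; rewrite ltnS leq_add2r leq_addl.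
have K1m N : (K1 0 <= K1 N)%N.
  elim: N => // N IH; apply: (leq_trans IH) => /=.
  by have [h _] := hk (K1 N + N.+1)%N; apply: leq_trans (ltnW h); rewrite -addnA leq_addr.
exists (g k0), (fun N => drop k0 (g (K1 N))) => N; have [h1 h2] := K1P N; split.
- by rewrite size_drop gn ltn_subRL addnC.
- have [v] := gc k0 (K1 N - k0)%N; rewrite subnKC; last exact: leq_trans (leq_addl _ _) (ltnW h1).
  by move=> e1; have := Pg (K1 N); rewrite e1 drop_size_cat // gn.
- have [v] := gc (K1 0) (K1 N - K1 0)%N; rewrite subnKC // => ->.
  exists v; rewrite drop_cat gn; case: ltnP => // h.
  by have [h3 _] := K1P 0%N; exfalso; move: h3; rewrite ltnNge add0n h.
- by apply: key => //; apply: leq_trans (leq_addl _ _) (ltnW h1).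
Qed.

Section PeriodicCore.
Variables (R : realType) (d m : nat).
Implicit Types (B : 'I_m -> 'M[R]_d) (w s t u v : seq 'I_m).

(** The exceptional words in the third condition of [dominant_products], for a single dominant
    product. *)
Definition rot_power w s := exists a n, s = wpow n (rot a w).

Lemma rot_power_rev w s : rot_power w s -> rot_power (rev w) (rev s).
Proof.
move=> [a [n ->]]; exists (size (rev w) - a)%N, n.
by rewrite rev_wpow rev_rot.
Qed.

Definition near_singular_periodic B w (e : R) := forall s, s <> [::] ->
  `|\det (1%:M - prod_word B s)| < e -> rot_power w s.

(** Each return word is a power of some rotation of [w]. All of them start with the nonempty word
    [v 0], so comparing the first [size w] letters shows that the rotation is always the same. *)
Lemma periodic_prefixes B (C delta e : R) w (P : seq 'I_m -> Prop) :
  (forall s, `|prod_word B s| <= C) -> 0 < delta -> 0 < e ->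
  near_singular_periodic B w e ->
  (forall s t, P (s ++ t) -> P s) -> (forall n, exists2 s, size s = n & P s) ->
  (forall s, P s -> delta <= `|prod_word B s|) ->
  exists u, forall n, P (u ++ wpow n w).
Proof.
move=> BC delta0 e0 Bw Pc Pn Pdelta.
have [u [v uv]] := almost_recurrence BC delta0 e0 Pc Pn Pdelta.
have pv N : rot_power w (v N).
  by have [h _ _ ?] := uv N; apply: Bw => // v0; rewrite v0 in h.
have [a [[|n0] v0E]] := pv 0%N; first by have [] := uv 0%N; rewrite v0E.
have vE N : exists2 n, (N < n * size w)%N & v N = wpow n (rot a w).
  have [h _ [t vt] _] := uv N; have [b [n vN]] := pv N; exists n.
    rewrite -(size_rot b w) -size_wpow -vN; exact: h.
  rewrite vN; congr wpow; case: n => [|n] in vN; first by rewrite vN in h.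
  have eq_prefix (r1 r2 x y : seq 'I_m) : size r1 = size r2 ->
      r1 ++ x = (r2 ++ y) ++ t -> r1 = r2.
    by move=> r12 /(congr1 (take (size r1))); rewrite -catA !take_size_cat.
  move: vt; rewrite vN v0E !wpowS; apply: eq_prefix.
  by rewrite !size_rot.
(* A power of [rot a w = drop a w ++ take a w] is [drop a w] followed by full copies of [w] and a
   remainder; the incomplete first period is moved into the preperiod. *)
exists (u ++ drop a w) => N.
have [n Nn vN] := vE (N.+1 * size w)%N.
have {Nn} Nn : (N.+1 < n)%N by rewrite ltn_mul2r in Nn; case/andP: Nn.
have [_ Pu _ _] := uv (N.+1 * size w)%N.
move: Pu; rewrite vN -(subnKC (ltnW Nn)) wpowD /rot wpow_rot cat_take_drop.
by rewrite -!catA (catA u) (catA (u ++ _)) => /Pc; rewrite -catA.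
Qed.

(** Transposition reverses words and preserves norms and determinants, so this is
    [periodic_prefixes] for the transposed family and the reversed period. *)
Lemma periodic_suffixes B (C delta e : R) w (P : seq 'I_m -> Prop) :
  (forall s, `|prod_word B s| <= C) -> 0 < delta -> 0 < e ->
  near_singular_periodic B w e ->
  (forall s t, P (s ++ t) -> P t) -> (forall n, exists2 s, size s = n & P s) ->
  (forall s, P s -> delta <= `|prod_word B s|) ->
  exists u, forall n, P (wpow n w ++ u).
Proof.
move=> BC delta0 e0 Bw Pc Pn Pdelta.
have [] := @periodic_prefixes (fun i => (B i)^T) C delta e (rev w)
  (fun s => P (rev s)) _ delta0 e0 _ _ _ _.
- by move=> s; rewrite prod_word_tr mx_norm_trmx.
- move=> s s0; rewrite prod_word_tr -det_tr linearB /= trmx1 trmxK => h.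
  rewrite -(revK s); apply: rot_power_rev; apply: Bw => // rs.
  by apply: s0; rewrite -(revK s) rs.
- by move=> s t; rewrite rev_cat => /Pc.
- by move=> n; have [s sn Ps] := Pn n; exists (rev s); rewrite ?size_rev ?revK.
- by move=> s /Pdelta; rewrite prod_word_tr mx_norm_trmx.
move=> u hu; exists (rev u) => n.
by have := hu n; rewrite rev_cat rev_wpow revK.
Qed.

End PeriodicCore.

(** * Common invariant subspaces *)

(** Irreducibility speaks of [{vspace}] objects, whereas the subspaces met below are given by
    undecided predicates, such as having a bounded orbit. A subspace inside [P] is enlarged by one
    vector at a time; [k] bounds its codimension. *)
Lemma prop_subspace (R : realType) (d : nat) (P : 'cV[R]_d -> Prop) :
  P 0 -> (forall u v, P u -> P v -> P (u + v)) ->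
  (forall (c : R) v, P v -> P (c *: v)) ->
  exists U : {vspace 'cV[R]_d}, forall v, v \in U <-> P v.
Proof.
move=> P0 PD PZ.
suff H k (U : {vspace 'cV[R]_d}) : (forall v, v \in U -> P v) ->
    (\dim (fullv : {vspace 'cV[R]_d}) - \dim U <= k)%N ->
    exists U : {vspace 'cV[R]_d}, forall v, v \in U <-> P v.
  by apply: (H _ 0%VS) => // v; rewrite memv0 => /eqP ->.
elim: k U => [|k IH] U UP dimU.
  exists U => v; split; first exact: UP.
  suff -> : U = fullv by rewrite memvf.
  by apply/eqP; rewrite eqEdim subvf /= -subn_eq0 -leqn0.
have [[v [Pv vU]]|allU] := pselect (exists v, P v /\ v \notin U); last first.
  exists U => v; split=> [|Pv]; first exact: UP.
  by apply: contrapT => /negP vU; apply: allU; exists v.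
have UUv : (U <= U + <[v]>)%VS by exact: addvSl.
have dimUv : (\dim U < \dim (U + <[v]>))%N.
  rewrite ltnNge; apply: contra vU => le_dim.
  have /eqP -> : (U == U + <[v]>)%VS by rewrite eqEdim UUv.
  by apply: (subvP (addvSr _ _)); exact: memv_line.
apply: (IH (U + <[v]>)%VS) => [_ /memv_addP[u uU [_ /vlineP[c ->] ->]]|].
  by apply: PD; [exact: UP | exact: PZ].
have := dimvS (subvf (U + <[v]>)); move: dimU dimUv.
by move: (\dim U) (\dim fullv) (\dim (U + _)) => a b c; lia.
Qed.

Lemma irreducible_prop (R : realType) (d m : nat) (A : 'I_m -> 'M[R]_d)
    (P : 'cV[R]_d -> Prop) : irreducible_family A ->
  P 0 -> (forall u v, P u -> P v -> P (u + v)) ->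
  (forall (c : R) v, P v -> P (c *: v)) ->
  (forall i v, P v -> P (A i *m v)) ->
  (forall v, P v -> v = 0) \/ (forall v, P v).
Proof.
move=> irrA P0 PD PZ PA; have [U UP] := prop_subspace P0 PD PZ.
have [|U0|U1] := irrA U; first by move=> i v /UP /PA /UP.
- by left => v /UP; rewrite U0 memv0 => /eqP.
- by right => v; apply/UP; rewrite U1 memvf.
Qed.

Lemma cV_sum_delta (R : realType) (d : nat) (x : 'cV[R]_d) :
  x = \sum_(i < d) x i 0 *: delta_mx i 0.
Proof.
apply/matrixP => i j; rewrite summxE (bigD1 i) //= big1 => [|k ki].
  by rewrite !mxE !ord1 !eqxx mulr1 addr0.
by rewrite !mxE eq_sym (negPf ki) mulr0.
Qed.

(** The denominator is [n.+1] because the point [0] takes the remaining weight; this also covers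
    [n = 0]. *)
Lemma convex_mean (R : realType) (d n : nat) (X : set 'cV[R]_d)
    (y : 'I_n -> 'cV[R]_d) :
  Defs.convex X -> X 0 -> (forall i, X (y i)) -> X (n.+1%:R^-1 *: \sum_i y i).
Proof.
move=> cX X0; elim: n y => [|n IH] y Xy; first by rewrite big_ord0 scaler0.
rewrite big_ord_recr /= scalerDr.
have -> : n.+2%:R^-1 *: \sum_(i < n) y (widen_ord (leqnSn n) i) =
    (n.+1%:R / n.+2%:R) *: (n.+1%:R^-1 *: \sum_(i < n) y (widen_ord (leqnSn n) i)).
  by rewrite scalerA mulrAC divff ?mul1r // pnatr_eq0.
apply: convex_comb => //; first exact: IH.
by rewrite -[X in _ + X]mul1r -mulrDl natr1 divff // pnatr_eq0.
Qed.

Lemma convex_box_ball (R : realType) (d : nat) (X : set 'cV[R]_d) (c : R) :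
  Defs.convex X -> X 0 -> (forall x, X x -> X (- x)) -> 0 < c ->
  (forall i, X (c *: delta_mx i 0)) ->
  forall x, `|x| < c / d.+1%:R -> X x.
Proof.
move=> cX X0 sX c0 Xc x xc.
have -> : x = d.+1%:R^-1 *: \sum_(i < d) (d.+1%:R * x i 0) *: delta_mx i 0.
  under eq_bigr do rewrite -scalerA.
  by rewrite -scaler_sumr -cV_sum_delta scalerA mulVf ?scale1r // pnatr_eq0.
apply: convex_mean => // i; set t := _ * x i 0.
have tc : `|t| <= c.
  rewrite normrM gtr0_norm // mulrC -ler_pdivlMr // (le_trans _ (ltW xc)) //.
  exact: mx_entry_le.
have -> : t *: delta_mx i 0 = (`|t| / c) *: (Num.sg t *: (c *: delta_mx i 0)) :> 'cV[R]_d.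
  by rewrite !scalerA mulrAC divfK ?gt_eqF // mulrC -numEsg.
apply: convex_scale => //; last by rewrite ler_pdivrMr // mul1r.
  case: sgrP => _; rewrite ?scale0r ?scale1r ?scaleN1r //; exact: sX.
by rewrite divr_ge0 // ltW.
Qed.

Definition short_words (m k : nat) : seq (seq 'I_m) :=
  flatten [seq [seq tval t | t <- enum {: j.-tuple 'I_m}] | j <- iota 0 k].

Lemma short_wordsP (m k : nat) (s : seq 'I_m) :
  (s \in short_words m k) = (size s < k)%N.
Proof.
apply/flatten_mapP/idP => [[j]|sk].
  rewrite mem_iota /= add0n => jk /mapP[t _ ->]; by rewrite size_tuple.
exists (size s); first by rewrite mem_iota.
by apply/mapP; exists (in_tuple s); rewrite // mem_enum.
Qed.

(** * The convex hull of the orbit of a leading set *)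

Lemma hull_image_mulmx (R : realType) (d : nat) (M : 'M[R]_d) (S : set 'cV[R]_d) :
  hull [set M *m x | x in S] = [set M *m x | x in hull S].
Proof.
apply/seteqP; split; last first.
  by move=> _ [x hx <-]; apply: hull_mulmx hx => y Sy; exists y.
apply: hull_sub => [|_ [x Sx <-]]; last by exists x => //; exact: sub_hull.
apply/convexP => _ _ t [x hx <-] [y hy <-] t0 t1.
exists (t *: x + (1 - t) *: y); last by rewrite mulmxDr -!scalemxAr.
by have /convexP := @hull_convex _ _ S; apply.
Qed.

Lemma compact_image_mulmx (R : realType) (d : nat) (M : 'M[R]_d) (X : set 'cV[R]_d) :
  compact X -> compact [set M *m x | x in X].
Proof.
move=> cX; apply: continuous_compact => //.
apply: continuous_subspaceT => v V /nbhs_ballP[e /= e0 sV].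
have q0 : 0 < d%:R * `|M| + 1 by rewrite ltr_wpDl // mulr_ge0.
apply/nbhs_ballP; exists (e / (d%:R * `|M| + 1)); first exact: divr_gt0.
move=> z; rewrite -ball_normE /= => vz; apply: sV; rewrite -ball_normE /=.
rewrite -mulmxBr (le_lt_trans (mx_norm_mulmx _ _)) //.
rewrite ltr_pdivlMr // mulrC in vz; apply: le_lt_trans vz.
by rewrite ler_wpM2r // lerDl.
Qed.

(** Placing the two vectors side by side in one matrix makes both cluster along the same indices. *)
Lemma bounded_cluster_pair (R : realType) (d : nat) (y z : nat -> 'cV[R]_d) (C : R) :
  (forall k, `|y k| <= C) -> (forall k, `|z k| <= C) ->
  exists x1 x2 : 'cV[R]_d, forall (e : R) N, 0 < e ->
    exists k, [/\ (N <= k)%N, `|y k - x1| < e & `|z k - x2| < e].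
Proof.
move=> yC zC; have C0 : 0 <= C by exact: le_trans (yC 0%N).
have nl (X : 'M[R]_(d, 1 + 1)) : `|lsubmx X| <= `|X|.
  by apply: mx_norm_leP => // i j; rewrite mxE mx_entry_le.
have nr (X : 'M[R]_(d, 1 + 1)) : `|rsubmx X| <= `|X|.
  by apply: mx_norm_leP => // i j; rewrite mxE mx_entry_le.
have [|X hX] := @bounded_cluster_point R d (1 + 1) (fun k => row_mx (y k) (z k)) C.
  move=> k; apply: mx_norm_leP => // i j; rewrite mxE.
  by case: (fintype.split j) => a; rewrite (le_trans (mx_entry_le _ _ _)).
exists (lsubmx X), (rsubmx X) => e N e0; have [k Nk kX] := hX e N e0.
exists k; split=> //.
  by rewrite -[y k](row_mxKl _ (z k)) -linearB (le_lt_trans (nl _)).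
by rewrite -[z k](row_mxKr (y k)) -linearB (le_lt_trans (nr _)).
Qed.

Section Dynamics.
Variables (R : realType) (d m : nat) (B : 'I_m -> 'M[R]_d) (C eps : R).
Variables (w : seq 'I_m) (E : set 'cV[R]_d) (e0 : 'cV[R]_d).
Notation S := (prod_word B).
Hypothesis irrB : irreducible_family B.
Hypothesis BC : forall s, `|S s| <= C.
Hypothesis w0 : w <> [::].
Hypothesis eps0 : 0 < eps.
Hypothesis Bw : forall s (sigma : R), s <> [::] -> 1 <= `|sigma| ->
  `|\det (sigma%:M - S s)| < eps -> rot_power w s.
Hypothesis Ee0 : E e0.
Hypothesis Enz : forall x, E x -> x != 0.
Hypothesis Esym : forall x, E x -> E (- x).
Hypothesis Ecomp : compact E.
Hypothesis Ehull : compact (hull E).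
Hypothesis EPi : forall x, E x -> E (S w *m x).
Hypothesis EPi_onto : forall x, E x -> exists2 y, E y & x = S w *m y.
(** The starting vector [y k] varies with the power: in both applications each power comes with its
    own point, chosen as a counterexample. *)
Hypothesis Elim : forall (y : nat -> 'cV[R]_d) (D : R) (z : 'cV[R]_d), (forall k, `|y k| <= D) ->
  (forall (e : R) N, 0 < e -> exists2 k, (N <= k)%N & `|S (wpow k w) *m y k - z| < e) ->
  exists s : R, exists2 x, E x & 0 <= s /\ z = s *: x.
Hypothesis Edense : forall x y (eta : R), E x -> E y -> 0 < eta ->
  exists k, exists2 sigma : R, sigma = 1 \/ sigma = -1 &
    `|sigma *: (S (wpow k w) *m x) - y| < eta.

Definition orbit_hull k := hull [set x | exists2 s, (size s < k)%N &
  exists2 y, E y & x = S s *m y].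

Let C0 : 0 <= C. Proof. exact: le_trans (BC [::]). Qed.

Let normS s (x : 'cV[R]_d) : `|S s *m x| <= d%:R * C * `|x|.
Proof.
by rewrite (le_trans (mx_norm_mulmx _ _)) // ler_wpM2r // ler_wpM2l.
Qed.

Lemma orbit_hull_convex k : Defs.convex (orbit_hull k).
Proof. exact: hull_convex. Qed.

Lemma orbit_hull_le k l x : (k <= l)%N -> orbit_hull k x -> orbit_hull l x.
Proof.
move=> kl; apply: hullS => y [s sk ?]; exists s => //; exact: leq_trans kl.
Qed.

Lemma orbit_hull_opp k x : orbit_hull k x -> orbit_hull k (- x).
Proof.
apply: hull_opp => _ [s sk [y Ey ->]]; exists s => //; exists (- y); first exact: Esym.
by rewrite mulmxN.
Qed.

Lemma orbit_hull_word k s y : (size s < k)%N -> E y -> orbit_hull k (S s *m y).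
Proof. by move=> sk Ey; apply: sub_hull; exists s => //; exists y. Qed.

Lemma orbit_hull_E k y : (0 < k)%N -> E y -> orbit_hull k y.
Proof.
by move=> k0 Ey; have := @orbit_hull_word k [::] y k0 Ey; rewrite prod_word_nil mul1mx.
Qed.

Lemma orbit_hull0 k : (0 < k)%N -> orbit_hull k 0.
Proof.
move=> k0; apply: symmetric_convex0 (orbit_hull_E k0 Ee0).
  exact: orbit_hull_convex.
exact: orbit_hull_opp.
Qed.

Lemma orbit_hull_mulS k t x : orbit_hull k x -> orbit_hull (size t + k) (S t *m x).
Proof.
apply: hull_mulmx => _ [s sk [y Ey ->]]; exists (t ++ s).
  by rewrite size_cat ltn_add2l.
by exists y => //; rewrite prod_word_cat mulmxA.
Qed.

Lemma orbit_hull_compact k : compact (orbit_hull k).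
Proof.
rewrite /orbit_hull.
have -> : [set x | exists2 s, (size s < k)%N & exists2 y, E y & x = S s *m y] =
   [set x | exists2 s, s \in short_words m k & [set S s *m y | y in E] x].
  apply/seteqP; split => x [s sk [y Ey]].
    by move=> ->; exists s; [rewrite short_wordsP | exists y].
  by move=> <-; exists s; [rewrite -short_wordsP | exists y].
apply: compact_hull_seq => s; rewrite hull_image_mulmx.
exact: compact_image_mulmx.
Qed.

(** The vectors having a positive multiple in some [orbit_hull k] form a common invariant subspace,
    which is nonzero because it contains [e0]. By irreducibility it contains all coordinate vectors,
    and finitely many of these suffice for a ball. *)
Lemma orbit_hull_ball : exists k, exists2 r : R, 0 < r &
  forall x, `|x| < r -> orbit_hull k x.
Proof.
pose P v := exists2 k, (0 < k)%N & exists2 c : R, 0 < c & orbit_hull k (c *: v).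
have scale k l (c c' : R) v : (0 < k)%N -> (k <= l)%N -> 0 < c -> 0 <= c' -> c' <= c ->
    orbit_hull k (c *: v) -> orbit_hull l (c' *: v).
  move=> k0 kl c0 c'0 c'c h.
  have -> : c' *: v = (c' / c) *: (c *: v) by rewrite scalerA divfK ?gt_eqF.
  apply: convex_scale; first exact: orbit_hull_convex.
  - by apply: orbit_hull0; exact: leq_trans kl.
  - exact: orbit_hull_le h.
  - by rewrite divr_ge0 // ltW.
  - by rewrite ler_pdivrMr // mul1r.
have P0 : P 0 by exists 1%N => //; exists 1 => //; rewrite scaler0; apply: orbit_hull0.
have PD u v : P u -> P v -> P (u + v).
  move=> [k k0 [a a0 ha]] [l l0 [b b0 hb]].
  have c0 : 0 < Num.min a b by rewrite lt_min a0 b0.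
  exists (k + l)%N; first by rewrite addn_gt0 k0.
  exists (2^-1 * Num.min a b); first by rewrite mulr_gt0.
  rewrite -scalerA scalerDr scalerDr; apply: convex_comb; rewrite ?invr_ge0 //.
  - exact: orbit_hull_convex.
  - by apply: (scale k _ a) ha; rewrite ?leq_addr ?(ltW c0) ?ge_min ?lexx.
  - by apply: (scale l _ b) hb; rewrite ?leq_addl ?(ltW c0) ?ge_min ?lexx ?orbT.
  - lra.
have PZ (c : R) v : P v -> P (c *: v).
  move=> Pv; have [->|c0] := eqVneq c 0; first by rewrite scale0r.
  have [k k0 [a a0 ha]] := Pv; exists k => //; exists (a / `|c|).
    by rewrite divr_gt0 // normr_gt0.
  rewrite scalerA {2}[c]numEsg mulrCA divfK ?normr_eq0 // -scalerA.
  case: sgrP c0 => // _ _; rewrite ?scale1r // scaleN1r; exact: orbit_hull_opp.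
have PB i v : P v -> P (B i *m v).
  move=> [k k0 [a a0 ha]]; exists k.+1 => //; exists a => //.
  have := @orbit_hull_mulS k [:: i] (a *: v) ha.
  by rewrite prod_word_cons prod_word_nil mulmx1 -scalemxAr.
have [h0|hall] := irreducible_prop irrB P0 PD PZ PB.
  suff : e0 = 0 by move/eqP; rewrite (negPf (Enz Ee0)).
  by apply: h0; exists 1%N => //; exists 1; rewrite // scale1r; apply: orbit_hull_E.
have /choice[k hk] i : exists k, (0 < k)%N /\
    exists2 c : R, 0 < c & orbit_hull k (c *: delta_mx i 0).
  by have [k k0 h] := hall (delta_mx i 0); exists k.
have /choice[c hc] i : exists c : R, 0 < c /\ orbit_hull (k i) (c *: delta_mx i 0).
  by have [_ [c c0 h]] := hk i; exists c.
(* [K] exceeds every [k i] and [q] is below every [c i]; the summands 1 keep both meaningful when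
   there are no coordinates. *)
pose K := (1 + \sum_i k i)%N; pose q : R := (1 + \sum_i (c i)^-1)^-1.
have q0 : 0 < q.
  by rewrite invr_gt0 ltr_pwDl // sumr_ge0 // => i _; rewrite invr_ge0 ltW //; case: (hc i).
exists K, (q / d.+1%:R); first by rewrite divr_gt0.
apply: convex_box_ball => //.
- exact: orbit_hull_convex.
- exact: orbit_hull0.
- exact: orbit_hull_opp.
move=> i; have [ci0 hi] := hc i; have [ki0 _] := hk i.
apply: (scale (k i) _ (c i)) => //; last 2 first.
- exact: ltW.
- rewrite /q invf_ple ?posrE //; last by rewrite -invr_gt0.
  rewrite (bigD1 i) //= addrCA lerDl addr_ge0 // sumr_ge0 // => j _.
  by rewrite invr_ge0 ltW //; case: (hc j).
by rewrite /K (bigD1 i) //= addnCA leq_addr.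
Qed.


Lemma near_singular_Bw : near_singular_periodic B w eps.
Proof. by move=> s s0; apply: (@Bw s 1); rewrite ?normr1. Qed.

Lemma E_wpow n y : E y -> E (S (wpow n w) *m y).
Proof.
elim: n => [|n IH] Ey; first by rewrite prod_word_nil mul1mx.
by rewrite wpowS prod_word_cat -mulmxA; apply/EPi/IH.
Qed.

Lemma size_wpow_ge n : (n <= size (wpow n w))%N.
Proof. by rewrite size_wpow leq_pmulr // lt0n size_eq0; apply/eqP. Qed.

(** One complete copy of [w] at the front forces [rot a w = w], so the tail consists of whole copies
    of [w]. *)
Lemma rot_power_tail n u : (0 < n)%N -> rot_power w (wpow n w ++ u) ->
  exists k, u = wpow k w.
Proof.
move=> n0 [a [k e]].
have nk : (n <= k)%N.
  have := congr1 size e; rewrite size_cat !size_wpow size_rot => h.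
  by rewrite -(leq_pmul2r (_ : 0 < size w)%N) ?lt0n ?size_eq0 -?h ?leq_addr //; apply/eqP.
have wa : rot a w = w.
  case: k n n0 nk e => [|k] [|n] // _ _.
  rewrite !wpowS -catA => /(congr1 (take (size w))).
  by rewrite take_size_cat // take_size_cat ?size_rot.
exists (k - n)%N; move: e; rewrite wa -{1}(subnKC nk) wpowD.
by move=> /(congr1 (drop (size (wpow n w)))); rewrite !drop_size_cat.
Qed.

(* If [Pi^k u] maps a point of [E] outside the dilates [s E], [s < 1], then the
   density of the orbits in [E] produces a product [Pi^(r+k) u] that nearly fixes
   a point up to a factor of modulus [s >= 1]. *)
Lemma expanding_limit_rot_power u (s : R) x e z (y : nat -> 'cV[R]_d) :
  E x -> E e -> 1 <= s -> z = s *: e ->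
  (forall (eta : R) N, 0 < eta -> exists k, [/\ (N <= k)%N, `|y k - x| < eta &
     `|S (wpow k w) *m (S u *m y k) - z| < eta]) ->
  exists2 n, (0 < n)%N & rot_power w (wpow n w ++ u).
Proof.
move=> Ex Ee s1 zE hlim.
have s0 : 0 < s by exact: lt_le_trans s1.
have [K K0 hK] := @det_norm_le R d 1 (s + C).
pose Dd := d%:R * C + 1; have Dd0 : 0 < Dd by rewrite ltr_wpDl // mulr_ge0.
have nS t (v : 'cV[R]_d) : `|S t *m v| <= Dd * `|v|.
  by rewrite (le_trans (normS _ _)) // ler_wpM2r // lerDl.
have nx : 0 < `|x| by rewrite normr_gt0 Enz.
(* With this choice [K * tau] is half of [eps * |x|], so the adjugate bound brings the determinant
   below [eps]. *)
pose tau := eps * `|x| / (2 * K); have tau0 : 0 < tau by rewrite divr_gt0 ?mulr_gt0.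
have [r [sigma sigma1 hr]] := @Edense e x (tau / (2 * s)) Ee Ex
  ltac:(by rewrite divr_gt0 // mulr_gt0).
pose eta := tau / (2 * (Dd * (Dd + 1))).
have eta0 : 0 < eta by rewrite divr_gt0 // !mulr_gt0 // addr_gt0.
have [k [k1 hy hz]] := hlim eta 1%N eta0.
exists (r + k)%N; first exact: leq_trans k1 (leq_addl _ _).
set T := wpow (r + k) w ++ u.
have nsigma : `|sigma| = 1 by case: sigma1 => ->; rewrite ?normrN normr1.
apply: (@Bw T (s * sigma)).
- move=> T0; have := leq_trans (size_wpow_ge (r + k)) (leq_addr (size u) _).
  by rewrite -size_cat -/T T0 leqn0 addn_eq0 => /andP[_ /eqP k0]; rewrite k0 in k1.
- by rewrite normrM nsigma mulr1 ger0_norm // ltW.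
have nM : `|(s * sigma)%:M - S T| <= s + C.
  rewrite (le_trans (ler_normB _ _)) // lerD // -scalemx1 normrZ normrM nsigma mulr1.
  by rewrite ger0_norm ?ler_piMr ?mx_norm1_le // ltW.
have main : `|((s * sigma)%:M - S T) *m x| < tau.
  (* Since [z = s *: e] and [sigma ^ 2 = 1], the term [s *: (S (wpow r w) *m e)] can be inserted.
     The three errors are the distance of [sigma *: (S (wpow r w) *m e)] from [x], of [y k] from
     [x], and of the image of [y k] from [z]. *)
  have -> : ((s * sigma)%:M - S T) *m x =
    (s * sigma) *: (x - sigma *: (S (wpow r w) *m e)) -
    (S (wpow r w) *m (S (wpow k w) *m (S u *m (x - y k)) +
       (S (wpow k w) *m (S u *m y k) - z))).
    have ss : sigma * sigma = 1 by case: sigma1 => ->; rewrite ?mulrNN mulr1.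
    have -> : S (wpow k w) *m (S u *m (x - y k)) +
       (S (wpow k w) *m (S u *m y k) - z) = S (wpow k w) *m (S u *m x) - z.
      by rewrite addrA -mulmxDr -mulmxDr subrK.
    rewrite zE mulmxBr -scalemxAr scalerBr scalerA -mulrA ss mulr1.
    rewrite opprB addrA subrK mulmxBl mul_scalar_mx /T wpowD !prod_word_cat.
    by rewrite !mulmxA.
  rewrite (le_lt_trans (ler_normB _ _)) //.
  rewrite [ltRHS]splitr; apply: ltr_leD.
    rewrite normrZ normrM nsigma mulr1 gtr0_norm // distrC.
    have -> : tau / 2 = s * (tau / (2 * s)) by field; rewrite gt_eqF.
    by rewrite ltr_pM2l.
  rewrite (le_trans (nS _ _)) //.
  have -> : tau / 2 = Dd * ((Dd + 1) * eta) + 0.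
    by rewrite addr0 /eta; field; rewrite !gt_eqF // addr_gt0.
  rewrite addr0 ler_pM2l // (le_trans (ler_normD _ _)) // mulrDl mul1r lerD //.
    rewrite mulmxA -prod_word_cat (le_trans (nS _ _)) // ler_pM2l // distrC ltW //.
  exact: ltW.
have := hK _ x nM; rewrite -(ltr_pM2r nx) => h.
apply: le_lt_trans h _; apply: (@lt_trans _ _ (K * tau)); first by rewrite ltr_pM2l.
have -> : K * tau = eps * `|x| / 2 by rewrite /tau; field; rewrite gt_eqF.
by rewrite ltr_pdivrMr // ltr_pMr ?ltr1n // mulr_gt0.
Qed.


(** Otherwise words of every length carry a point of [E] outside the hull of the images by shorter
    words. This property passes to suffixes, so it holds for all [wpow n w ++ u]. The limit of the
    escaping images is [s *: e]: if [s < 1], nearby points are inside the hull, and if [1 <= s], the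
    word is a power of [w] and the images stay in [E]. *)
Lemma orbit_hull_stable : exists2 K, (0 < K)%N &
  forall s, size s = K -> forall y, E y -> orbit_hull K (S s *m y).
Proof.
apply: contrapT => noK.
pose P s := exists2 y, E y & ~ orbit_hull (size s) (S s *m y).
have Pc s t : P (s ++ t) -> P t.
  move=> [y Ey h]; exists y => // ht; apply: h.
  by rewrite size_cat prod_word_cat -mulmxA; exact: orbit_hull_mulS.
have Pn n : exists2 s, size s = n & P s.
  have [[|i s] // sn Ps] : exists2 s, size s = n.+1 & P s.
    apply: contrapT => h; apply: noK; exists n.+1 => // s sn y Ey.
    by apply: contrapT => hy; apply: h; exists s => //; exists y; rewrite ?sn.
  by exists s; [case: sn | exact: (Pc [:: i])].
have [k0 [r r0 kr]] := orbit_hull_ball.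
(* The hull for a short word may have empty interior, so [P] alone gives no lower bound on the
   product. Prepending at least [k0] letters brings in the ball of radius [r], which an escaping
   image must avoid. *)
pose P' s := exists2 t, (k0 <= size t)%N & P (t ++ s).
have P'c s t : P' (s ++ t) -> P' t.
  move=> [u uk]; rewrite catA => Pu; exists (u ++ s) => //.
  by rewrite size_cat (leq_trans uk) ?leq_addr.
have P'n n : exists2 s, size s = n & P' s.
  have [s sn Ps] := Pn (k0 + n)%N; exists (drop k0 s).
    by rewrite size_drop sn addKn.
  by exists (take k0 s); rewrite ?cat_take_drop // size_takel // sn leq_addr.
have [[CE hCE] clE] := (compact_mxP E).1 Ecomp.
have CE0 : 0 <= CE by exact: le_trans (hCE _ Ee0).
pose L := d%:R * C * (d%:R * CE) + 1.
have L0 : 0 < L by rewrite ltr_wpDl // !mulr_ge0.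
have P'delta s : P' s -> r / L <= `|S s|.
  move=> [t tk [y Ey hy]]; rewrite ler_pdivrMr // leNgt; apply/negP => h.
  apply: hy; apply: (@orbit_hull_le k0).
    by rewrite size_cat (leq_trans tk) ?leq_addr.
  apply: kr; apply: le_lt_trans h; rewrite prod_word_cat -mulmxA.
  rewrite (le_trans (normS _ _)) // /L mulrDr mulr1 -[leLHS]addr0 lerD //.
  rewrite mulrCA ler_wpM2l ?mulr_ge0 // (le_trans (mx_norm_mulmx _ _)) //.
  by rewrite -mulrA mulrCA ler_wpM2l // ler_wpM2l // hCE.
have [u P'u] := periodic_suffixes BC (divr_gt0 r0 L0) eps0 near_singular_Bw P'c P'n P'delta.
have Pu n : P (wpow n w ++ u) by have [t _] := P'u n; exact: Pc.
have /choice[y hy] n : exists y, E y /\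
    ~ orbit_hull (size (wpow n w ++ u)) (S (wpow n w ++ u) *m y).
  by have [y] := Pu n; exists y.
have yb k : `|S u *m y k| <= d%:R * C * CE.
  by rewrite (le_trans (normS _ _)) // ler_wpM2l ?mulr_ge0 // hCE //; case: (hy k).
have [||x [z hxz]] := @bounded_cluster_pair R d y
  (fun k => S (wpow k w) *m (S u *m y k)) (CE + d%:R * C * (d%:R * C * CE)).
- move=> k; rewrite (le_trans (hCE _ _)) //; first by case: (hy k).
  by rewrite lerDl !mulr_ge0.
- move=> k; rewrite (le_trans (normS _ _)) // (le_trans (ler_wpM2l _ (yb k))) ?mulr_ge0 //.
  by rewrite lerDr.
have Ex : E x.
  apply: clE => e e_gt0; have [k [_ h _]] := hxz e 0%N e_gt0.
  by exists (y k); [case: (hy k) | rewrite distrC].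
have [|s [e Ee [s0 zE]]] := @Elim (fun k => S u *m y k) _ z yb.
  by move=> e N e_gt0; have [k [? _ ?]] := hxz e N e_gt0; exists k.
have [s1|s1] := ltP s 1; last first.
  have [n n0 hn] := expanding_limit_rot_power Ex Ee s1 zE hxz.
  have [k uE] := rot_power_tail n0 hn.
  have [v Ev []] := Pu 1%N; rewrite uE -wpowD.
  apply: orbit_hull_E; last exact: E_wpow.
  exact: leq_trans (size_wpow_ge _).
(* From index [k0.+1] on, the hull contains both [E] and the ball of radius [r], so it swallows the
   points within [(1 - s) * r] of [s *: e]. *)
have [|k [k0k _ hk]] := hxz ((1 - s) * r) k0.+1; first by rewrite mulr_gt0 // subr_gt0.
have [_] := hy k; apply.
apply: (@orbit_hull_le k0.+1).
  by rewrite size_cat (leq_trans k0k) // (leq_trans (size_wpow_ge _)) // leq_addr.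
rewrite prod_word_cat -mulmxA.
apply: (@convex_interior_scale _ _ _ r s e) => //.
- exact: orbit_hull_convex.
- by move=> v /kr; apply: orbit_hull_le.
- exact: orbit_hull_E.
- by rewrite -zE.
Qed.

(** By induction on letters: a generating word of length below [K] prefixed by one letter either
    stays below [K] or has length exactly [K], the case covered by stability. *)
Lemma orbit_hull_word_sub K :
  (0 < K)%N -> (forall s, size s = K -> forall y, E y -> orbit_hull K (S s *m y)) ->
  forall s y, orbit_hull K y -> orbit_hull K (S s *m y).
Proof.
move=> K0 hK; elim=> [|i s IH] y hy; first by rewrite prod_word_nil mul1mx.
rewrite prod_word_cons -mulmxA; move: (S s *m y) (IH y hy) => {IH hy} {}y.
rewrite -[A in A *m _]mulmx1 -(prod_word_nil B) -prod_word_cons.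
have := @hull_convex _ _ [set x | exists2 s, (size s < K)%N & exists2 y, E y & x = S s *m y].
move/(@convex_preimage _ _ (S [:: i])) => cK; apply: (hull_sub cK).
move=> _ [t tK [v Ev ->]] /=; rewrite mulmxA -prod_word_cat /=.
have [tK'|] := ltnP (size t).+1 K; first exact: orbit_hull_word.
by move=> h; apply: hK => //=; apply/eqP; rewrite eqn_leq h andbT.
Qed.

(** For the inclusion of the hull in the hull of its images, every generator must begin with a
    letter. The empty word is the only obstacle; a point of [E] is rewritten as the image under [w]
    of another point of [E], and [w] has a first letter. *)
Lemma orbit_hull_invariant K :
  (0 < K)%N -> (forall s, size s = K -> forall y, E y -> orbit_hull K (S s *m y)) ->
  hull (\bigcup_(i in [set: 'I_m]) [set B i *m x | x in orbit_hull K]) = orbit_hull K.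
Proof.
move=> K0 hK; have sub := orbit_hull_word_sub K0 hK.
apply/seteqP; split; apply: hull_sub; try exact: hull_convex.
  move=> _ [i _ [x hx <-]].
  by have := sub [:: i] x hx; rewrite prod_word_cons prod_word_nil mulmx1.
move=> _ [[|i s] sK [y Ey ->]]; last first.
  apply: sub_hull; exists i => //; exists (S s *m y).
    by apply: sub; exact: orbit_hull_E.
  by rewrite prod_word_cons mulmxA.
have [v Ev ->] := EPi_onto Ey; rewrite prod_word_nil mul1mx.
case: w w0 => // i t _; apply: sub_hull; exists i => //; exists (S t *m v).
  by apply: sub; exact: orbit_hull_E.
by rewrite prod_word_cons mulmxA.
Qed.

Lemma orbit_hull_body K :
  (0 < K)%N -> (forall s, size s = K -> forall y, E y -> orbit_hull K (S s *m y)) ->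
  convex_body (orbit_hull K).
Proof.
move=> K0 hK; split.
- exact: orbit_hull_convex.
- exact: orbit_hull_compact.
- have [k [r r0 hr]] := orbit_hull_ball.
  exists 0; apply/interior_mxP; exists r => // y; rewrite sub0r normrN => /hr.
  (* The ball was found in [orbit_hull k] for an unrelated [k]; stability puts the images of [E]
     under words of any length into [orbit_hull K]. *)
  apply: hull_sub => [|_ [s _ [v Ev ->]]]; first exact: hull_convex.
  by apply: orbit_hull_word_sub => //; exact: orbit_hull_E.
- by move=> x; exact: orbit_hull_opp.
Qed.


(** * Comparison with an arbitrary invariant body *)

Section Uniqueness.
Variable G' : set 'cV[R]_d.
Hypothesis bodyG' : convex_body G'.
Hypothesis invG' : hull (\bigcup_(i in [set: 'I_m]) [set B i *m x | x in G']) = G'.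

Let cG' : Defs.convex G'. Proof. by case: bodyG'. Qed.
Let sG' x : G' x -> G' (- x). Proof. by case: bodyG' => _ _ _; apply. Qed.
Let kG' : compact G'. Proof. by case: bodyG'. Qed.

Lemma invariant_body_word s x : G' x -> G' (S s *m x).
Proof.
elim: s => [|i s IH] Gx; first by rewrite prod_word_nil mul1mx.
rewrite prod_word_cons -mulmxA -invG'; apply: sub_hull; exists i => //.
by exists (S s *m x) => //; exact: IH.
Qed.

(** Iterating the invariance shows that [G'] is the hull of its own images under the words of any
    fixed length. *)
Lemma invariant_body_sub X n : Defs.convex X ->
  (forall s, size s = n -> forall x, G' x -> X (S s *m x)) -> G' `<=` X.
Proof.
move=> cX; elim: n => [|n IH] hX.
  by move=> x /(hX [::] erefl); rewrite prod_word_nil mul1mx.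
apply: IH => s sn; rewrite -{1}invG'; apply: (hull_sub (convex_preimage cX)).
move=> _ [i _ [x Gx <-]] /=; have := hX (rcons s i) _ x Gx.
by rewrite -cats1 prod_word_cat prod_word_cons prod_word_nil mulmx1 mulmxA size_cat addn1 sn; apply.
Qed.

(** The orbit of one point of [s E] stays in [G'] and is dense in [s E] up to sign; symmetry and
    closedness of [G'] do the rest. *)
Lemma invariant_body_E (s : R) x y : E x -> E y -> 0 <= s -> G' (s *: x) -> G' (s *: y).
Proof.
move=> Ex Ey s0 Gx; have [_ clG] := (compact_mxP G').1 kG'.
apply: clG => e e_gt0.
have s10 : 0 < s + 1 by rewrite ltr_wpDl.
have [k [sigma hs hk]] := Edense Ex Ey (divr_gt0 e_gt0 s10).
exists (s *: (sigma *: (S (wpow k w) *m x))).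
  rewrite scalerA mulrC -scalerA scalemxAr.
  have Gk : G' (S (wpow k w) *m (s *: x)) by exact: invariant_body_word.
  by case: hs => ->; rewrite ?scale1r // scaleN1r; exact: sG'.
rewrite distrC -scalerBr normrZ ger0_norm // .
rewrite ltr_pdivlMr // in hk; apply: le_lt_trans hk.
by rewrite mulrC ler_wpM2l // lerDl.
Qed.

Lemma invariant_body_radius : exists2 c : R, 0 < c &
  forall s x, 0 <= s -> E x -> (G' (s *: x) <-> s <= c).
Proof.
have [[D hD] clG] := (compact_mxP G').1 kG'.
have [r r0 hr] := convex_body_ball bodyG'.
have ne : 0 < `|e0| by rewrite normr_gt0 Enz.
pose Q := [set s : R | 0 <= s /\ G' (s *: e0)].
have Qsup : has_sup Q.
  split; first by exists 0; split => //; rewrite scale0r; apply: hr; rewrite normr0.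
  exists (D / `|e0|) => s [s0 /hD]; rewrite normrZ ger0_norm // => h.
  by rewrite ler_pdivlMr.
have Qr : Q (r / (2 * `|e0|)).
  split; first by rewrite divr_ge0 // ltW // mulr_gt0.
  apply: hr; rewrite normrZ ger0_norm; last by rewrite divr_ge0 // ltW // mulr_gt0.
  have -> : r / (2 * `|e0|) * `|e0| = r / 2 by field; rewrite gt_eqF.
  by rewrite ltr_pdivrMr // ltr_pMr ?ltr1n.
have c0 : 0 < sup Q.
  apply: lt_le_trans (_ : r / (2 * `|e0|) <= _); first by rewrite divr_gt0 // mulr_gt0.
  by apply: ub_le_sup => //; case: Qsup.
have Gc : G' (sup Q *: e0).
  apply: clG => e e_gt0.
  have [s [s0 Gs] hs] := sup_adherent (divr_gt0 e_gt0 ne) Qsup.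
  exists (s *: e0) => //; rewrite -scalerBl normrZ ger0_norm.
    by rewrite -ltr_pdivlMr // ltrBlDr addrC -ltrBlDr.
  by rewrite subr_ge0; apply: ub_le_sup => //; case: Qsup.
exists (sup Q) => // s x s0 Ex; split=> [Gx|sc].
  apply: ub_le_sup; first by case: Qsup.
  by split => //; exact: (invariant_body_E Ex).
apply: (invariant_body_E Ee0 Ex s0).
have -> : s *: e0 = (s / sup Q) *: (sup Q *: e0) by rewrite scalerA divfK ?gt_eqF.
apply: convex_scale => //; first by apply: hr; rewrite normr0.
  by rewrite divr_ge0 // ltW.
by rewrite ler_pdivrMr // mul1r.
Qed.

Lemma invariant_body_unique K :
  (0 < K)%N -> (forall s, size s = K -> forall y, E y -> orbit_hull K (S s *m y)) ->
  exists2 c : R, 0 < c & G' = dilate c (orbit_hull K).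
Proof.
move=> K0 hK; have sub := orbit_hull_word_sub K0 hK.
set G := orbit_hull K; have bodyG : convex_body G by exact: orbit_hull_body.
have [cG kG _ _] := bodyG.
have [r r0 Gr] := convex_body_ball bodyG.
have [[D hD] clG'] := (compact_mxP G').1 kG'.
have [_ clG] := (compact_mxP G).1 kG.
have [c c0 hc] := invariant_body_radius; exists c => //.
have D0 : 0 <= D.
  by apply: le_trans (normr_ge0 _) (hD (c *: e0) _); apply/hc => //; exact: ltW.
apply/seteqP; split; last first.
  move=> _ [x Gx <-]; rewrite -mul_scalar_mx; move: x Gx.
  apply: hull_sub; first exact: convex_preimage.
  move=> _ [s _ [y Ey ->]] /=; rewrite mul_scalar_mx scalemxAr.
  by apply: invariant_body_word; apply/hc => //; exact: ltW.
suff key (eta : R) : 0 < eta -> forall x, G' x -> G ((c + eta)^-1 *: x).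
  move=> x Gx; exists (c^-1 *: x); last by rewrite scalerA divff ?scale1r // gt_eqF.
  apply: clG => e e_gt0.
  (* The two dilation factors differ by [eta / (c * (c + eta))], at most [eta / c ^+ 2], and points
     of [G'] have norm at most [D]. *)
  pose eta := e * c ^+ 2 / (D + 1).
  have D1 : 0 < D + 1 by rewrite ltr_wpDl.
  have eta0 : 0 < eta by rewrite divr_gt0 // mulr_gt0 // exprn_gt0.
  have ce : 0 < c + eta by rewrite addr_gt0.
  exists ((c + eta)^-1 *: x); first exact: key.
  rewrite -scalerBl normrZ ger0_norm; last first.
    by rewrite subr_ge0 lef_pV2 ?posrE // lerDl ltW.
  have -> : c^-1 - (c + eta)^-1 = eta / (c * (c + eta)) by field; rewrite !gt_eqF.
  apply: (@le_lt_trans _ _ (eta / c ^+ 2 * D)).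
    apply: ler_pM => //; last exact: hD.
      by apply: divr_ge0; [exact: ltW | apply: mulr_ge0; exact: ltW].
    rewrite ler_pM2l // lef_pV2 ?posrE; [|exact: mulr_gt0|exact: exprn_gt0].
    by rewrite expr2 ler_pM2l // lerDl ltW.
  have -> : eta / c ^+ 2 * D = e * D / (D + 1) by rewrite /eta; field; rewrite !gt_eqF.
  by rewrite ltr_pdivrMr // ltr_pM2l // ltrDl.
move=> eta0; have ce : 0 < c + eta by rewrite addr_gt0.
pose X := [set x : 'cV[R]_d | G ((c + eta)^-1 *: x)].
have cX : Defs.convex X.
  have := @convex_preimage _ _ ((c + eta)^-1%:M) _ cG.
  by rewrite /X; under eq_set do rewrite mul_scalar_mx.
suff [n hn] : exists n, forall s, size s = n -> forall x, G' x -> X (S s *m x).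
  exact: (invariant_body_sub cX hn).
apply: contrapT => noN.
pose P s := exists2 x, G' x & ~ X (S s *m x).
(* Here failure passes to prefixes, because the inner factor [t] only moves the starting point
   within [G']; hence the words grow to the right. *)
have Pc s t : P (s ++ t) -> P s.
  move=> [x Gx hx]; exists (S t *m x); first exact: invariant_body_word.
  by move=> h; apply: hx; rewrite prod_word_cat -mulmxA.
have Pn n : exists2 s, size s = n & P s.
  apply: contrapT => h; apply: noN; exists n => s sn x Gx.
  by apply: contrapT => hx; apply: h; exists s => //; exists x.
pose L := d%:R * D + 1; have L0 : 0 < L by rewrite ltr_wpDl // mulr_ge0.
have Pdelta s : P s -> (c + eta) * r / L <= `|S s|.
  move=> [x Gx hx]; rewrite ler_pdivrMr // leNgt; apply/negP => h.
  apply: hx; apply: Gr; rewrite normrZ gtr0_norm ?invr_gt0 //.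
  rewrite mulrC ltr_pdivrMr // [r * _]mulrC; apply: le_lt_trans h.
  rewrite (le_trans (mx_norm_mulmx _ _)) // /L mulrDr mulr1 -[leLHS]addr0 lerD //.
  by rewrite mulrAC mulrC ler_wpM2l // ler_wpM2l // hD.
have [u Pu] := periodic_prefixes BC (divr_gt0 (mulr_gt0 ce r0) L0) eps0
  near_singular_Bw Pc Pn Pdelta.
have /choice[x hx] n : exists x, G' x /\ ~ X (S (u ++ wpow n w) *m x).
  by have [x] := Pu n; exists x.
have [|z Gz hz] := @compact_cluster_point R d 1 G' (fun n => S (wpow n w) *m x n) kG'.
  by move=> n; apply: invariant_body_word; case: (hx n).
have [||s [e Ee [s0 zE]]] := @Elim x D z.
- by move=> k; apply: hD; case: (hx k).
- by move=> e N e_gt0; have [k ? ?] := hz e N e_gt0; exists k.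
have sc : s <= c by apply/(hc _ _ s0 Ee); rewrite -zE.
have t1 : s / (c + eta) < 1.
  by rewrite ltr_pdivrMr // mul1r (le_lt_trans sc) // ltrDl.
pose L2 := d%:R * C + 1; have L20 : 0 < L2 by rewrite ltr_wpDl // mulr_ge0.
pose tau := (1 - s / (c + eta)) * r * (c + eta) / L2.
have tau0 : 0 < tau by rewrite divr_gt0 // !mulr_gt0 // subr_gt0.
have [k _ hk] := hz tau 0%N tau0.
have [_] := hx k; apply; rewrite /X /=.
apply: (@convex_interior_scale _ _ _ r (s / (c + eta)) (S u *m e)) => //.
- by rewrite divr_ge0 // ltW.
- by apply: sub; exact: orbit_hull_E.
have -> : (s / (c + eta)) *: (S u *m e) = (c + eta)^-1 *: (S u *m z).
  by rewrite zE -scalemxAr scalerA mulrC.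
rewrite prod_word_cat -mulmxA -scalerBr -mulmxBr normrZ gtr0_norm ?invr_gt0 //.
rewrite mulrC ltr_pdivrMr // (le_lt_trans (normS _ _)) //.
rewrite ltr_pdivlMr // in hk; apply: le_lt_trans hk.
by rewrite mulrC ler_wpM2l // lerDl.
Qed.

End Uniqueness.

End Dynamics.

Local Open Scope complex_scope.

(** * Spectra over the complex numbers *)

Lemma char_poly_tr (F : fieldType) n (T : 'M[F]_n) : char_poly T^T = char_poly T.
Proof.
rewrite /char_poly -det_tr; congr (\det _); apply/matrixP => i j.
by rewrite !mxE eq_sym.
Qed.

Lemma char_poly_eval (F : fieldType) n (T : 'M[F]_n) a :
  (char_poly T).[a] = \det (a%:M - T).
Proof.
rewrite horner_sum; apply: eq_bigr => s _.
rewrite hornerM horner_exp !hornerE; congr (_ * _).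
rewrite (big_morph _ (fun p q => hornerM p q a) (hornerC 1 a)).
by apply: eq_bigr => i _; rewrite !mxE !(hornerE, hornerMn).
Qed.

(* Choose an invertible [P] whose first [k] rows span the kernel of [T - l]: those
   rows of [P (X - T)] are divisible by [X - l], hence [(X - l)^k] divides the
   characteristic polynomial. *)
Lemma rank_kermx_le_mup (F : fieldType) n (T : 'M[F]_n) l :
  (\rank (kermx (T - l%:M)) <= mup l (char_poly T))%N.
Proof.
set K := kermx _; set k := \rank K; pose P := row_ebase K.
have kn : (k <= n)%N by exact: rank_leq_row.
have Punit : P \in unitmx by exact: row_ebase_unit.
have PK : pid_mx k *m P *m (T - l%:M) = 0 :> 'M[F]_n.
  have -> : pid_mx k *m P = invmx (col_ebase K) *m K.
    by rewrite -{2}[K]mulmx_ebase -mulmxA mulKmx // col_ebase_unit.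
  by rewrite -mulmxA mulmx_ker mulmx0.
have Prow (i : 'I_n) : (i < k)%N -> forall j, (P *m T) i j = l * P i j.
  move=> ik j; have := congr1 (fun M : 'M[F]_n => M i j) PK.
  rewrite -mulmxA mulmxBr mul_mx_scalar; move: (P *m T) => Q.
  rewrite mxE (bigD1 i) //= big1 => [|a ai]; last first.
    move: ai; rewrite -val_eqE eq_sym => /negPf /= ai.
    by rewrite mxE ai mul0r.
  by rewrite !mxE eqxx ik mul1r addr0 => /eqP; rewrite subr_eq0 => /eqP.
pose N := \matrix_(i < n, j < n) if (i < k)%N then (P i j)%:P
  else (map_mx polyC P *m char_poly_mx T) i j.
pose D : 'rV[{poly F}]_n := \row_(i < n) if (i < k)%N then 'X - l%:P else 1.
have PDN : map_mx polyC P *m char_poly_mx T = diag_mx D *m N.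
  apply/matrixP => i j; rewrite mul_diag_mx [RHS]mxE [N i j]mxE [D _ _]mxE.
  case: ifP => ik; last by rewrite mul1r.
  have -> : (map_mx polyC P *m char_poly_mx T) i j =
      (P i j)%:P * 'X - ((P *m T) i j)%:P.
    rewrite !mxE rmorph_sum /= (bigD1 j) //= [X in _ = _ - X](bigD1 j) //= opprD addrA.
    rewrite !mxE eqxx mulr1n mulrBr -rmorphM; congr (_ + _).
    rewrite -sumrN; apply: eq_bigr => a aj.
    by rewrite !mxE (negPf aj) mulr0n sub0r mulrN -rmorphM.
  by rewrite Prow // rmorphM /= mulrBl mulrC.
have cP : char_poly T != 0 by rewrite monic_neq0 // char_poly_monic.
rewrite mup_geq //.
have := congr1 determinant PDN; rewrite !det_mulmx det_diag det_map_mx /=.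
rewrite -/(char_poly T) mul_polyC => e.
rewrite -(@dvdpZr _ (\det P)); last by rewrite -unitfE -unitmxE.
rewrite e; apply: dvdp_mulr; under eq_bigr do rewrite mxE.
by rewrite -big_mkcond /= (big_ord_narrow kn) /= big_const_ord iter_mulr_1 dvdpp.
Qed.

(** The geometric multiplicity is at most the algebraic one, so the eigenspace is a line. The
    transposes appear because [kermx] is a kernel of row vectors. *)
Lemma simple_root_kernel (F : fieldType) n (T : 'M[F]_n) l (u v : 'cV[F]_n) :
  mup l (char_poly T) = 1%N -> T *m u = l *: u -> T *m v = l *: v -> v != 0 ->
  exists c, u = c *: v.
Proof.
move=> l1 Tu Tv v0.
have ker (x : 'cV_n) : T *m x = l *: x -> (x^T <= kermx (T^T - l%:M))%MS.
  move=> Tx; apply/sub_kermxP.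
  by rewrite mulmxBr -trmx_mul Tx mul_mx_scalar linearZ subrr.
have rk := rank_kermx_le_mup T^T l; rewrite char_poly_tr l1 in rk.
have /eqmxP vK : (v^T == kermx (T^T - l%:M))%MS.
  rewrite -(geq_leqif (mxrank_leqif_eq (ker v Tv))).
  by rewrite (leq_trans rk) // lt0n mxrank_eq0 -(inj_eq (@trmx_inj _ _ _)) trmxK trmx0.
have : (u^T <= v^T)%MS by rewrite vK ker.
case/sub_rVP => c uc; exists c; apply: trmx_inj.
by rewrite uc linearZ.
Qed.

Lemma cmod_real (R : realType) (x : R) : cmod x%:C = `|x|.
Proof. by rewrite /= expr0n addr0 sqrtr_sqr. Qed.

Lemma cmod_ge0 (R : realType) (z : R[i]) : 0 <= cmod z.
Proof. by case: z => a b; rewrite /= sqrtr_ge0. Qed.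

Lemma cmodD (R : realType) (x y : R[i]) : cmod (x + y) <= cmod x + cmod y.
Proof. exact: le_normcD. Qed.

Lemma cmod_sub (R : realType) (x y : R[i]) : cmod x - cmod y <= cmod (x - y).
Proof.
rewrite lerBlDr; have := cmodD (x - y) y.
by rewrite subrK.
Qed.

Lemma cmod_prod (R : realType) (I : Type) (r : seq I) (F : I -> R[i]) :
  cmod (\prod_(i <- r) F i) = \prod_(i <- r) cmod (F i).
Proof.
elim: r => [|i r IH]; first by rewrite !big_nil; exact: ComplexField.Normc.normc1.
by rewrite !big_cons ComplexField.Normc.normcM IH.
Qed.

Lemma cmod_sum (R : realType) (I : Type) (r : seq I) (F : I -> R[i]) :
  cmod (\sum_(i <- r) F i) <= \sum_(i <- r) cmod (F i).
Proof.
elim: r => [|i r IH]; first by rewrite !big_nil ComplexField.Normc.normc0.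
by rewrite !big_cons (le_trans (cmodD _ _)) // lerD2l.
Qed.

Lemma char_poly_split (R : realType) (d : nat) (M : 'M[R]_d) :
  exists zs : seq R[i],
    [/\ char_poly (complexify M) = \prod_(z <- zs) ('X - z%:P), size zs = d &
        forall z, (z \in zs) = eigenvalue (complexify M) z].
Proof.
have [zs zsE] := closed_field_poly_normal (char_poly (complexify M)).
have /monicP lc := char_poly_monic (complexify M); rewrite lc scale1r in zsE.
exists zs; split => // [|z].
  apply: succn_inj; rewrite -(size_char_poly (complexify M)) zsE.
  by rewrite size_prod_XsubC.
by rewrite eigenvalue_root_char zsE root_prod_XsubC.
Qed.

(** The determinant is the characteristic polynomial at [sigma], a product of [d] factors each of
    modulus at least [|sigma| - theta]. *)
Lemma det_lower_bound (R : realType) (d : nat) (M : 'M[R]_d) (sigma theta : R) :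
  (forall z, eigenvalue (complexify M) z -> cmod z <= theta) -> theta <= `|sigma| ->
  (`|sigma| - theta) ^+ d <= `|\det (sigma%:M - M)|.
Proof.
move=> zle th; have [zs [zsE szs zseig]] := char_poly_split M.
have {szs} -> : (`|sigma| - theta) ^+ d = (`|sigma| - theta) ^+ size zs by rewrite szs.
rewrite -[leRHS]cmod_real.
have -> : (\det (sigma%:M - M))%:C = \det ((sigma%:C)%:M - complexify M).
  by rewrite -det_map_mx /complexify map_mxB map_scalar_mx.
rewrite -char_poly_eval zsE horner_prod cmod_prod.
rewrite -iter_mulr_1 -big_const_ord (big_nth 0) big_mkord; apply: ler_prod => i _.
rewrite subr_ge0 th /= hornerXsubC.
apply: le_trans (cmod_sub _ _); rewrite cmod_real lerD2l lerN2.
by apply: zle; rewrite -zseig mem_nth.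
Qed.

Lemma has_sup_eigenvalues (R : realType) (d : nat) (M : 'M[R]_d) : (0 < d)%N ->
  has_sup [set cmod z | z in [set z : R[i] | eigenvalue (complexify M) z]].
Proof.
move=> d0; have [zs [zsE szs zseig]] := char_poly_split M; split.
  case: zs szs zseig {zsE} => [|z zs] szs h; first by rewrite -szs in d0.
  by exists (cmod z), z; rewrite //= -h mem_head.
exists (\sum_(z <- zs) cmod z) => _ [z /= ez <-].
rewrite -zseig in ez; rewrite (big_rem z) //= lerDl.
by apply: sumr_ge0 => ? _; exact: cmod_ge0.
Qed.

Lemma le_spectral_radius (R : realType) (d : nat) (M : 'M[R]_d) z :
  eigenvalue (complexify M) z -> cmod z <= spectral_radius M.
Proof.
move=> ez; have d0 : (0 < d)%N.
  by case: d M ez => // M /eigenvalueP[v _]; rewrite thinmx0 eqxx.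
by apply: ub_le_sup; [case: (has_sup_eigenvalues M d0) | exists z].
Qed.

Lemma spectral_radius_ge0 (R : realType) (d : nat) (M : 'M[R]_d) : (0 < d)%N ->
  0 <= spectral_radius M.
Proof.
move=> d0; have [[_ [z ez _]] _] := has_sup_eigenvalues M d0.
exact: le_trans (cmod_ge0 z) (le_spectral_radius ez).
Qed.

Lemma spectral_radius_leading (R : realType) (d : nat) (M : 'M[R]_d) l :
  leading_eigenvalue M l -> spectral_radius M = cmod l.
Proof.
move=> [el hl]; apply/eqP; rewrite eq_le le_spectral_radius // andbT.
apply: ge_sup; first by exists (cmod l), l.
by move=> _ [z ez <-]; exact: hl.
Qed.

(** * Powers of a matrix with a simple leading eigenvalue *)

Lemma small_power (R : realType) (x A e : R) : 0 <= x -> x < 1 -> 0 < e ->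
  exists N, forall n, (N <= n)%N -> x ^+ n * A < e.
Proof.
move=> x0 x1 e0; have A1 : 0 < `|A| + 1 by rewrite ltr_wpDl.
have /cvgrPdist_lt/(_ (e / (`|A| + 1)) (divr_gt0 e0 A1)) [N _ hN] :
  (fun n => x ^+ n) @ \oo --> (0 : R) by apply: cvg_expr; rewrite ger0_norm.
exists N => n Nn; have := hN n Nn; rewrite /= sub0r normrN ger0_norm ?exprn_ge0 //.
rewrite ltr_pdivlMr // => h; apply: le_lt_trans h; rewrite ler_wpM2l ?exprn_ge0 //.
by rewrite (le_trans (ler_norm _)) // lerDl.
Qed.

Lemma contracting_recurrence (R : realType) (theta : R) (a b : nat -> R) :
  0 <= theta -> theta < 1 -> (forall n, a n.+1 <= theta * a n + b n) ->
  (forall e, 0 < e -> exists N, forall n, (N <= n)%N -> b n < e) ->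
  forall e, 0 < e -> exists N, forall n, (N <= n)%N -> a n < e.
Proof.
move=> t0 t1 hab hb e e0; have t10 : 0 < 1 - theta by rewrite subr_gt0.
(* The error [(1 - theta) * e / 2] sums geometrically to at most [e / 2]. *)
have [N hN] := hb (e / 2 * (1 - theta)) (mulr_gt0 (divr_gt0 e0 (ltr0Sn _ 1)) t10).
have aN k : a (N + k)%N <= theta ^+ k * a N + e / 2.
  elim: k => [|k IH]; first by rewrite addn0 expr0 mul1r lerDl divr_ge0 // ltW.
  rewrite addnS (le_trans (hab _)) // exprS -mulrA.
  have := hN _ (leq_addr k N); have := ler_wpM2l t0 IH; lra.
have [K hK] := small_power (a N) t0 t1 (divr_gt0 e0 (ltr0Sn _ 1)).
exists (N + K)%N => n NKn; have Nn : (N <= n)%N := leq_trans (leq_addr _ _) NKn.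
rewrite -(subnKC Nn); apply: le_lt_trans (aN _) _.
rewrite [ltRHS]splitr ltrD2r; apply: hK.
by rewrite leq_subRL.
Qed.

Definition decays (R : realType) (u : nat -> R[i]) := forall e : R, 0 < e ->
  exists N, forall n, (N <= n)%N -> cmod (u n) < e.

(** Peel off the last factor: [T ^+ n * ((T - z%:M) * Y)] decays by induction and equals
    [T ^+ n.+1 * Y - z *: (T ^+ n * Y)]. So the entries of [T ^+ n * Y] obey a recurrence with
    contraction factor [cmod z < 1]. *)
Lemma prod_shift_decays (R : realType) (d : nat) (T : 'M[R[i]]_d.+1) zs
    (Y : 'M[R[i]]_d.+1) :
  (forall z, z \in zs -> cmod z < 1) -> \prod_(z <- zs) (T - z%:M) * Y = 0 ->
  forall i j, decays (fun n => (T ^+ n * Y) i j).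
Proof.
elim/last_ind: zs Y => [|zs z IH] Y zs1.
  rewrite big_nil mul1r => -> i j e e0; exists 0%N => n _.
  by rewrite mulr0 mxE ComplexField.Normc.normc0.
rewrite big_rcons -mulrA => TY i j.
have IHz := IH ((T - z%:M) * Y) _ TY i j.
apply: (@contracting_recurrence _ (cmod z) _
  (fun n => cmod ((T ^+ n * ((T - z%:M) * Y)) i j))).
- exact: cmod_ge0.
- by apply: zs1; rewrite mem_rcons mem_head.
- move=> n; rewrite -ComplexField.Normc.normcM.
  apply: le_trans (cmodD _ _); rewrite le_eqVlt; apply/orP; left; apply/eqP.
  congr cmod; rewrite mulrA mulrBr mulrBl -exprSr.
  have -> : T ^+ n * z%:M * Y = z *: (T ^+ n * Y).
    by rewrite -!mulmxE mul_mx_scalar scalemxAl.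
  suff: forall P Q : 'M[R[i]]_d.+1, P i j = z * Q i j + (P - z *: Q) i j by exact.
  by move=> P Q; rewrite !mxE [RHS]addrC subrK.
- by apply: IHz => x xs; apply: zs1; rewrite mem_rcons inE xs orbT.
Qed.

(** [Y] commutes with the powers, so [Y z] splits into [Y (z - M^k y_k)] and [M^k Y y_k]; the first
    is small for suitable [k], and the second because [Y] removes everything but the subcritical
    spectrum. Taking for [Y] the leading factors confines limits to the leading eigenspaces. *)
Lemma limit_kernel (R : realType) (d : nat) (M : 'M[R]_d.+1) zs (Y : 'M[R[i]]_d.+1)
    (y : nat -> 'cV[R]_d.+1) (D : R) (z : 'cV[R]_d.+1) :
  (forall z, z \in zs -> cmod z < 1) ->
  \prod_(z <- zs) (complexify M - z%:M) * Y = 0 ->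
  GRing.comm Y (complexify M) -> (forall k, `|y k| <= D) ->
  (forall (e : R) N, 0 < e -> exists2 k, (N <= k)%N & `|M ^+ k *m y k - z| < e) ->
  Y *m map_mx (real_complex R) z = 0.
Proof.
move=> zs1 TY YT yD hz; set T := complexify M in TY YT *.
have D0 : 0 <= D by exact: le_trans (yD 0%N).
have dec := prod_shift_decays zs1 TY.
have powC k : map_mx (real_complex R) (M ^+ k) = T ^+ k by rewrite rmorphXn.
apply/matrixP => i j; rewrite [RHS]mxE {j}(ord1 j).
apply: ComplexField.Normc.eq0_normc; apply/eqP; rewrite eq_le cmod_ge0 andbT.
apply/ler_addgt0Pr => e e0; rewrite add0r.
pose s := \sum_j cmod (Y i j) + 1.
have s0 : 0 < s by rewrite ltr_wpDl // sumr_ge0 // => *; exact: cmod_ge0.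
have e2 : 0 < e / 2 by rewrite divr_gt0.
have t0 : 0 < e / 2 / (d.+1%:R * (D + 1)).
  by rewrite divr_gt0 // mulr_gt0 // ltr_wpDl.
have /choice[N hN] j : exists N, forall n, (N <= n)%N ->
    cmod ((T ^+ n * Y) i j) < e / 2 / (d.+1%:R * (D + 1)).
  exact: dec.
have [k Nk hk] := hz (e / 2 / s) (\max_j N j)%N (divr_gt0 e2 s0).
have -> : Y *m map_mx (real_complex R) z =
    Y *m map_mx (real_complex R) (z - M ^+ k *m y k) +
    (T ^+ k * Y) *m map_mx (real_complex R) (y k).
  rewrite -(commrX k YT) -mulmxE -mulmxA -powC -map_mxM -mulmxDr -map_mxD.
  by rewrite subrK.
rewrite mxE (le_trans (cmodD _ _)) // [leRHS]splitr lerD //.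
  rewrite mxE (le_trans (cmod_sum _ _)) //.
  apply: (@le_trans _ _ (\sum_j cmod (Y i j) * (e / 2 / s))).
    apply: ler_sum => j _; rewrite ComplexField.Normc.normcM mxE cmod_real.
    rewrite ler_wpM2l ?cmod_ge0 // (le_trans (mx_entry_le _ _ _)) // distrC.
    exact: ltW.
  rewrite -mulr_suml mulrCA ler_piMr ?(ltW e2) //.
  by rewrite ler_pdivrMr // mul1r lerDl.
rewrite mxE (le_trans (cmod_sum _ _)) //.
apply: (@le_trans _ _ (\sum_(j < d.+1) e / 2 / (d.+1%:R * (D + 1)) * (D + 1))).
  apply: ler_sum => j _; rewrite ComplexField.Normc.normcM [map_mx _ _ _ _]mxE cmod_real.
  apply: ler_pM; rewrite ?cmod_ge0 //.
    by apply/ltW/hN; apply: leq_trans Nk; exact: leq_bigmax.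
  by rewrite (le_trans (mx_entry_le _ _ _)) // (le_trans (yD _)) // lerDl.
rewrite sumr_const card_ord -mulr_natl le_eqVlt; apply/orP; left; apply/eqP.
by field; rewrite !gt_eqF // ltr_wpDl.
Qed.

Lemma prod_word_wpow (R : realType) (d m : nat) (A : 'I_m -> 'M[R]_d.+1) w n :
  prod_word A (wpow n w) = prod_word A w ^+ n.
Proof.
elim: n => [|n IH]; first by rewrite prod_word_nil.
by rewrite wpowS prod_word_cat IH exprS.
Qed.

Lemma horner_mx_prod (F : fieldType) (d : nat) (T : 'M[F]_d.+1) zs :
  horner_mx T (\prod_(z <- zs) ('X - z%:P)) = \prod_(z <- zs) (T - z%:M).
Proof.
rewrite rmorph_prod; apply: eq_bigr => z _.
by rewrite rmorphB /= horner_mx_X horner_mx_C.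
Qed.

Lemma prod_shift_scale (F : fieldType) (d : nat) (T : 'M[F]_d.+1) c zs :
  \prod_(z <- [seq c * z | z <- zs]) (c *: T - z%:M) =
  c ^+ size zs *: \prod_(z <- zs) (T - z%:M).
Proof.
elim: zs => [|z zs IH]; first by rewrite !big_nil scale1r.
rewrite big_cons big_cons IH /= exprS.
have -> : c *: T - (c * z)%:M = c *: (T - z%:M).
  by rewrite scalerBr scale_scalar_mx.
by rewrite -scalerAl -scalerAr scalerA.
Qed.

Lemma mup_count (F : fieldType) (zs : seq F) l :
  mup l (\prod_(z <- zs) ('X - z%:P)) = count_mem l zs.
Proof. by rewrite mu_prod_XsubC. Qed.

Lemma char_poly_conj_roots (R : realType) (d : nat) (M : 'M[R]_d) zs :
  char_poly (complexify M) = \prod_(z <- zs) ('X - z%:P) ->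
  perm_eq zs (map conjc zs).
Proof.
move=> zsE; apply: prod_XsubC_eq.
rewrite big_map -zsE -(map_prod_XsubC conjc) -zsE map_char_poly.
congr char_poly; apply/matrixP => i j; rewrite !mxE.
by symmetry; exact: conjc_real.
Qed.

Lemma simple_real_factor (R : realType) (d : nat) (M : 'M[R]_d.+1) l :
  unique_simple_leading M l -> is_real l ->
  exists zs, (forall z, z \in zs -> cmod z < cmod l) /\
    \prod_(z <- zs) (complexify M - z%:M) * (complexify M - l%:M) = 0.
Proof.
move=> [[el _] l1 hl] rl; have [zs [zsE _ zseig]] := char_poly_split M.
have lzs : l \in zs by rewrite zseig.
rewrite zsE mup_count in l1.
have cl : conjc l = l by case: l rl {el l1 hl lzs} => x y; rewrite /is_real /= => ->; rewrite oppr0.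
have pe := perm_to_rem lzs.
have nl : l \notin rem l zs.
  by have := seq.permP pe (pred1 l); rewrite /= l1 eqxx => -[] /esym/count_memPn.
exists (rem l zs); split.
  move=> z zr; have zl : z <> l by move=> zl; rewrite zl (negPf nl) in zr.
  have ez : eigenvalue (complexify M) z by rewrite -zseig (mem_rem zr).
  by apply: (hl z ez zl); rewrite cl.
have pe2 : perm_eq zs (rcons (rem l zs) l).
  by rewrite (perm_trans pe) // perm_sym perm_rcons.
have := Cayley_Hamilton (complexify M).
by rewrite zsE (perm_big _ pe2) horner_mx_prod big_rcons.
Qed.

(** The roots of a real characteristic polynomial are closed under conjugation with multiplicity, so
    [conjc l] is simple as well and one copy of each can be split off in Cayley-Hamilton. *)
Lemma simple_complex_factor (R : realType) (d : nat) (M : 'M[R]_d.+1) l :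
  unique_simple_leading M l -> ~ is_real l ->
  exists zs, (forall z, z \in zs -> cmod z < cmod l) /\
    \prod_(z <- zs) (complexify M - z%:M) *
      ((complexify M - l%:M) * (complexify M - (conjc l)%:M)) = 0.
Proof.
move=> [[el _] l1 hl] rl; have [zs [zsE _ zseig]] := char_poly_split M.
have lzs : l \in zs by rewrite zseig.
rewrite zsE mup_count in l1.
have cl : conjc l != l.
  apply/eqP => h; apply: rl; case: l h {el l1 hl lzs} => x y [] /eqP.
  by rewrite eq_sym -subr_eq0 opprK -mulr2n mulrn_eq0 /= => /eqP.
have pc := char_poly_conj_roots zsE.
have cl1 : count_mem (conjc l) zs = 1%N.
  rewrite (seq.permP pc) count_map -l1; apply: eq_count => z /=.
  by rewrite (inj_eq (can_inj (@conjcK R))).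
have clzs : conjc l \in zs by rewrite -has_pred1 has_count cl1.
have pe := perm_to_rem lzs.
have clr : conjc l \in rem l zs.
  by have := perm_mem pe (conjc l); rewrite clzs inE (negPf cl) /= => <-.
have pe2 := perm_to_rem clr; set zs' := rem (conjc l) (rem l zs) in pe2.
have pe3 : perm_eq zs [:: l, conjc l & zs'].
  by rewrite (perm_trans pe) // perm_cons.
have nl : l \notin zs'.
  have := seq.permP pe3 (pred1 l); rewrite /= l1 eqxx (negPf cl) => -[].
  by move/esym/count_memPn.
have ncl : conjc l \notin zs'.
  have := seq.permP pe3 (pred1 (conjc l)); rewrite /= cl1 eqxx eq_sym (negPf cl) => -[].
  by move/esym/count_memPn.
exists zs'; split.
  move=> z zr.
  have ez : eigenvalue (complexify M) z.
    by rewrite -zseig (perm_mem pe3) !inE zr !orbT.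
  apply: (hl z ez).
  - by move=> zl; rewrite zl (negPf nl) in zr.
  - by move=> zl; rewrite zl (negPf ncl) in zr.
have pe4 : perm_eq zs (zs' ++ [:: l; conjc l]).
  by rewrite (perm_trans pe3) // perm_sym perm_catC.
have := Cayley_Hamilton (complexify M).
by rewrite zsE (perm_big _ pe4) horner_mx_prod big_cat /= !big_cons big_nil mulr1.
Qed.

(** * Irrational rotations *)

(** Dirichlet's pigeonhole: two of [N + 1] fractional parts share one of [N] intervals of length
    [1 / N], and irrationality keeps their difference nonzero. *)
Lemma irrational_small_multiple (R : realType) (x delta : R) :
  irrational x -> 0 < delta ->
  exists p : nat, exists n : int, 0 < `|p%:R * x - n%:~R| /\ `|p%:R * x - n%:~R| < delta.
Proof.
move=> irx delta0.
have irr (p : nat) (n : int) : (0 < p)%N -> p%:R * x - n%:~R != 0.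
  move=> p0; apply/eqP => /eqP; rewrite subr_eq0 => /eqP e; apply: irx.
  apply/rationalP; exists n, p; rewrite -e mulrC mulKf //.
  by rewrite pnatr_eq0 -lt0n.
pose N := (Num.truncn delta^-1).+1.
have N0 : 0 < N%:R :> R by rewrite ltr0n.
have Nd : N%:R^-1 < delta.
  rewrite -[ltRHS]invrK ltf_pV2 ?posrE ?invr_gt0 //.
  exact: truncnS_gt.
pose f (i : nat) := i%:R * x - (Num.floor (i%:R * x))%:~R.
have f01 i : 0 <= f i /\ f i < 1.
  by have /andP[h1 h2] := floor_itv (i%:R * x); rewrite /f subr_ge0 h1 ltrBlDl -intrD1.
pose g (i : 'I_N.+1) : 'I_N := inord (Num.truncn (N%:R * f i)).
have gP (i : 'I_N.+1) : (g i)%:R <= N%:R * f i /\ N%:R * f i < (g i)%:R + 1.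
  have [h0 h1] := f01 i; have h : 0 <= N%:R * f i by rewrite mulr_ge0.
  have /andP[t1 t2] := truncn_itv h; rewrite /g inordK.
    by rewrite natr1.
  rewrite ltnS -ltnS; rewrite -(ltr_nat R); apply: le_lt_trans t1 _.
  by rewrite -[ltRHS]mulr1 ltr_pM2l.
have /injectivePn[i [j ij gij]] : ~~ injectiveb g.
  apply/negP => /injectiveP /leq_card; rewrite !card_ord.
  by rewrite ltnn.
wlog lt_ij : i j ij gij / (i < j)%N.
  move=> H; case: (ltngtP i j) => h; first exact: H h.
    by apply: H h => //; rewrite eq_sym.
  by move: ij; rewrite -val_eqE /= h eqxx.
exists (j - i)%N, (Num.floor (j%:R * x) - Num.floor (i%:R * x)); split.
  by rewrite normr_gt0 irr // subn_gt0.
have -> : (j - i)%:R * x - (Num.floor (j%:R * x) - Num.floor (i%:R * x))%:~R = f j - f i.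
  by rewrite natrB ?(ltnW lt_ij) // intrB /f; ring.
apply: lt_trans Nd; rewrite -[ltRHS]mul1r ltr_pdivlMr //.
rewrite -[N%:R]gtr0_norm // -normrM mulrC mulrBr.
have [a1 a2] := gP i; have [b1 b2] := gP j; rewrite -gij in b1 b2.
by rewrite ltr_norml; lra.
Qed.

Lemma irrational_multiples_dense (R : realType) (x theta delta : R) :
  irrational x -> 0 < delta ->
  exists k : nat, exists n : int, `|k%:R * x - theta - n%:~R| < delta.
Proof.
move=> irx delta0; have [p [n [pn0 pnd]]] := irrational_small_multiple irx delta0.
set u := p%:R * x - n%:~R in pn0 pnd; have u0 : u != 0 by rewrite -normr_gt0.
(* The step [u] may be negative, while the number of steps must be a natural number; shifting
   [theta] by an integer gives it the sign of [u]. *)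
have [M' hM'] : exists M' : int, 0 <= (theta + M'%:~R) / u.
  have [t1 t2] : - (Num.truncn `|theta|).+1%:R < theta /\ theta < (Num.truncn `|theta|).+1%:R.
    by have := truncnS_gt `|theta|; rewrite ltr_norml => /andP[].
  have [u1|u1] := ltP 0 u.
    exists (Num.truncn `|theta|).+1; apply: divr_ge0; last exact: ltW.
    by rewrite -pmulrn; lra.
  exists (- (Num.truncn `|theta|).+1%:Z).
  rewrite mulrNz -pmulrn; apply: mulr_le0; last by rewrite invr_le0.
  by lra.
pose q := Num.truncn ((theta + M'%:~R) / u).
exists (q * p)%N, (M' + q%:Z * n).
have -> : (q * p)%:R * x - theta - (M' + q%:Z * n)%:~R =
    q%:R * u - (theta + M'%:~R).
  by rewrite natrM intrD intrM /u; ring.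
apply: le_lt_trans pnd.
have /andP[h1 h2] := truncn_itv hM'; rewrite -/q -natr1 in h1 h2.
have -> : q%:R * u - (theta + M'%:~R) = (q%:R - (theta + M'%:~R) / u) * u.
  by rewrite mulrBl divfK.
rewrite normrM ler_piMl // ler_norml; lra.
Qed.

Lemma trig_shift (R : realType) (n : int) : exists2 sigma : R, sigma = 1 \/ sigma = -1 &
  forall x, cos (x + n%:~R * pi) = sigma * cos x /\ sin (x + n%:~R * pi) = sigma * sin x.
Proof.
have nat_case (k : nat) : exists2 sigma : R, sigma = 1 \/ sigma = -1 &
    forall x, cos (x + k%:R * pi) = sigma * cos x /\ sin (x + k%:R * pi) = sigma * sin x.
  elim: k => [|k [s hs IH]].
    by exists 1; [left | move=> x; rewrite mul0r addr0 !mul1r].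
  exists (- s); first by case: hs => ->; [right | left; rewrite opprK].
  move=> x; have [h1 h2] := IH x.
  have -> : x + k.+1%:R * pi = x + k%:R * pi + pi by rewrite -natr1; ring.
  by rewrite cosDpi sinDpi h1 h2 !mulNr.
case: n => k; first exact: nat_case.
have [s hs h] := nat_case k.+1; exists s => // x.
rewrite NegzE mulrNz mulNr; have [h1 h2] := h (x - k.+1%:R * pi).
rewrite !subrK in h1 h2; have ss : s * s = 1 by case: hs => ->; rewrite ?mulrNN mulr1.
by rewrite h1 h2 !mulrA ss !mul1r.
Qed.

Lemma unit_circle_param (R : realType) (x y : R) : x ^+ 2 + y ^+ 2 = 1 ->
  exists t, x = cos t /\ y = sin t.
Proof.
move=> xy; have x1 : -1 <= x <= 1.
  have : x ^+ 2 <= 1 by rewrite -xy lerDl sqr_ge0.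
  by rewrite expr2 => x2; apply/andP; split; nra.
have hc : cos (acos x) = x by rewrite acosK // in_itv.
have hs : sin (acos x) = `|y|.
  by rewrite sin_acos // -xy addrAC subrr add0r sqrtr_sqr.
have [y0|y0] := leP 0 y; first by exists (acos x); rewrite hc hs ger0_norm.
by exists (- acos x); rewrite cosN sinN hc hs ltr0_norm ?opprK.
Qed.

Lemma polar (R : realType) (x y : R) : exists r t : R,
  [/\ 0 <= r, r ^+ 2 = x ^+ 2 + y ^+ 2, x = r * cos t & y = r * sin t].
Proof.
pose r := Num.sqrt (x ^+ 2 + y ^+ 2).
have q0 : 0 <= x ^+ 2 + y ^+ 2 by rewrite addr_ge0 ?sqr_ge0.
have r2 : r ^+ 2 = x ^+ 2 + y ^+ 2 by rewrite sqr_sqrtr.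
have r0 : 0 <= r by exact: sqrtr_ge0.
have [r00|r00] := eqVneq r 0.
  exists 0, 0; rewrite lexx !mul0r expr0n /=; move: r2; rewrite r00 expr0n /= => /esym e.
  have /eqP := e; rewrite paddr_eq0 ?sqr_ge0 // !sqrf_eq0 => /andP[/eqP-> /eqP->].
  by rewrite expr0n addr0.
have [|t [tx ty]] := @unit_circle_param _ (x / r) (y / r).
  by rewrite !expr_div_n -mulrDl -r2 divff // sqrf_eq0.
by exists r, t; rewrite -tx -ty; split => //; rewrite mulrC divfK.
Qed.

(** * Ellipses *)

Definition sqnorm (R : realType) (p : R * R) : R := p.1 ^+ 2 + p.2 ^+ 2.

Lemma continuous_sqnorm (R : realType) : continuous (@sqnorm R).
Proof.
move=> p; apply: cvgD; rewrite ?expr2.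
  by apply: cvgM; exact: cvg_fst.
by apply: cvgM; exact: cvg_snd.
Qed.

(** With [D] the singleton of 1 this is the circle, with [D] everything the closed disc: the
    parameter sets of an ellipse and of its hull. *)
Lemma compact_sqnorm (R : realType) (D : set R) : closed D ->
  compact [set p : R * R | sqnorm p <= 1 /\ D (sqnorm p)].
Proof.
move=> cD; have kK := compact_setX (@segment_compact R (-1) 1) (@segment_compact R (-1) 1).
apply: (subclosed_compact _ kK); last first.
  move=> [x y] [/= h _]; rewrite /sqnorm /= in h.
  have x2 := sqr_ge0 x; have y2 := sqr_ge0 y; rewrite !expr2 in h x2 y2.
  by split; rewrite /= in_itv /=; apply/andP; split; nra.
rewrite (_ : [set p | _] = (@sqnorm R) @^-1` ([set x | x <= 1] `&` D)) //.
apply: closed_comp; last by apply: closedI => //; exact: closed_le.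
by move=> p _; exact: continuous_sqnorm.
Qed.

Section Ellipse.
Variables (R : realType) (d : nat) (a b : 'cV[R]_d).

Definition ellipse_pt (t : R) : 'cV[R]_d := cos t *: a + sin t *: b.

Let comb (p : R * R) : 'cV[R]_d := p.1 *: a + p.2 *: b.

Let continuous_comb : continuous comb.
Proof.
move=> p; apply: cvgD; apply: cvgZl; [exact: cvg_fst | exact: cvg_snd].
Qed.

Lemma compact_ellipse : compact (ellipse a b).
Proof.
have -> : ellipse a b = comb @` [set p | sqnorm p <= 1 /\ [set x | x = 1] (sqnorm p)].
  apply/seteqP; split => [_ [t _ <-]|_ [[x y] [_ /= h] <-]].
    by exists (cos t, sin t) => //; rewrite /sqnorm /= cos2Dsin2.
  by have [t [xt yt]] := unit_circle_param h; exists t; rewrite // /comb /= -xt -yt.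
apply: continuous_compact; first exact/continuous_subspaceT.
apply: compact_sqnorm; exact: closed_eq.
Qed.

Lemma ellipse_opp x : ellipse a b x -> ellipse a b (- x).
Proof.
move=> [t _ <-]; exists (t + pi) => //.
by rewrite cosDpi sinDpi !scaleNr opprD.
Qed.

Lemma hull_ellipse : hull (ellipse a b) =
  comb @` [set p | sqnorm p <= 1 /\ [set: R] (sqnorm p)].
Proof.
apply/seteqP; split.
  apply: hull_sub => [|_ [t _ <-]]; last first.
    by exists (cos t, sin t) => //; rewrite /sqnorm /= cos2Dsin2.
  apply/convexP => _ _ t [[x y] [/= h _] <-] [[x' y'] [/= h' _] <-] t0 t1.
  exists (t * x + (1 - t) * x', t * y + (1 - t) * y').
    split => //; move: h h'; rewrite /sqnorm /= => h h'.
    (* Convexity of the squared norm, with its exact defect. *)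
    have -> : (t * x + (1 - t) * x') ^+ 2 + (t * y + (1 - t) * y') ^+ 2 =
      t * (x ^+ 2 + y ^+ 2) + (1 - t) * (x' ^+ 2 + y' ^+ 2) -
      t * (1 - t) * ((x - x') ^+ 2 + (y - y') ^+ 2) by ring.
    have q : 0 <= t * (1 - t) * ((x - x') ^+ 2 + (y - y') ^+ 2).
      by rewrite mulr_ge0 ?mulr_ge0 ?subr_ge0 // addr_ge0 ?sqr_ge0.
    have u : t * (x ^+ 2 + y ^+ 2) <= t * 1 by rewrite ler_wpM2l.
    have v : (1 - t) * (x' ^+ 2 + y' ^+ 2) <= (1 - t) * 1 by rewrite ler_wpM2l ?subr_ge0.
    lra.
  by rewrite /comb /= !scalerDr !scalerA !scalerDl addrACA.
move=> _ [[x y] [/= h _] <-]; rewrite /sqnorm /= in h.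
have [r [t [r0 r2 -> ->]]] := polar x y.
have r1 : r <= 1 by rewrite -(@ler_pXn2r _ 2) ?nnegrE // r2 expr1n.
rewrite /comb /= -!scalerA -scalerDr.
have et : hull (ellipse a b) (ellipse_pt t) by apply: sub_hull; exists t.
apply: convex_scale => //; first exact: hull_convex.
apply: symmetric_convex0 (et); first exact: hull_convex.
by apply: hull_opp; exact: ellipse_opp.
Qed.

Lemma compact_hull_ellipse : compact (hull (ellipse a b)).
Proof.
rewrite hull_ellipse; apply: continuous_compact; first exact/continuous_subspaceT.
by apply: compact_sqnorm; exact: closedT.
Qed.

Lemma ellipse_pt_continuous t (e : R) : 0 < e ->
  exists2 delta : R, 0 < delta & forall s, `|s - t| < delta ->
    `|ellipse_pt s - ellipse_pt t| < e.
Proof.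
move=> e0; have h : ellipse_pt x @[x --> t] --> ellipse_pt t.
  by apply: cvgD; apply: cvgZl; [exact: continuous_cos | exact: continuous_sin].
have : nbhs (ellipse_pt t) (ball (ellipse_pt t) e) by exact: nbhsx_ballx.
move=> /h /nbhs_ballP [delta /= d0 hd]; exists delta => // s st.
by have := hd s; rewrite -!ball_normE /= distrC => /(_ st); rewrite distrC.
Qed.

Variables (M : 'M[R]_d) (phi : R).
Hypothesis Ma : M *m a = cos phi *: a - sin phi *: b.
Hypothesis Mb : M *m b = sin phi *: a + cos phi *: b.

Lemma mulmx_ellipse_pt t : M *m ellipse_pt t = ellipse_pt (t - phi).
Proof.
rewrite mulmxDr -!scalemxAr Ma Mb /ellipse_pt cosB sinB.
rewrite !scalerDr !scalerN !scalerA addrACA -scalerDl [X in _ + X]addrC -scalerBl.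
by congr (_ *: _ + _ *: _); rewrite mulrC.
Qed.

Lemma ellipse_stable x : ellipse a b x -> ellipse a b (M *m x).
Proof. by move=> [t _ <-]; rewrite mulmx_ellipse_pt; exists (t - phi). Qed.

Lemma ellipse_onto x : ellipse a b x -> exists2 y, ellipse a b y & x = M *m y.
Proof.
move=> [t _ <-]; exists (ellipse_pt (t + phi)); first by exists (t + phi).
by rewrite mulmx_ellipse_pt addrK.
Qed.

(** A zero at parameter [t] gives another at [t - phi]. The two relations between [a] and [b] have
    determinant [± sin phi], so both vectors would vanish. *)
Lemma ellipse_neq0 x : sin phi != 0 -> (a != 0) || (b != 0) -> ellipse a b x -> x != 0.
Proof.
move=> sp ab [t _ <-]; apply/eqP => /= e0.
have e1 : ellipse_pt (t - phi) = 0 by rewrite -mulmx_ellipse_pt /ellipse_pt e0 mulmx0.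
have ea : sin phi *: a = 0.
  have : sin t *: ellipse_pt (t - phi) - sin (t - phi) *: (cos t *: a + sin t *: b) = 0.
    by rewrite e0 e1 !scaler0 subrr.
  rewrite /ellipse_pt !scalerDr !scalerA opprD addrACA -!scalerBl.
  rewrite [sin t * sin _]mulrC subrr scale0r addr0 => <-; congr (_ *: _).
  have := sinB t (t - phi); rewrite subKr => ->; ring.
have eb : sin phi *: b = 0.
  have : cos (t - phi) *: (cos t *: a + sin t *: b) - cos t *: ellipse_pt (t - phi) = 0.
    by rewrite e0 e1 !scaler0 subrr.
  rewrite /ellipse_pt !scalerDr !scalerA opprD addrACA -!scalerBl.
  rewrite [cos t * cos _]mulrC subrr scale0r add0r => <-; congr (_ *: _).
  have := sinB t (t - phi); rewrite subKr => ->; ring.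
move: ab ea eb => /orP[] h /eqP + /eqP; by rewrite !scaler_eq0 (negPf sp) (negPf h).
Qed.

End Ellipse.

(** [M] subtracts [phi] from the parameter. Multiples of [phi / pi] are dense modulo 1, so the
    target parameter is approached modulo [pi], and a shift by a multiple of [pi] costs only a
    sign. *)
Lemma ellipse_dense (R : realType) (d : nat) (a b : 'cV[R]_d.+1) (M : 'M[R]_d.+1)
    (phi : R) (x y : 'cV[R]_d.+1) (eta : R) :
  M *m a = cos phi *: a - sin phi *: b -> M *m b = sin phi *: a + cos phi *: b ->
  irrational (phi / pi) -> ellipse a b x -> ellipse a b y -> 0 < eta ->
  exists k, exists2 sigma : R, sigma = 1 \/ sigma = -1 &
    `|sigma *: (M ^+ k *m x) - y| < eta.
Proof.
move=> Ma Mb irr [t _ <-] [s _ <-] eta0.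
have Mk k : M ^+ k *m ellipse_pt a b t = ellipse_pt a b (t - k%:R * phi).
  elim: k => [|k IH]; first by rewrite mul0r subr0 mul1mx.
  rewrite exprS -mulmxE -mulmxA IH (mulmx_ellipse_pt Ma Mb); congr ellipse_pt.
  by rewrite -natr1; ring.
have [delta delta0 hd] := ellipse_pt_continuous a b s eta0.
have pi0 : 0 < (pi : R) by exact: pi_gt0.
have [k [n hk]] := irrational_multiples_dense ((t - s) / pi) irr (divr_gt0 delta0 pi0).
exists k; have [sigma hs hsig] := trig_shift R n; exists sigma => //.
rewrite Mk; have [e1 e2] := hsig (t - k%:R * phi).
have -> : sigma *: ellipse_pt a b (t - k%:R * phi) =
    ellipse_pt a b (t - k%:R * phi + n%:~R * pi).
  by rewrite /ellipse_pt e1 e2 scalerDr !scalerA.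
apply: hd.
have -> : t - k%:R * phi + n%:~R * pi - s =
    - ((k%:R * (phi / pi) - (t - s) / pi - n%:~R) * pi).
  by move: (pi : R) pi0 => p p0; field; rewrite gt_eqF.
by rewrite normrN normrM (gtr0_norm pi0) -ltr_pdivlMr.
Qed.

(** * Leading sets *)

Lemma Re_sum (R : realType) (I : Type) (r : seq I) (F : I -> R[i]) :
  complex.Re (\sum_(i <- r) F i) = \sum_(i <- r) complex.Re (F i).
Proof. by apply: (big_morph (@complex.Re R)) => // -[x y] [x' y']. Qed.

Lemma Im_sum (R : realType) (I : Type) (r : seq I) (F : I -> R[i]) :
  complex.Im (\sum_(i <- r) F i) = \sum_(i <- r) complex.Im (F i).
Proof. by apply: (big_morph (@complex.Im R)) => // -[x y] [x' y']. Qed.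

Definition re_im_col (R : realType) (n : nat) (a b : 'cV[R]_n) : 'cV[R[i]]_n :=
  \col_i (a i 0 +i* b i 0).

Lemma mulmx_re_im (R : realType) (n : nat) (M : 'M[R]_n) (a b : 'cV[R]_n) :
  complexify M *m re_im_col a b = re_im_col (M *m a) (M *m b).
Proof.
apply/matrixP => i j; rewrite !mxE [LHS]complexE [RHS]complexE Re_sum Im_sum /=.
by congr (_%:C + 'i * _%:C); apply: eq_bigr => k _; rewrite !mxE /=; ring.
Qed.

Lemma scale_re_im (R : realType) (n : nat) (l : R[i]) (a b : 'cV[R]_n) :
  l *: re_im_col a b = re_im_col (complex.Re l *: a - complex.Im l *: b)
    (complex.Im l *: a + complex.Re l *: b).
Proof.
apply/matrixP => i j; rewrite !mxE; case: l => x y /=.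
by apply/eqP; rewrite eq_complex /=; apply/andP; split; apply/eqP; ring.
Qed.

Lemma sub_re_im (R : realType) (n : nat) (a b a' b' : 'cV[R]_n) :
  re_im_col a b - re_im_col a' b' = re_im_col (a - a') (b - b').
Proof. by apply/matrixP => i j; rewrite !mxE. Qed.

Lemma re_im_inj (R : realType) (n : nat) (a b a' b' : 'cV[R]_n) :
  re_im_col a b = re_im_col a' b' -> a = a' /\ b = b'.
Proof.
move=> e; split; apply/matrixP => i j; rewrite (ord1 j);
by have := congr1 (fun v : 'cV[R[i]]_n => v i 0) e; rewrite !mxE => -[].
Qed.

Lemma re_im_surj (R : realType) (n : nat) (v : 'cV[R[i]]_n) :
  exists a b, v = re_im_col a b.
Proof.
exists (\col_i complex.Re (v i 0)), (\col_i complex.Im (v i 0)).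
by apply/matrixP => i j; rewrite !mxE (ord1 j); case: (v i 0).
Qed.

Lemma complexify_re_im (R : realType) (n : nat) (z : 'cV[R]_n) :
  map_mx (real_complex R) z = re_im_col z 0.
Proof. by apply/matrixP => i j; rewrite !mxE (ord1 j). Qed.

Lemma leading_eigenvector (R : realType) (n : nat) (M : 'M[R]_n) l :
  eigenvalue (complexify M) l -> exists a b : 'cV[R]_n,
  [/\ (a != 0) || (b != 0), M *m a = complex.Re l *: a - complex.Im l *: b &
      M *m b = complex.Im l *: a + complex.Re l *: b].
Proof.
(* Passing to the transpose turns the row eigenvector into a column eigenvector. *)
rewrite eigenvalue_root_char -char_poly_tr -eigenvalue_root_char => /eigenvalueP[u uM u0].
have [a [b ab]] := re_im_surj u^T; exists a, b.
have : complexify M *m re_im_col a b = l *: re_im_col a b.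
  by rewrite -ab -[complexify M]trmxK -trmx_mul uM linearZ.
rewrite mulmx_re_im scale_re_im => /re_im_inj[-> ->]; split=> //.
apply: contraNT u0; rewrite negb_or !negbK => /andP[/eqP a0 /eqP b0].
apply/eqP/trmx_inj; rewrite ab a0 b0 trmx0.
by apply/matrixP => i j; rewrite !mxE.
Qed.

Section LeadingSet.
Variables (R : realType) (d : nat) (M : 'M[R]_d.+1) (c : R) (l : R[i]).
Hypothesis c0 : 0 < c.
Hypothesis cl : c * cmod l = 1.
Hypothesis leadl : unique_simple_leading M l.

Let T := complexify M.

Let TN : complexify (c *: M) = c%:C *: T.
Proof. by apply/matrixP => i j; rewrite !mxE rmorphM. Qed.

Let commT z : GRing.comm (T - z%:M) (complexify (c *: M)).
Proof.
rewrite TN /GRing.comm -!mulmxE mulmxBl mulmxBr -scalemxAr -scalemxAl.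
by rewrite mul_scalar_mx mul_mx_scalar.
Qed.

Lemma scaled_limit_kernel zs Y (y : nat -> 'cV[R]_d.+1) (D : R) (z : 'cV[R]_d.+1) :
  (forall z, z \in zs -> cmod z < cmod l) -> \prod_(z <- zs) (T - z%:M) * Y = 0 ->
  GRing.comm Y (complexify (c *: M)) -> (forall k, `|y k| <= D) ->
  (forall (e : R) N, 0 < e ->
     exists2 k, (N <= k)%N & `|(c *: M) ^+ k *m y k - z| < e) ->
  Y *m map_mx (real_complex R) z = 0.
Proof.
move=> zsl TY YT yD hz.
apply: (@limit_kernel _ _ (c *: M) [seq c%:C * x | x <- zs] Y y D) => //.
  move=> _ /mapP[x xz ->]; rewrite ComplexField.Normc.normcM cmod_real gtr0_norm //.
  by rewrite -cl ltr_pM2l // zsl.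
by rewrite TN prod_shift_scale -scalerAl TY scaler0.
Qed.

(* [N] maps [E] onto itself, the limit points of its orbits lie in the cone over [E], and
   its orbits in [E] are dense up to sign. *)
Definition leading_set_spec (N : 'M[R]_d.+1) (E : set 'cV[R]_d.+1) :=
  [/\ [/\ E !=set0, forall x, E x -> x != 0, forall x, E x -> E (- x),
          compact E & compact (hull E)],
      forall x, E x -> E (N *m x),
      forall x, E x -> exists2 y, E y & x = N *m y,
      forall (y : nat -> 'cV[R]_d.+1) (D : R) (z : 'cV[R]_d.+1),
        (forall k, `|y k| <= D) ->
        (forall (e : R) n, 0 < e ->
           exists2 k, (n <= k)%N & `|N ^+ k *m y k - z| < e) ->
        exists s : R, exists2 x, E x & 0 <= s /\ z = s *: x &
      forall x y (eta : R), E x -> E y -> 0 < eta ->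
        exists k, exists2 sigma : R, sigma = 1 \/ sigma = -1 &
          `|sigma *: (N ^+ k *m x) - y| < eta].

Lemma real_leading_set : is_real l ->
  exists2 E, leading_set_spec (c *: M) E & finite_set E.
Proof.
move=> rl; have [zs [zsl TY]] := simple_real_factor leadl rl.
have [[el _] l1 _] := leadl.
have lE : l = (complex.Re l)%:C by rewrite [LHS]complexE rl mulr0 addr0.
have [a a0 Ma] : exists2 a : 'cV[R]_d.+1, a != 0 & M *m a = complex.Re l *: a.
  have [a [b [ab]]] := leading_eigenvector el; rewrite rl !scale0r subr0 add0r => Ma Mb.
  by case/orP: ab => h; [exists a | exists b].
have [sg hsg Na] : exists2 sg : R, sg = 1 \/ sg = -1 & (c *: M) *m a = sg *: a.
  exists (c * complex.Re l); last by rewrite -scalemxAl Ma scalerA.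
  have : `|c * complex.Re l| = 1.
    by rewrite normrM (gtr0_norm c0) -cmod_real -lE.
  case: (lerP 0 (c * complex.Re l)) => h; [rewrite ger0_norm // | rewrite ltr0_norm //].
    by move=> ->; left.
  by move/eqP; rewrite eqr_oppLR => /eqP->; right.
have memE x : [set a; - a] x <-> exists2 s : R, s = 1 \/ s = -1 & x = s *: a.
  split=> [[]->|[s [] -> ->]].
  - by exists 1; [left | rewrite scale1r].
  - by exists (-1); [right | rewrite scaleN1r].
  - by left; rewrite /= scale1r.
  - by right; rewrite /= scaleN1r.
have sgM (s t : R) : s = 1 \/ s = -1 -> t = 1 \/ t = -1 -> s * t = 1 \/ s * t = -1.
  by case=> -> [] ->; rewrite ?mul1r ?mulr1 ?mulrNN ?mulr1; [left|right|right|left].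
have sgK (s : R) : s = 1 \/ s = -1 -> s * s = 1.
  by case=> ->; rewrite ?mulrNN mulr1.
exists [set a; - a]; last by rewrite finite_setU; split; exact: finite_set1.
have convex1 (v : 'cV[R]_d.+1) : Defs.convex [set v].
  by apply/convexP => _ _ t -> -> _ _ /=; rewrite -scalerDl addrC subrK scale1r.
split.
- split.
  + by exists a; left.
  + by move=> x [] -> //; rewrite oppr_eq0.
  + by move=> x [] ->; [right | left; rewrite /= opprK].
  + by apply: compactU; exact: compact_set1.
  + by apply: compact_hull_setU => //; exact: compact_set1.
- move=> _ /memE[s hs ->]; apply/memE; exists (s * sg); first exact: sgM.
  by rewrite -scalemxAr Na scalerA.
- move=> _ /memE[s hs ->]; exists ((s * sg) *: a).
    by apply/memE; exists (s * sg) => //; exact: sgM.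
  by rewrite -scalemxAr Na scalerA -mulrA sgK // mulr1.
- move=> y D z yD hz.
  have := scaled_limit_kernel zsl TY (commT l) yD hz.
  rewrite mulmxBl mul_scalar_mx => /eqP; rewrite subr_eq0 => /eqP Tz.
  have Ta : T *m re_im_col a 0 = l *: re_im_col a 0.
    by rewrite /T mulmx_re_im scale_re_im rl mulmx0 Ma !scale0r !scaler0 subr0 addr0.
  have ca0 : re_im_col a 0 != 0.
    apply: contraNneq a0 => e; apply/eqP/matrixP => i j; rewrite (ord1 j) !mxE.
    by have := congr1 (fun v : 'cV[R[i]]_d.+1 => v i 0) e; rewrite !mxE => -[].
  have [k] := simple_root_kernel l1 Tz Ta ca0.
  (* [z] and [a] are real, so comparing real parts replaces the complex factor [k] by its real part;
     the choice between [a] and [- a] then makes the factor nonnegative. *)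
  rewrite complexify_re_im scale_re_im scaler0 subr0 => /re_im_inj[zE _].
  exists `|complex.Re k|; exists (if 0 <= complex.Re k then a else - a).
    by case: ifP; [left | right].
  split=> //; rewrite zE; case: (lerP 0 (complex.Re k)) => h.
    by rewrite ger0_norm.
  by rewrite ltr0_norm // scaleNr scalerN opprK.
- move=> _ _ eta /memE[s hs ->] /memE[t ht ->] eta0.
  exists 0%N, (s * t); first exact: sgM.
  by rewrite mul1mx scalerA mulrAC sgK // mul1r subrr normr0.
Qed.

Lemma complex_leading_set : complex_irrational_arg l ->
  exists a b, leading_set_spec (c *: M) (ellipse a b).
Proof.
move=> [nrl [phi larg irr]]; have [zs [zsl TY]] := simple_complex_factor leadl nrl.
have [[el _] l1 _] := leadl.
have [a [b [ab Ma Mb]]] := leading_eigenvector el.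
have cRe : c * complex.Re l = cos phi by rewrite larg /= mulrA cl mul1r.
have cIm : c * complex.Im l = sin phi by rewrite larg /= mulrA cl mul1r.
have sphi : sin phi != 0.
  by rewrite -cIm; apply: mulf_neq0; [rewrite gt_eqF | apply/eqP; exact: nrl].
have Na : (c *: M) *m a = cos phi *: a - sin phi *: b.
  by rewrite -scalemxAl Ma scalerBr !scalerA cRe cIm.
have Nb : (c *: M) *m b = sin phi *: a + cos phi *: b.
  by rewrite -scalemxAl Mb scalerDr !scalerA cRe cIm.
exists a, b; split.
- split.
  + by exists (ellipse_pt a b 0), 0.
  + by move=> x; exact: (ellipse_neq0 Na Nb).
  + exact: ellipse_opp.
  + exact: compact_ellipse.
  + exact: compact_hull_ellipse.
- by move=> x; exact: (ellipse_stable Na Nb).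
- by move=> x; exact: (ellipse_onto Na Nb).
- move=> y D z yD hz.
  have YT : GRing.comm ((T - l%:M) * (T - (conjc l)%:M)) (complexify (c *: M)).
    by apply/commr_sym; apply: commrM; apply/commr_sym; exact: commT.
  have := scaled_limit_kernel zsl TY YT yD hz.
  (* Applying the factor for [conjc l] to [z] leaves a vector [u] in the eigenspace of [l], hence a
     complex multiple of the leading eigenvector. *)
  rewrite -mulmxE -mulmxA; set u := _ *m map_mx _ z => /eqP.
  rewrite mulmxBl mul_scalar_mx subr_eq0 => /eqP Tu.
  have Tv : T *m re_im_col a b = l *: re_im_col a b.
    by rewrite /T mulmx_re_im scale_re_im Ma Mb.
  have v0 : re_im_col a b != 0.
    apply: contraTneq ab => e; rewrite negb_or !negbK.
    have /re_im_inj[-> ->] : re_im_col a b = re_im_col 0 0.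
      by rewrite e; apply/matrixP => i j; rewrite !mxE.
    by rewrite eqxx.
  have [k uk] := simple_root_kernel l1 Tu Tv v0.
  have uE : u = re_im_col (M *m z - complex.Re l *: z) (complex.Im l *: z).
    rewrite /u mulmxBl mul_scalar_mx complexify_re_im mulmx_re_im scale_re_im.
    have [-> ->] : complex.Re (conjc l) = complex.Re l /\ complex.Im (conjc l) = - complex.Im l.
      by case: (l).
    by rewrite sub_re_im mulmx0 !scaler0 subr0 addr0 sub0r scaleNr opprK.
  (* For real [z] the imaginary part of [u] is [Im l *: z], so the imaginary part of the relation
     already expresses [z] through [a] and [b]; polar coordinates put it on a multiple of the
     ellipse. *)
  rewrite uE scale_re_im in uk; have [_ zE] := re_im_inj uk.
  have Im0 : complex.Im l != 0 by apply/eqP; exact: nrl.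
  have [r [t [r0 _ xr yr]]] := polar (complex.Im k / complex.Im l) (complex.Re k / complex.Im l).
  exists r, (ellipse_pt a b t); first by exists t.
  split=> //; rewrite /ellipse_pt scalerDr !scalerA -xr -yr.
  rewrite ![_ / complex.Im l]mulrC -!scalerA -scalerDr -zE scalerA mulVf //.
  by rewrite scale1r.
- by move=> x y eta Ex Ey eta0; exact: (ellipse_dense Na Nb irr Ex Ey eta0).
Qed.

End LeadingSet.

(** * Growth rate of an irreducible family *)

(** The least such [t] will be identified with [jsr A]. That it is attained is what makes the
    normalised semigroup bounded. *)
Definition growth_bounded (R : realType) (d m : nat) (A : 'I_m -> 'M[R]_d) (t : R) :=
  exists C : R, forall s, `|prod_word A s| <= C * t ^+ size s.

Lemma growth_bounded_le (R : realType) (d m : nat) (A : 'I_m -> 'M[R]_d) (t u : R) :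
  0 <= t -> t <= u -> growth_bounded A t -> growth_bounded A u.
Proof.
move=> t0 tu [C hC]; exists C => s; apply: le_trans (hC s) _.
have C0 : 0 <= C by have := le_trans (normr_ge0 _) (hC [::]); rewrite expr0 mulr1.
by rewrite ler_wpM2l // lerXn2r // ?nnegrE // (le_trans t0).
Qed.

(** The value [3 / 2] matters only for being below 2, the gain obtained in [growth_step] within [N]
    letters. *)
Lemma one_plus_pow (R : realType) N : exists2 h : R, 0 < h & (1 + h) ^+ N <= 3 / 2.
Proof.
have N0 : 0 < N.+1%:R :> R by rewrite ltr0n.
exists (4 * N.+1%:R)^-1; first by rewrite invr_gt0 mulr_gt0.
set h := _^-1; have h0 : 0 < h by rewrite invr_gt0 mulr_gt0.
have Nh : N%:R * h <= 4^-1.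
  rewrite /h invfM mulrCA ler_piMr ?invr_ge0 //.
  by rewrite ler_pdivrMr // mul1r ler_nat.
suff H k : (k <= N)%N -> (1 + h) ^+ k <= 1 + 2 * k%:R * h by have := H N (leqnn _); lra.
elim: k => [|k IH] kN; first by rewrite expr0; lra.
have := IH (ltnW kN); rewrite exprS => IHk.
have kh : k%:R * h <= 4^-1 by apply: le_trans Nh; rewrite ler_pM2r // ler_nat ltnW.
have : (1 + h) * (1 + h) ^+ k <= (1 + h) * (1 + 2 * k%:R * h).
  by rewrite ler_pM2l // addr_gt0.
have k0 : 0 <= k%:R :> R by [].
rewrite -[k.+1%:R]natr1; move: (k%:R : R) kh k0 => x xh x0 h1; apply: le_trans h1 _.
have h2 : x * h * h <= 4^-1 * h by rewrite ler_pM2r.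
have -> : (1 + h) * (1 + 2 * x * h) = 1 + 2 * x * h + h + 2 * (x * h * h) by ring.
have -> : 1 + 2 * (x + 1) * h = 1 + 2 * x * h + 2 * h by ring.
have := h0; lra.
Qed.

Lemma not_power_bounded (R : realType) (a b K : R) : 0 <= a -> a < b ->
  ~ (forall n, b ^+ n <= K * a ^+ n).
Proof.
move=> a0 ab h; have b0 : 0 < b := le_lt_trans a0 ab.
have [N hN] := @small_power _ (a / b) K 1 (divr_ge0 a0 (ltW b0))
  ltac:(by rewrite ltr_pdivrMr // mul1r) ltr01.
have := hN N (leqnn _); rewrite expr_div_n mulrAC ltr_pdivrMr ?exprn_gt0 // mul1r.
by rewrite mulrC ltNge h.
Qed.

Lemma nonzero_scale_unit (R : realType) (d : nat) (x : 'cV[R]_d) : x != 0 ->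
  exists2 u : 'cV[R]_d, `|u| = 1 & x = `|x| *: u.
Proof.
move=> x0; exists (`|x|^-1 *: x).
  by rewrite normrZ normfV normr_id mulVf // normr_eq0.
by rewrite scalerA divff ?scale1r // normr_eq0.
Qed.

Lemma sphere_cluster (R : realType) (d : nat) (x : nat -> 'cV[R]_d) :
  (forall k, `|x k| = 1) -> exists2 y : 'cV[R]_d, y != 0 &
  forall (e : R) N, 0 < e -> exists2 k, (N <= k)%N & `|x k - y| < e.
Proof.
move=> x1; have [|y hy] := @bounded_cluster_point _ _ _ x 1 .
  by move=> k; rewrite x1.
exists y => //; apply/eqP => y0; have [k _] := hy 1 0%N ltr01.
by rewrite y0 subr0 x1 ltxx.
Qed.

Section Rate.
Variables (R : realType) (d m : nat) (A : 'I_m -> 'M[R]_d.+1).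
Hypothesis irrA : irreducible_family A.
Let D : R := d.+1%:R.
Let D0 : 0 < D. Proof. by rewrite ltr0n. Qed.

(* A vector with a bounded normalised orbit spans a common invariant subspace; if
   there is none, then by compactness of the sphere some product of bounded length
   doubles any given vector. *)
Lemma growth_step (t : R) : 0 < t -> ~ growth_bounded A t ->
  exists2 u, t < u & ~ growth_bounded A u.
Proof.
move=> t0 nbt.
pose P (x : 'cV[R]_d.+1) := exists C : R, forall s, `|prod_word A s *m x| <= C * t ^+ size s.
have P0 : P 0 by exists 0 => s; rewrite mulmx0 normr0 mul0r.
have PD u v : P u -> P v -> P (u + v).
  move=> [C hC] [C' hC']; exists (C + C') => s; rewrite mulmxDr mulrDl.
  by rewrite (le_trans (ler_normD _ _)) // lerD.
have PZ (c : R) v : P v -> P (c *: v).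
  move=> [C hC]; exists (`|c| * C) => s; rewrite -scalemxAr normrZ -mulrA.
  by rewrite ler_wpM2l.
have PA i v : P v -> P (A i *m v).
  move=> [C hC]; exists (C * t) => s; have := hC (rcons s i).
  rewrite -cats1 prod_word_cat prod_word_cons prod_word_nil mulmx1 mulmxA.
  by rewrite size_cat addn1 exprS mulrA.
have [Pz|Pall] := irreducible_prop irrA P0 PD PZ PA; last first.
  exfalso; apply: nbt.
  have /choice[C hC] j : exists C : R, forall s,
      `|prod_word A s *m (delta_mx j 0 : 'cV[R]_d.+1)| <= C * t ^+ size s.
    exact: Pall.
  exists (\sum_j `|C j|) => s.
  have t0s : 0 <= t ^+ size s by rewrite exprn_ge0 // ltW.
  apply: mx_norm_leP => [|i j]; first by rewrite mulr_ge0 // sumr_ge0.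
  have -> : prod_word A s i j = (prod_word A s *m (delta_mx j 0 : 'cV[R]_d.+1)) i 0.
    by rewrite -colE mxE.
  rewrite (le_trans (mx_entry_le _ _ _)) // (le_trans (hC _ _)) // ler_wpM2r //.
  by rewrite (bigD1 j) //= (le_trans (ler_norm _)) // lerDl sumr_ge0.
have [N hN] : exists N, forall x : 'cV[R]_d.+1, `|x| = 1 ->
    exists2 s, (size s <= N)%N & 2 * t ^+ size s < `|prod_word A s *m x|.
  apply: contrapT => /forallNP noN.
  have /choice[x hx] N : exists x : 'cV[R]_d.+1, `|x| = 1 /\
      forall s, (size s <= N)%N -> `|prod_word A s *m x| <= 2 * t ^+ size s.
    have /existsNP[x /not_implyP[x1 hx]] := noN N; exists x; split => // s sN.
    by rewrite leNgt; apply/negP => h; apply: hx; exists s.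
  have [y y0 hy] := sphere_cluster (fun k => (hx k).1).
  (* The limit direction [y] has an unbounded normalised orbit. A factor 3 at [y] leaves a factor 2
     at the nearby [x k], against the choice of [x k]. *)
  have [s hs] : exists s, 3 * t ^+ size s < `|prod_word A s *m y|.
    apply: contrapT => h; move/eqP: y0; apply; apply: Pz; exists 3 => s.
    by rewrite leNgt; apply/negP => h'; apply: h; exists s.
  have ts : 0 < t ^+ size s by rewrite exprn_gt0.
  pose L := D * `|prod_word A s| + 1.
  have L0 : 0 < L by rewrite ltr_wpDl // mulr_ge0 // ltW.
  have [k sk hk] := hy (t ^+ size s / L) (size s) (divr_gt0 ts L0).
  have h1 := (hx k).2 s sk.
  have h2 : `|prod_word A s *m (y - x k)| <= t ^+ size s.
    rewrite (le_trans (mx_norm_mulmx _ _)) // distrC.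
    rewrite ltr_pdivlMr // mulrC in hk; apply: le_trans (ltW hk).
    by rewrite ler_wpM2r // lerDl.
  have := ler_normD (prod_word A s *m (y - x k)) (prod_word A s *m x k).
  by rewrite -mulmxDr subrK; lra.
have grow k (x : 'cV[R]_d.+1) : x != 0 -> exists2 s, (size s <= k * N)%N &
    2 ^+ k * t ^+ size s * `|x| <= `|prod_word A s *m x|.
  elim: k => [|k IH] x0.
    by exists [::]; rewrite // prod_word_nil mul1mx !expr0 !mul1r.
  have [s sk hs] := IH x0.
  have Sx0 : prod_word A s *m x != 0.
    rewrite -normr_gt0; apply: lt_le_trans hs.
    by rewrite !mulr_gt0 ?exprn_gt0 ?normr_gt0.
  have [u u1 uE] := nonzero_scale_unit Sx0; have [s' s'N hs'] := hN u u1.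
  exists (s' ++ s); first by rewrite size_cat mulSn leq_add.
  rewrite prod_word_cat -mulmxA uE -scalemxAr normrZ normr_id size_cat exprS exprD.
  apply: (@le_trans _ _ (2 * t ^+ size s' * `|prod_word A s *m x|)).
    have -> : 2 * 2 ^+ k * (t ^+ size s' * t ^+ size s) * `|x| =
      2 * t ^+ size s' * (2 ^+ k * t ^+ size s * `|x|) by ring.
    by rewrite ler_wpM2l // mulr_ge0 // exprn_ge0 // ltW.
  by rewrite mulrC ler_wpM2l // ltW.
have [h h0 hpow] := one_plus_pow R N.
have h1 : 1 <= 1 + h by rewrite lerDl ltW.
exists (t * (1 + h)); first by rewrite ltr_pMr // ltrDl.
move=> [C hC].
pose x : 'cV[R]_d.+1 := delta_mx 0 0.
have x0 : x != 0.
  apply/eqP => e; have := congr1 (fun v : 'cV[R]_d.+1 => v 0 0) e.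
  by rewrite !mxE /= => /eqP; rewrite oner_eq0.
have nx : 0 < `|x| by rewrite normr_gt0.
have C0 : 0 <= C by have := le_trans (normr_ge0 _) (hC [::]); rewrite expr0 mulr1.
(* After at most [k * N] letters the normalised vector has grown by [2 ^+ k], while growth at rate
   [t * (1 + h)] would allow only [D * C * (3 / 2) ^+ k]. *)
apply: (@not_power_bounded _ (3 / 2) 2 (D * C)); [lra | lra | move=> k].
have [s sk hs] := grow k x x0.
have ts : 0 < t ^+ size s by rewrite exprn_gt0.
rewrite -(ler_pM2r (mulr_gt0 ts nx)) mulrA (le_trans hs) //.
rewrite (le_trans (mx_norm_mulmx _ _)) // mulrA ler_wpM2r //.
rewrite -!mulrA ler_wpM2l ?(ltW D0) // (le_trans (hC s)) // ler_wpM2l //.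
rewrite exprMn mulrC ler_wpM2r ?(ltW ts) //.
apply: (@le_trans _ _ ((1 + h) ^+ (k * N))); first by rewrite ler_weXn2l.
rewrite mulnC exprM lerXn2r // ?nnegrE ?exprn_ge0 //; last lra.
Qed.

(** The common kernel is an invariant subspace, hence trivial. By compactness of the sphere some
    [A i] shrinks a given unit vector by no more than a fixed factor [kappa], and such letters can
    be chained. *)
Lemma growth_rate_gt0 : (exists i, A i != 0) ->
  exists2 kappa : R, 0 < kappa & forall t, 0 <= t -> growth_bounded A t -> kappa <= t.
Proof.
move=> [i0 Ai0].
pose P (x : 'cV[R]_d.+1) := forall i, A i *m x = 0.
have [||||Pz|Pall] := @irreducible_prop _ _ _ A P irrA.
- by move=> i; rewrite mulmx0.
- by move=> u v Pu Pv i; rewrite mulmxDr Pu Pv addr0.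
- by move=> c v Pv i; rewrite -scalemxAr Pv scaler0.
- by move=> j v Pv i; rewrite Pv mulmx0.
- have [kappa k0 hk] : exists2 kappa : R, 0 < kappa & forall x : 'cV[R]_d.+1, `|x| = 1 ->
      exists i, kappa <= `|A i *m x|.
    apply: contrapT => nok.
    have /choice[x hx] (N : nat) : exists x : 'cV[R]_d.+1, `|x| = 1 /\
        forall i, `|A i *m x| < N.+1%:R^-1.
      apply: contrapT => /forallNP h; apply: nok; exists N.+1%:R^-1; first by rewrite invr_gt0.
      move=> x x1; apply: contrapT => /forallNP hi; apply: (h x); split => // i.
      by rewrite ltNge; apply/negP; exact: hi.
    have [y y0 hy] := sphere_cluster (fun k => (hx k).1).
    move/eqP: y0; apply; apply: Pz => i.
    apply/eqP; rewrite -normr_le0; apply/ler_addgt0Pr => e e0; rewrite add0r.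
    have L0 : 0 < 2 * (D * `|A i| + 1) by rewrite mulr_gt0 // ltr_wpDl // mulr_ge0 // ltW.
    have [k kN hk] := hy (e / (2 * (D * `|A i| + 1))) (Num.truncn (2 / e)) (divr_gt0 e0 L0).
    have h1 : `|A i *m x k| <= e / 2.
      rewrite (le_trans (ltW ((hx k).2 i))) // -[leRHS]invrK lef_pV2 ?posrE ?invr_gt0 ?divr_gt0 //.
      rewrite invf_div (le_trans (ltW (truncnS_gt _))) // ler_nat.
      by rewrite ltnS.
    have h2 : `|A i *m (y - x k)| <= e / 2.
      rewrite (le_trans (mx_norm_mulmx _ _)) // distrC.
      rewrite ltr_pdivlMr // in hk.
      have := normr_ge0 (x k - y); move: hk; rewrite -/D; move: (Num.norm (x k - y)) (D * _) => q p hk q0.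
      lra.
    have := ler_normD (A i *m (y - x k)) (A i *m x k).
    by rewrite -mulmxDr subrK [e]splitr; lra.
  exists kappa => // t t0 [C hC]; rewrite leNgt; apply/negP => tk.
  pose x : 'cV[R]_d.+1 := delta_mx 0 0.
  have x0 : x != 0.
    apply/eqP => e; have := congr1 (fun v : 'cV[R]_d.+1 => v 0 0) e.
    by rewrite !mxE /= => /eqP; rewrite oner_eq0.
  have nx : 0 < `|x| by rewrite normr_gt0.
  apply: (@not_power_bounded _ t kappa (D * C)) => // n.
  have [s sn hs] : exists2 s, size s = n & kappa ^+ n * `|x| <= `|prod_word A s *m x|.
    elim: n => [|n [s sn hs]].
      by exists [::]; rewrite // prod_word_nil mul1mx expr0 mul1r.
    have Sx0 : prod_word A s *m x != 0.
      by rewrite -normr_gt0; apply: lt_le_trans hs; rewrite mulr_gt0 // exprn_gt0.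
    have [u u1 uE] := nonzero_scale_unit Sx0; have [i hi] := hk u u1.
    exists (i :: s); first by rewrite /= sn.
    rewrite prod_word_cons -mulmxA uE -scalemxAr normrZ normr_id exprS -mulrA mulrC.
    by rewrite ler_pM // ?mulr_ge0 ?exprn_ge0 // ltW.
  rewrite -(ler_pM2r nx) (le_trans hs) // (le_trans (mx_norm_mulmx _ _)) //.
  by rewrite ler_wpM2r // -mulrA ler_wpM2l ?(ltW D0) // -sn.
move/eqP: Ai0; case; apply/matrixP => i j.
have := congr1 (fun v : 'cV[R]_d.+1 => v i 0) (Pall (delta_mx j 0) i0).
by rewrite -colE !mxE.
Qed.

(** The infimum is attained: by [growth_step], failure at the infimum would persist at a larger
    rate, above some admissible one. *)
Lemma growth_rate : (exists i, A i != 0) -> exists2 r : R, 0 < r &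
  growth_bounded A r /\ forall t, 0 <= t -> t < r -> ~ growth_bounded A t.
Proof.
move=> A0; have [kappa k0 hk] := growth_rate_gt0 A0.
pose Q := [set t : R | 0 <= t /\ growth_bounded A t].
have Qinf : has_inf Q.
  split; last by exists kappa => t [t0 /hk]; exact.
  pose t := D * (\sum_i `|A i|) + 1.
  have t1 : 1 <= t by rewrite lerDr mulr_ge0 ?(ltW D0) // sumr_ge0.
  exists t; split; first exact: le_trans t1.
  exists 1 => s; rewrite mul1r; elim: s => [|i s IH].
    by rewrite prod_word_nil mx_norm1_le.
  rewrite prod_word_cons (le_trans (mx_norm_mulmx _ _)) // exprS ler_pM //.
  apply: (@le_trans _ _ (D * \sum_i `|A i|)); last by rewrite lerDl.
  by rewrite ler_wpM2l ?(ltW D0) // (bigD1 i) //= lerDl sumr_ge0.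
have r0 : 0 < inf Q.
  by apply: lt_le_trans k0 _; apply: lb_le_inf; [case: Qinf | move=> t [t0 /hk]; exact].
exists (inf Q) => //; split; last first.
  move=> t t0 tr bt; suff : inf Q <= t by rewrite leNgt tr.
  by apply: ge_inf; [case: Qinf | split].
apply: contrapT => /(growth_step r0)[u ru nbu]; apply: nbu.
have ur0 : 0 < u - inf Q by rewrite subr_gt0.
have [t [t0 bt] tu] := inf_adherent ur0 Qinf.
by rewrite addrC subrK in tu; apply: growth_bounded_le bt => //; exact: ltW.
Qed.

End Rate.

Lemma prod_word_scale (R : realType) (d m : nat) (A : 'I_m -> 'M[R]_d) (c : R) s :
  prod_word (fun i => c *: A i) s = c ^+ size s *: prod_word A s.
Proof.
elim: s => [|i s IH]; first by rewrite !prod_word_nil scale1r.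
by rewrite !prod_word_cons IH -scalemxAl -scalemxAr scalerA -exprS.
Qed.

(** * Products of a family normalised to growth rate 1 *)

Section NormalizedGrowth.
Variables (R : realType) (d m : nat) (B : 'I_m -> 'M[R]_d.+1) (C : R).
Hypothesis BC : forall s, `|prod_word B s| <= C.
Hypothesis Bmin : forall t : R, 0 <= t -> t < 1 -> ~ growth_bounded B t.
Let D : R := d.+1%:R.
Let D0 : 0 < D. Proof. by rewrite ltr0n. Qed.

(** [D] times the norm is submultiplicative. If it were below 1 on all words of length [n], cutting
    words into blocks of length [n] would give a growth rate below 1. *)
Lemma normalized_lower_bound n :
  exists2 s, size s = n & 1 <= D * `|prod_word B s|.
Proof.
apply: contrapT => noS.
have hS s : size s = n -> D * `|prod_word B s| < 1.
  by move=> sn; rewrite ltNge; apply/negP => h; apply: noS; exists s.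
have n0 : (0 < n)%N.
  rewrite lt0n; apply/eqP => nz; have := hS [::] (esym nz).
  rewrite prod_word_nil => h; have := mx_entry_le (1%:M : 'M[R]_d.+1) 0 0.
  rewrite mxE eqxx normr1 => h1; have : D * 1 < 1.
    by apply: le_lt_trans h; rewrite ler_wpM2l // ltW.
  by rewrite mulr1 ltNge ler1n.
have [mu [mu0 mu1 hmu]] : exists mu : R, [/\ 0 < mu, mu < 1 &
    forall s, size s = n -> D * `|prod_word B s| <= mu].
  (* The default [2^-1] keeps the maximum positive, even if all these products vanish. *)
  exists (\big[Num.max/2^-1]_(t : n.-tuple 'I_m) (D * `|prod_word B t|)); split.
  - by apply: lt_le_trans (bigmax_ge_id _ _ _ _); rewrite invr_gt0.
  - apply/bigmax_ltP; split; first by rewrite invf_lt1 // ltr1n.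
    by move=> t _; apply: hS; rewrite size_tuple.
  - by move=> s /eqP sn; apply: (le_bigmax _ _ (Tuple sn)).
pose theta := mu `^ n%:R^-1.
have thn : theta ^+ n = mu.
  rewrite -powR_mulrn ?powR_ge0 // -powRrM mulVf ?pnatr_eq0 -?lt0n //.
  by rewrite powRr1 // ltW.
have th0 : 0 < theta by rewrite powR_gt0.
have th1 : theta < 1.
  rewrite ltNge; apply/negP => h; have := exprn_ege1 n h; rewrite thn.
  by rewrite leNgt mu1.
apply: (Bmin (ltW th0) th1); exists (C / mu) => s.
have C0 : 0 <= C by exact: le_trans (BC [::]).
have [k] := ubnP (size s); elim: k s => // k IH s sk.
(* For an incomplete block, dividing by [mu = theta ^+ n] in the constant compensates for at most
   [n] factors [theta]. *)
have [sn|ns] := leqP (size s) n.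
  rewrite (le_trans (BC s)) // -mulrA ler_peMr // mulrC ler_pdivlMr // mul1r -thn.
  by rewrite ler_wiXn2l // ltW.
have sE : size s = (n + size (drop n s))%N by rewrite size_drop subnKC // ltnW.
rewrite -{1}(cat_take_drop n s) prod_word_cat (le_trans (mx_norm_mulmx _ _)) //.
rewrite sE exprD thn mulrCA ler_pM ?mulr_ge0 //.
  by apply: hmu; rewrite size_takel // ltnW.
apply: IH; apply: leq_trans (sk : (size s <= k)%N).
by rewrite size_drop ltn_subrL n0 (ltn_trans n0 ns).
Qed.

Lemma eigenvalue_power_bounded s z : eigenvalue (complexify (prod_word B s)) z ->
  cmod z <= 1.
Proof.
move=> /eigenvalueP[v vz v0]; set T := complexify _ in vz.
have vT n : v *m T ^+ n = z ^+ n *: v.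
  elim: n => [|n IH]; first by rewrite expr0 mulmx1 expr0 scale1r.
  by rewrite exprSr -mulmxE mulmxA IH -scalemxAl vz scalerA -exprSr.
have [i vi] : exists i, v 0 i != 0.
  apply: contrapT => /forallNP h; move/eqP: v0; apply; apply/matrixP => a i.
  by rewrite (ord1 a) [RHS]mxE; apply/eqP/negPn/negP; exact: h.
have vi0 : 0 < cmod (v 0 i).
  rewrite lt_neqAle cmod_ge0 andbT eq_sym; apply: contraNneq vi => h.
  exact/eqP/ComplexField.Normc.eq0_normc.
rewrite leNgt; apply/negP => z1.
apply: (@not_power_bounded _ 1 (cmod z) ((\sum_j cmod (v 0 j)) * C / cmod (v 0 i))) => // n.
rewrite expr1n mulr1 ler_pdivlMr //.
have := congr1 (fun u : 'rV[R[i]]_d.+1 => cmod (u 0 i)) (vT n).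
rewrite [in RHS]mxE ComplexField.Normc.normcM.
have -> : cmod (z ^+ n) = cmod z ^+ n.
  elim: n => [|n IH]; first by rewrite !expr0; exact: ComplexField.Normc.normc1.
  by rewrite !exprS ComplexField.Normc.normcM IH.
move=> <-; rewrite mxE (le_trans (cmod_sum _ _)) // mulr_suml ler_sum // => j _.
rewrite ComplexField.Normc.normcM ler_wpM2l ?cmod_ge0 //.
rewrite -rmorphXn /= mxE cmod_real (le_trans (mx_entry_le _ _ _)) //.
by rewrite -prod_word_wpow BC.
Qed.

Lemma subcritical_power_decay (M : 'M[R]_d.+1) (e : R) :
  (forall z, eigenvalue (complexify M) z -> cmod z < 1) -> 0 < e ->
  exists N, forall n, (N <= n)%N -> `|M ^+ n| < e.
Proof.
move=> M1 e0; have [zs [zsE _ zseig]] := char_poly_split M.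
have CH : \prod_(z <- zs) (complexify M - z%:M) * 1 = 0.
  by rewrite mulr1 -horner_mx_prod -zsE; exact: Cayley_Hamilton.
have zs1 z : z \in zs -> cmod z < 1 by rewrite zseig; exact: M1.
have e2 : 0 < e / 2 by rewrite divr_gt0.
have /choice[N hN] (p : 'I_d.+1 * 'I_d.+1) : exists N, forall n, (N <= n)%N ->
    `|(M ^+ n) p.1 p.2| < e / 2.
  have [N hN] := prod_shift_decays zs1 CH p.1 p.2 e2.
  by exists N => n /hN; rewrite mulr1 -rmorphXn /= mxE cmod_real.
exists (\max_p N p) => n Nn; apply: (@le_lt_trans _ _ (e / 2)); last first.
  by rewrite ltr_pdivrMr // ltr_pMr // ltr1n.
apply: mx_norm_leP => [|i j]; first exact: ltW.
by apply/ltW/(hN (i, j)); apply: leq_trans Nn; exact: leq_bigmax.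
Qed.

(* Otherwise [periodic_prefixes] would make the powers of the dominant product
   stay away from 0, while its eigenvalues all have modulus < 1. *)
Lemma dominant_eigenvalue_modulus (w : seq 'I_m) (eps : R) : 0 < eps ->
  near_singular_periodic B w eps ->
  exists2 z, eigenvalue (complexify (prod_word B w)) z & 1 <= cmod z.
Proof.
move=> eps0 Bw; apply: contrapT => noz.
have w1 z : eigenvalue (complexify (prod_word B w)) z -> cmod z < 1.
  by move=> ez; rewrite ltNge; apply/negP => h; apply: noz; exists z.
have C0 : 0 <= C by exact: le_trans (BC [::]).
(* Large products need not have large prefixes, so [P] asks for a large extension; boundedness of
   the semigroup then still gives the lower bound [L^-1] on the prefix. *)
pose P s := exists t, 1 <= D * `|prod_word B (s ++ t)|.
pose L := D * (D * C) + 1; have L0 : 0 < L by rewrite ltr_wpDl // !mulr_ge0 // ltW.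
have bound s t : D * `|prod_word B (s ++ t)| <= L * `|prod_word B s|.
  rewrite /L mulrDl mul1r -[leLHS]addr0 lerD // -mulrA ler_wpM2l ?(ltW D0) //.
  rewrite prod_word_cat (le_trans (mx_norm_mulmx _ _)) // -!mulrA.
  by rewrite ler_wpM2l ?(ltW D0) // mulrC ler_wpM2r.
have Pc s t : P (s ++ t) -> P s by move=> [u]; rewrite -catA => h; exists (t ++ u).
have Pn n : exists2 s, size s = n & P s.
  by have [s sn hs] := normalized_lower_bound n; exists s => //; exists [::]; rewrite cats0.
have Pdelta s : P s -> L^-1 <= `|prod_word B s|.
  move=> [t ht]; rewrite -[_^-1]mul1r ler_pdivrMr // mulrC.
  exact: le_trans ht (bound _ _).
have iL0 : 0 < L^-1 by rewrite invr_gt0.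
have [u Pu] := periodic_prefixes BC iL0 eps0 Bw Pc Pn Pdelta.
have L1 : 0 < L ^+ 2 * 1 + L by rewrite mulr1 addr_gt0 // exprn_gt0.
have DC : 0 < D * C + 1 by rewrite ltr_wpDl // mulr_ge0 // ltW.
have [N hN] := subcritical_power_decay w1 (divr_gt0 iL0 DC).
have := hN N (leqnn _); rewrite -prod_word_wpow ltr_pdivlMr // => h.
have := Pdelta _ (Pu N); rewrite leNgt; apply/negP; rewrite negbK.
apply: le_lt_trans h; rewrite prod_word_cat (le_trans (mx_norm_mulmx _ _)) //.
rewrite mulrC ler_wpM2l //; apply: (@le_trans _ _ (D * C)); last by rewrite lerDl.
by rewrite ler_wpM2l // ltW.
Qed.

End NormalizedGrowth.

(** * Joint spectral radius and scaling *)

Lemma invariant_body_of_leading_set (R : realType) (d m : nat) (B : 'I_m -> 'M[R]_d.+1)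
    (C eps : R) (w : seq 'I_m) (E : set 'cV[R]_d.+1) :
  irreducible_family B -> (forall s, `|prod_word B s| <= C) -> w <> [::] -> 0 < eps ->
  (forall s (sigma : R), s <> [::] -> 1 <= `|sigma| ->
     `|\det (sigma%:M - prod_word B s)| < eps -> rot_power w s) ->
  leading_set_spec (prod_word B w) E ->
  exists G : set 'cV[R]_d.+1,
    [/\ convex_body G,
        hull (\bigcup_(i in [set: 'I_m]) [set B i *m x | x in G]) = G,
        forall G', convex_body G' ->
          hull (\bigcup_(i in [set: 'I_m]) [set B i *m x | x in G']) = G' ->
          exists2 c : R, 0 < c & G' = dilate c G,
        finite_set E -> polytope G &
        forall a b, E = ellipse a b -> hull_of_ellipses G].
Proof.
move=> irrB BC w0 eps0 Bw [[[e0 Ee0] Enz Esym Ecomp Ehull] Estab Eonto Elim Edense].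
have Elim' (y : nat -> 'cV[R]_d.+1) (D : R) (z : 'cV[R]_d.+1) : (forall k, `|y k| <= D) ->
    (forall (e : R) N, 0 < e -> exists2 k, (N <= k)%N &
       `|prod_word B (wpow k w) *m y k - z| < e) ->
    exists s : R, exists2 x, E x & 0 <= s /\ z = s *: x.
  move=> yD hz; apply: (Elim y D) => // e N /hz - /(_ N)[k Nk].
  by rewrite prod_word_wpow; exists k.
have Edense' x y (eta : R) : E x -> E y -> 0 < eta ->
    exists k, exists2 sigma : R, sigma = 1 \/ sigma = -1 &
      `|sigma *: (prod_word B (wpow k w) *m x) - y| < eta.
  move=> Ex Ey eta0; have [k [sigma hs hk]] := Edense x y eta Ex Ey eta0.
  by exists k, sigma => //; rewrite prod_word_wpow.
have [K K0 hK] := orbit_hull_stable irrB BC w0 eps0 Bw Ee0 Enz Esym Ecomp Estab Elim' Edense'.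
have body : convex_body (orbit_hull B E K).
  exact: (orbit_hull_body irrB Ee0 Enz Esym Ehull).
exists (orbit_hull B E K); split => //.
- exact: (orbit_hull_invariant w0 Eonto).
- move=> G' bG' iG'.
  exact: (invariant_body_unique irrB BC eps0 Bw Ee0 Enz Esym Ehull Elim' Edense').
- move=> fE; split => //.
  exists ((fun p => prod_word B p.1 *m p.2) @` ([set` short_words m K] `*` E)).
    by apply: finite_image; apply: finite_setX => //; exact: finite_seq.
  congr hull; apply/seteqP; split=> [_ [s sK [y Ey ->]]|_ [[s y] [/= sK Ey] <-]].
    by exists (s, y) => //; split => //=; rewrite short_wordsP.
  by exists s; [rewrite -short_wordsP | exists y].
- move=> a b EE; pose sw := short_words m K.
  exists (size sw), (fun i => prod_word B (nth [::] sw i) *m a),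
    (fun i => prod_word B (nth [::] sw i) *m b).
  congr hull; apply/seteqP; split=> [_ [s sK [y Ey ->]]|_ [i _ [t _ <-]]].
    move: Ey; rewrite EE => -[t _ <-]; have ssw : s \in sw by rewrite short_wordsP.
    have isw : (index s sw < size sw)%N by rewrite index_mem.
    exists (Ordinal isw) => //; exists t => //=.
    by rewrite nth_index // mulmxDr -!scalemxAr.
  exists (nth [::] sw i); first by rewrite -short_wordsP mem_nth.
  exists (cos t *: a + sin t *: b); first by rewrite EE; exists t.
  by rewrite mulmxDr -!scalemxAr.
Qed.

Lemma dilateK (R : realType) (d : nat) (c : R) (G : set 'cV[R]_d) : c != 0 ->
  dilate c^-1 (dilate c G) = G.
Proof.
move=> c0; apply/seteqP; split=> [_ [_ [x Gx <-] <-]|x Gx].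
  by rewrite scalerA mulVf // scale1r.
by exists (c *: x); [exists x | rewrite scalerA mulVf // scale1r].
Qed.

Lemma hull_scaled_family (R : realType) (d m : nat) (B : 'I_m -> 'M[R]_d) (c : R)
    (G : set 'cV[R]_d) :
  hull (\bigcup_(i in [set: 'I_m]) [set (c *: B i) *m x | x in G]) =
  dilate c (hull (\bigcup_(i in [set: 'I_m]) [set B i *m x | x in G])).
Proof.
have dE (X : set 'cV[R]_d) : dilate c X = [set c%:M *m x | x in X].
  by apply/seteqP; split=> _ [x Xx <-]; exists x; rewrite ?mul_scalar_mx.
rewrite dE -hull_image_mulmx; congr hull; apply/seteqP; split.
  move=> _ [i _ [x Gx <-]]; exists (B i *m x); first by exists i => //; exists x.
  by rewrite mul_scalar_mx scalemxAl.
move=> _ [_ [i _ [x Gx <-]] <-]; exists i => //; exists x => //.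
by rewrite mul_scalar_mx scalemxAl.
Qed.

Lemma invariant_body_scaled (R : realType) (d m : nat) (B : 'I_m -> 'M[R]_d) (c : R)
    (G : set 'cV[R]_d) : c != 0 -> jsr (fun i => c *: B i) = c -> convex_body G ->
  invariant_body (fun i => c *: B i) G <->
  hull (\bigcup_(i in [set: 'I_m]) [set B i *m x | x in G]) = G.
Proof.
move=> c0 jc bG; split=> [[_]|e]; last by split => //; rewrite hull_scaled_family jc e.
by rewrite hull_scaled_family jc => /(congr1 (dilate c^-1)); rewrite !dilateK.
Qed.

Lemma cvg_nth_root (R : realType) (x : R) : 0 < x ->
  (fun n => x `^ n.+1%:R^-1) @ \oo --> (1 : R).
Proof.
move=> x0; have -> : (fun n => x `^ n.+1%:R^-1) = (fun n => expR (harmonic n * ln x)).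
  by apply/funext => n; rewrite /powR gt_eqF.
rewrite -[X in _ --> X]expR0; apply: continuous_cvg; first exact: continuous_expR.
rewrite -[X in _ --> X](mul0r (ln x)); apply: cvgMl.
exact: cvg_harmonic.
Qed.

Lemma powR_root_pow (R : realType) (x : R) n : 0 <= x -> (0 < n)%N ->
  (x `^ n%:R^-1) ^+ n = x.
Proof.
move=> x0 n0; rewrite -powR_mulrn ?powR_ge0 // -powRrM mulVf ?powRr1 //.
by rewrite pnatr_eq0 -lt0n.
Qed.

Lemma powR_pow_root (R : realType) (x : R) n : 0 <= x -> (0 < n)%N ->
  (x ^+ n) `^ n%:R^-1 = x.
Proof.
move=> x0 n0; rewrite -powR_mulrn // -powRrM mulfV ?powRr1 //.
by rewrite pnatr_eq0 -lt0n.
Qed.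

(** The maxima lie between constant multiples of [r ^+ n], and roots of the constants tend to 1. The
    sequence is shifted by one to avoid the exponent [0^-1 = 0]. *)
Lemma jsr_growth (R : realType) (d m : nat) (A : 'I_m -> 'M[R]_d) (r c C : R) :
  0 < r -> 0 < c -> (forall s, `|prod_word A s| <= C * r ^+ size s) ->
  (forall n, exists2 s, size s = n & c * r ^+ n <= `|prod_word A s|) -> jsr A = r.
Proof.
move=> r0 c0 hC hc; apply: cvg_lim => //.
rewrite -[X in X @ \oo --> _]/(fun n => _) -cvg_shiftS /=.
have C0 : 0 < C.
  have [s] := hc 0%N; move=> s0 h; have := le_trans h (hC s); rewrite s0 expr0 !mulr1.
  exact: lt_le_trans.
apply: (@squeeze_cvgr _ _ _ _ (fun n => c `^ n.+1%:R^-1 * r)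
  (fun n => C `^ n.+1%:R^-1 * r)).
- near=> n; have rn : 0 <= r ^+ n.+1 by rewrite exprn_ge0 // ltW.
  have root (x : R) : 0 <= x -> x `^ n.+1%:R^-1 * r = (x * r ^+ n.+1) `^ n.+1%:R^-1.
    by move=> x0; rewrite powRM // powR_pow_root // ltW.
  rewrite !root ?(ltW c0) ?(ltW C0) //; apply/andP; split.
    have [s /eqP sn hs] := hc n.+1.
    have hmax := le_bigmax 0 (fun t : n.+1.-tuple 'I_m => `|prod_word A t|) (Tuple sn).
    apply: ge0_ler_powR; rewrite ?invr_ge0 // ?nnegrE.
    - by rewrite mulr_ge0 // ltW.
    - exact: le_trans hmax.
    - exact: le_trans hs hmax.
  apply: ge0_ler_powR; rewrite ?invr_ge0 // ?nnegrE.
  - exact: bigmax_ge_id.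
  - by rewrite mulr_ge0 // ltW.
  apply/bigmax_leP; split=> [|t _]; first by rewrite mulr_ge0 // ltW.
  by have := hC t; rewrite size_tuple.
- by rewrite -[X in _ --> X]mul1r; apply: cvgMl; exact: cvg_nth_root.
- by rewrite -[X in _ --> X]mul1r; apply: cvgMl; exact: cvg_nth_root.
Unshelve. all: by end_near. Qed.

Lemma prod_word_zero (R : realType) (d m : nat) (A : 'I_m -> 'M[R]_d) s :
  (forall i, A i = 0) -> s <> [::] -> prod_word A s = 0.
Proof. by case: s => // i s A0 _; rewrite prod_word_cons A0 mul0mx. Qed.

Lemma jsr_zero (R : realType) (d m : nat) (A : 'I_m -> 'M[R]_d) :
  (forall i, A i = 0) -> jsr A = 0.
Proof.
move=> A0; apply: cvg_lim => //; apply/cvgrPdist_lt => e e0.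
exists 1%N => // n /= n1.
rewrite big1_idem; [|exact: maxxx|]; last first.
  move=> t _; rewrite prod_word_zero ?normr0 // => t0.
  by move: n1; rewrite -(size_tuple t) t0.
by rewrite powR0 ?invr_eq0 ?pnatr_eq0 -?lt0n // subr0 normr0.
Qed.

Lemma eigenvalue_scale (R : realType) (d : nat) (M : 'M[R]_d) (c : R) z :
  eigenvalue (complexify M) z -> eigenvalue (complexify (c *: M)) (c%:C * z).
Proof.
move=> /eigenvalueP[v vz v0]; apply/eigenvalueP; exists v => //.
have -> : complexify (c *: M) = c%:C *: complexify M.
  by apply/matrixP => i j; rewrite !mxE rmorphM.
by rewrite -scalemxAr vz scalerA.
Qed.

Lemma eigenvalue_scale_le (R : realType) (d : nat) (M : 'M[R]_d) (c theta : R) : 0 < c ->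
  (forall z, eigenvalue (complexify M) z -> cmod z <= theta) ->
  forall z, eigenvalue (complexify (c *: M)) z -> cmod z <= c * theta.
Proof.
move=> c0 hM z /(eigenvalue_scale c^-1); rewrite scalerA mulVf ?gt_eqF // scale1r.
move=> /hM; rewrite ComplexField.Normc.normcM cmod_real gtr0_norm ?invr_gt0 //.
by rewrite mulrC ler_pdivrMr // mulrC.
Qed.

Local Close Scope complex_scope.

(** * The zero family *)

Lemma zero_or_nonzero_family (R : realType) (d m : nat) (A : 'I_m -> 'M[R]_d) :
  (forall i, A i = 0) \/ (exists i, A i != 0).
Proof.
have [|/forallNP h] := pselect (exists i, A i != 0); first by right.
by left => i; apply/eqP/negPn/negP; exact: h.
Qed.

(** Every line is invariant under zero matrices, so the space itself is a line. *)
Lemma irreducible_zero_dim (R : realType) (d m : nat) (A : 'I_m -> 'M[R]_d.+1) :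
  irreducible_family A -> (forall i, A i = 0) -> d = 0%N.
Proof.
move=> irrA A0; pose v : 'cV[R]_d.+1 := delta_mx 0 0.
have v0 : v != 0.
  apply/eqP => e; have := congr1 (fun v : 'cV[R]_d.+1 => v 0 0) e.
  by rewrite !mxE /= => /eqP; rewrite oner_eq0.
have [|U0|U1] := irrA <[v]>%VS.
- by move=> i u _; rewrite A0 mul0mx mem0v.
- by move: v0; rewrite -memv0 -U0 memv_line.
have := dim_vline v; rewrite U1 v0 dimvf /= /dim /= => e.
by apply: succn_inj; rewrite -[LHS]muln1 e.
Qed.

(** Any convex set is invariant under the identity family, so the general uniqueness result, applied
    to that family in dimension one, shows that all convex bodies there are dilates of a single
    one. *)
Lemma symmetric_interval (R : realType) : exists G : set 'cV[R]_1,
  [/\ convex_body G, forall G', convex_body G' -> exists2 c : R, 0 < c & G' = dilate c G &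
      polytope G].
Proof.
pose I1 : 'I_1 -> 'M[R]_1 := fun=> 1%:M.
have I1s s : prod_word I1 s = 1%:M.
  by elim: s => [|i s IH]; rewrite ?prod_word_nil // prod_word_cons IH mul1mx.
have inv1 (G : set 'cV[R]_1) : convex_body G ->
    hull (\bigcup_(i in [set: 'I_1]) [set I1 i *m x | x in G]) = G.
  move=> [cG _ _ _]; rewrite -[RHS](hull_id cG); congr hull.
  apply/seteqP; split=> [_ [i _ [x Gx <-]]|x Gx]; first by rewrite mul1mx.
  by exists ord0 => //; exists x => //; rewrite mul1mx.
have irr1 : irreducible_family I1.
  move=> U _; have := dimvS (subvf U); rewrite dimvf /dim /= muln1 leq_eqVlt ltnS leqn0.
  case/orP => [/eqP h|]; last by rewrite dimv_eq0 => /eqP ->; left.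
  by right; apply/eqP; rewrite eqEdim subvf dimvf /dim /= muln1 h.
have eig1 z : eigenvalue (complexify (1%:M : 'M[R]_1)) z -> z = 1.
  move=> /eigenvalueP[v]; rewrite /complexify map_scalar_mx mulmx1 => vz v0.
  have /eqP : (1 - z) *: v = 0 by rewrite scalerBl scale1r -vz subrr.
  by rewrite scaler_eq0 (negPf v0) orbF subr_eq0 => /eqP.
have [zs [zsE szs zseig]] := char_poly_split (1%:M : 'M[R]_1).
have zs1 : zs = [:: 1].
  case: zs szs zseig {zsE} => [|z [|z' zs]] // _ h.
  by congr [:: _]; apply: eig1; rewrite -h mem_head.
have lead1 : unique_simple_leading (1%:M : 'M[R]_1) 1.
  split; last by move=> z /eig1.
    by split; [rewrite -zseig zs1 mem_head | move=> z /eig1 ->].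
  by rewrite zsE mup_count zs1 /= eqxx.
have r1 : is_real (1 : R[i]) by [].
have [] := @real_leading_set R 0 1%:M 1 1 ltr01 _ lead1 r1.
  by rewrite mul1r; exact: ComplexField.Normc.normc1.
rewrite scale1r => E specE fE.
have [|||||G [bG _ uG pG _]] := @invariant_body_of_leading_set R 0 1 I1 1 1 [:: ord0] E irr1.
- by move=> s; rewrite I1s mx_norm1_le.
- by [].
- exact: ltr01.
- move=> s sigma _ _ _; exists 0%N, (size s); rewrite rot0.
  by elim: s => // i s {1}->; rewrite /= wpowS (ord1 i).
- by rewrite I1s.
exists G; split => //; last exact: pG.
by move=> G' bG'; apply: uG => //; exact: inv1.
Qed.

(** * Normalisation of a nonzero family *)

Section NonzeroFamily.
Variables (R : realType) (d m : nat) (A : 'I_m -> 'M[R]_d.+1) (w : seq 'I_m) (l : R[i]).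
Hypothesis irrA : irreducible_family A.
Hypothesis domw : unique_dominant_product A w.
Hypothesis leadl : unique_simple_leading (prod_word A w) l.

Lemma dominant_spectral_bound : exists q e : R,
  [/\ 0 <= q, 0 < e, e <= 1, cmod l = q ^+ size w &
      forall s, s <> [::] -> ~ rot_power w s ->
        spectral_radius (prod_word A s) <= (1 - e) * q ^+ size s].
Proof.
have [wP _ [q [qP [e [e0 e1 hs]]]]] := domw.
have [w0 _] := wP w erefl; have nuw := qP w erefl.
have size_gt0 (s : seq 'I_m) : s <> [::] -> (0 < size s)%N by case: s.
exists q, e; split => //.
- by rewrite -nuw powR_ge0.
- have [ll _ _] := leadl; rewrite -(spectral_radius_leading ll) -nuw.
  by rewrite /nu powR_root_pow ?size_gt0 // spectral_radius_ge0.
move=> s s0 nrot; have n0 := size_gt0 s s0.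
have h : nu A s <= (1 - e) `^ (size s)%:R^-1 * q.
  apply: hs => // -[_ [_ [n [-> [k ->] sE]]]]; apply: nrot; by exists k, n.
rewrite -[leLHS](powR_root_pow _ n0) ?spectral_radius_ge0 //.
apply: (le_trans (lerXn2r (size s) _ _ h)); rewrite ?nnegrE ?powR_ge0 //.
  by rewrite mulr_ge0 ?powR_ge0 // -nuw powR_ge0.
by rewrite exprMn powR_root_pow ?subr_ge0.
Qed.

Lemma normalized_family : (exists i, A i != 0) -> exists r : R, exists B : 'I_m -> 'M[R]_d.+1,
  [/\ 0 < r, A = (fun i => r *: B i), irreducible_family B, jsr A = r &
    exists C eps c : R, [/\ 0 < eps, forall s, `|prod_word B s| <= C,
      forall s (sigma : R), s <> [::] -> 1 <= `|sigma| ->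
        `|\det (sigma%:M - prod_word B s)| < eps -> rot_power w s,
      0 < c /\ c * cmod l = 1 & prod_word B w = c *: prod_word A w]].
Proof.
move=> A0; have [r r0 [[C hC] rmin]] := growth_rate irrA A0.
have [q [e [q0 e0 e1 lq hs]]] := dominant_spectral_bound.
have [wP _ _] := domw; have [w0 _] := wP w erefl.
pose B i := r^-1 *: A i.
have rV0 : 0 < r^-1 by rewrite invr_gt0.
have Bs s : prod_word B s = r^-1 ^+ size s *: prod_word A s by exact: prod_word_scale.
have rs (s : seq 'I_m) : 0 < r^-1 ^+ size s by rewrite exprn_gt0.
have AB : A = (fun i => r *: B i).
  by apply/funext => i; rewrite /B scalerA divff ?scale1r // gt_eqF.
have BC s : `|prod_word B s| <= C.
  by rewrite Bs normrZ gtr0_norm // exprVn mulrC ler_pdivrMr ?exprn_gt0.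
have Bmin (t : R) : 0 <= t -> t < 1 -> ~ growth_bounded B t.
  move=> t0 t1 [C' hC']; apply: (rmin (r * t)).
  - by rewrite mulr_ge0 // ltW.
  - by rewrite gtr_pMr.
  exists C' => s; have := hC' s; rewrite Bs normrZ gtr0_norm // exprMn.
  rewrite exprVn mulrC ler_pdivrMr ?exprn_gt0 // => h; apply: le_trans h _.
  by rewrite -mulrA [t ^+ _ * _]mulrC.
have irrB : irreducible_family B.
  move=> U hU; apply: irrA => i v vU; rewrite -[A i](scalerKV (_ : r != 0)) ?gt_eqF //.
  by rewrite -scalemxAl memvZ // hU.
have ll : leading_eigenvalue (prod_word A w) l by case: leadl.
pose c := r^-1 ^+ size w.
have cl1 : c * cmod l <= 1.
  have := eigenvalue_scale c ll.1; rewrite -Bs => /(eigenvalue_power_bounded BC).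
  by rewrite ComplexField.Normc.normcM cmod_real gtr0_norm ?(rs w).
have wsize : (0 < size w)%N by case: (w) w0.
have qr1 : q / r <= 1.
  rewrite leNgt; apply/negP => h; move: cl1; rewrite lq mulrC -exprMn leNgt.
  by rewrite exprn_egt1 // -lt0n wsize.
(* The threshold is the determinant bound for a matrix of order [d.+1] whose eigenvalues have
   modulus at most [1 - e], evaluated at [|sigma| = 1]. *)
have eps0 : 0 < e ^+ d.+1 by rewrite exprn_gt0.
have Bw s (sigma : R) : s <> [::] -> 1 <= `|sigma| ->
    `|\det (sigma%:M - prod_word B s)| < e ^+ d.+1 -> rot_power w s.
  move=> s0 s1 hdet; apply: contrapT => nrot.
  have eig z : eigenvalue (complexify (prod_word B s)) z -> cmod z <= 1 - e.
    rewrite Bs => /(eigenvalue_scale_le (rs s) (fun z => @le_spectral_radius _ _ _ z)) h.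
    apply: le_trans h _.
    apply: (@le_trans _ _ (r^-1 ^+ size s * ((1 - e) * q ^+ size s))).
      by rewrite ler_pM2l // hs.
    rewrite mulrCA ler_piMr ?subr_ge0 // -exprMn exprn_ile1 //.
      by rewrite mulr_ge0 // ltW.
    by rewrite mulrC.
  have := det_lower_bound eig (le_trans (_ : 1 - e <= 1) s1).
  rewrite gerBl (ltW e0) => /(_ isT); rewrite leNgt; move/negP; apply.
  apply: lt_le_trans hdet _; rewrite lerXn2r ?nnegrE ?(ltW e0) //; lra.
have Bw1 : near_singular_periodic B w (e ^+ d.+1).
  by move=> s s0; apply: (@Bw s 1); rewrite ?normr1.
have [z ez z1] := dominant_eigenvalue_modulus BC Bmin eps0 Bw1.
(* Since [c * cmod l = (q / r) ^+ size w], this is the equality of [q] with the growth rate [r]. *)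
have cl : c * cmod l = 1.
  apply/eqP; rewrite eq_le cl1 /=; apply: le_trans z1 _.
  by move: ez; rewrite Bs => /(eigenvalue_scale_le (rs w) ll.2).
exists r, B; split => //; last first.
  by exists C, (e ^+ d.+1), c; split; rewrite ?Bs //; split; first exact: (rs w).
apply: (@jsr_growth _ _ _ _ r (d.+1%:R^-1) C) => // n.
have [s sn hsn] := normalized_lower_bound BC Bmin n; exists s => //.
move: hsn; rewrite Bs normrZ gtr0_norm // sn exprVn => h.
rewrite mulrC ler_pdivrMr // mulrC.
by move: h; rewrite mulrCA -ler_pdivrMl ?invr_gt0 ?exprn_gt0 // invrK mulr1.
Qed.

End NonzeroFamily.

Theorem theorem1 (R : realType) (d m : nat) (m_gt0 : (0 < m)%N)
    (A : 'I_m -> 'M[R]_d) (irrA : irreducible_family A)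
    (w : seq 'I_m) (domw : unique_dominant_product A w)
    (l : R[i]) (leadl : unique_simple_leading (prod_word A w) l)
    (hl : is_real l \/ complex_irrational_arg l) :
  exists G : set 'cV[R]_d,
    [/\ invariant_body A G,
        forall G', invariant_body A G' -> exists2 c : R, 0 < c & G' = dilate c G,
        is_real l -> polytope G &
        complex_irrational_arg l -> hull_of_ellipses G].
Proof.
have [[el _] _ _] := leadl.
case: d A irrA domw leadl el => [|d] A irrA domw leadl el.
  by move: el => /eigenvalueP[v _]; rewrite thinmx0 eqxx.
have [wP _ _] := domw; have [w0 _] := wP w erefl.
(* The zero family has joint spectral radius 0 and cannot be normalised. There invariance reads
   [{0} = 0 G], true for every convex body, and uniqueness survives because irreducibility forces
   dimension one. *)
have [A0|A0] := zero_or_nonzero_family A.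
  have d0 := irreducible_zero_dim irrA A0.
  subst d; have [G [bG uG pG]] := symmetric_interval R.
  have l0 : l = 0.
    move: el; rewrite prod_word_zero // /complexify map_mx0 => /eigenvalueP[v].
    rewrite mulmx0 => /esym/eqP; rewrite scaler_eq0 => /orP[/eqP //|/eqP ->].
    by rewrite eqxx.
  exists G; split => //; last by rewrite l0 => -[]; case.
    split=> //; rewrite jsr_zero //; have G0 : G 0.
      have [cG _ [y /interior_subset Gy] sG] := bG.
      exact: symmetric_convex0 cG sG Gy.
    rewrite (_ : \bigcup_(i in _) _ = [set 0]).
      rewrite hull_id; last first.
        by apply/convexP => _ _ t -> -> _ _ /=; rewrite !scaler0 addr0.
      by apply/seteqP; split=> [_ ->|_ [x _ <-]]; [exists 0 | rewrite scale0r]; rewrite // scale0r.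
    apply/seteqP; split=> [_ [i _ [x _ <-]]|_ ->]; first by rewrite A0 mul0mx.
    by exists (Ordinal m_gt0) => //; exists 0; rewrite ?mulmx0.
  by move=> G' [bG' _]; exact: uG.
have [r [B [r0 AB irrB jA [C [eps [c [eps0 BC Bw [c0 cl] Bc]]]]]]] :=
  normalized_family irrA domw leadl A0.
have r1 : r != 0 by rewrite gt_eqF.
have scaled G : convex_body G -> invariant_body A G <->
    hull (\bigcup_(i in [set: 'I_m]) [set B i *m x | x in G]) = G.
  by move=> bG; subst A; exact: (invariant_body_scaled r1 jA bG).
have [E [specE realE complexE]] : exists E : set 'cV[R]_d.+1,
    [/\ leading_set_spec (prod_word B w) E, is_real l -> finite_set E &
        complex_irrational_arg l -> exists a b, E = ellipse a b].
  rewrite Bc; case: hl => hl.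
    have [E specE fE] := real_leading_set c0 cl leadl hl.
    by exists E; split => // -[].
  have [a [b specE]] := complex_leading_set c0 cl leadl hl.
  exists (ellipse a b); split=> //; last by exists a, b.
  by move=> rl; case: hl.
have [G [bG iG uG pG eG]] := invariant_body_of_leading_set irrB BC w0 eps0 Bw specE.
exists G; split.
- exact/scaled.
- by move=> G' iG'; have [bG' _] := iG'; apply: uG => //; apply/scaled.
- by move=> /realE; exact: pG.
- by move=> /complexE[a [b]]; exact: eG.
Qed.
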